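(* Let $\Lambda$ be a strictly increasing (infinite) sequence of non-negative real numbers satisfying the Müntz condition $\sum_{\lambda\in\Lambda\setminus\{0\}}1/\lambda<\infty$. The Volterra and Cesàro operators $V_\Lambda,\Gamma_\Lambda: M_\Lambda^1\to C([0,1])$ are finitely strictly singular. Moreover, the growth of their Bernstein numbers is of order $\frac1n$: for each $T\in\{V_\Lambda,\Gamma_\Lambda\}$ there are constants $c,C>0$ such that $\frac{c}{n}\le b_n(T)\le\frac{C}{n}$ for all $n\ge1$. For every $n\ge1$, we have $$b_{n}(V_\Lambda)\ge\frac{1}{2n-1}\quad\text{and}\quad b_{n}(\Gamma_\Lambda)\ge\frac{1}{2n-1}.$$ In particular, in the case of real valued functions (real scalars), we have $b_{n}(V_\Lambda)=\frac{1}{2n-1}$ for every $n\ge1$.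
   Context: Functions may be real or complex valued (with the corresponding scalar field) unless specified. $M_\Lambda$ is the linear span of the monomials $x^\lambda$, $\lambda\in\Lambda$, as functions on $[0,1]$; $M_\Lambda^1$ is the closure of $M_\Lambda$ in $L^1([0,1])$ (Lebesgue measure), with the $L^1$-norm; $C([0,1])$ carries the supremum norm. Under the Müntz condition, every $f\in M_\Lambda^1$ coincides almost everywhere with a (unique) function that is analytic on $(0,1)$ and continuous on $[0,1)$ (it is a known fact that for every $c\in(0,1)$ there is a constant $N_c$ with $\sup_{[0,c]}|f|\le N_c\|f\|_1$ for all $f\in M_\Lambda^1$); $f$ is identified with this function on $[0,1)$, and in particular $f(0)$ denotes its value at $0$. For $f\in M_\Lambda^1$: $V_\Lambda(f)(x)=\int_0^x f(t)\,dt$ for $x\in[0,1]$; $\Gamma_\Lambda(f)(0)=f(0)$ and $\Gamma_\Lambda(f)(x)=\frac1x\int_0^x f(t)\,dt$ for $x\in(0,1]$. An operator $T:X\to Y$ between Banach spaces is finitely strictly singular if for every $\varepsilon>0$ there exists $N_\varepsilon\ge1$ such that every subspace $E$ of $X$ with dimension greater than $N_\varepsilon$ contains a vector $v$ with $\|v\|=1$ and $\|T(v)\|\le\varepsilon$. The $n$-th Bernstein number of $T$ is $$b_n(T)=\sup_{E\subset X,\ \dim E=n}\ \inf_{v\in E,\ \|v\|=1}\|T(v)\|.$$ *)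

(* Defs.v *)
From HB Require Import structures.
From mathcomp Require Import all_boot all_order all_algebra.
From mathcomp Require Import complex.
From mathcomp Require Import all_classical all_reals all_analysis.

Set Implicit Arguments.
Unset Strict Implicit.
Unset Printing Implicit Defensive.

Import Order.TTheory GRing.Theory Num.Theory.
Import numFieldNormedType.Exports.

Local Open Scope classical_set_scope.
Local Open Scope ring_scope.

(* A normed space is given by a linear subspace [X] of an ambient space [V] and
   a norm [V -> \bar R] that is finite on [X].  Extended real norms, infima and
   suprema avoid any default value on unbounded sets. *)

Section subspaces.
Variables (K : numFieldType) (V : lmodType K).

Definition linear_subspace (E : set V) : Prop := submod_closed (mem E).

Definition linearly_independent (n : nat) (e : 'I_n -> V) : Prop :=
  forall c : 'I_n -> K, \sum_(i < n) c i *: e i = 0 -> forall i, c i = 0.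

Definition finite_span (n : nat) (e : 'I_n -> V) : set V :=
  [set \sum_(i < n) c i *: e i | c in [set: 'I_n -> K]].

Definition has_dim (E : set V) (n : nat) : Prop :=
  exists2 e : 'I_n -> V, linearly_independent e & E = finite_span e.

(* [E] may be infinite dimensional. *)
Definition dim_gt (E : set V) (N : nat) : Prop :=
  exists2 e : 'I_N.+1 -> V, linearly_independent e & forall i, E (e i).

End subspaces.

Section operators.
Variables (R : realType) (K : numFieldType) (V W : lmodType K).
Variables (X : set V) (normX : V -> \bar R) (Y : set W) (normY : W -> \bar R).
Variable T : V -> W.
Local Open Scope ereal_scope.

Definition bounded_linear_operator : Prop :=
  [/\ forall v, X v -> Y (T v),
      forall (a : K) u v, X u -> X v -> T (a *: u + v)%R = (a *: T u + T v)%R &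
      exists M : R, forall v, X v -> normY (T v) <= M%:E * normX v].

Definition finitely_strictly_singular : Prop :=
  forall eps : R, (0 < eps)%R ->
  exists2 N : nat, (1 <= N)%N &
  forall E : set V, linear_subspace E -> E `<=` X -> dim_gt E N ->
  exists v, [/\ E v, normX v = 1 & normY (T v) <= eps%:E].

Definition bernstein_number (n : nat) : \bar R :=
  ereal_sup [set ereal_inf [set normY (T v) | v in [set v | E v /\ normX v = 1]]
            | E in [set E : set V | E `<=` X /\ has_dim E n]].

End operators.

Variant scalars := RealScalars | ComplexScalars.

Definition scalar_field (R : realType) (s : scalars) : numFieldType :=
  match s with RealScalars => R | ComplexScalars => R[i] end.

Definition real_part (R : realType) (s : scalars) : scalar_field R s -> R :=
  match s return scalar_field R s -> R with
  | RealScalars => fun x => x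
  | ComplexScalars => fun z => complex.Re z
  end.

Definition imag_part (R : realType) (s : scalars) : scalar_field R s -> R :=
  match s return scalar_field R s -> R with
  | RealScalars => fun=> 0
  | ComplexScalars => fun z => complex.Im z
  end.

(* [a + i b]; the second argument is ignored for real scalars. *)
Definition of_parts (R : realType) (s : scalars) : R -> R -> scalar_field R s :=
  match s return R -> R -> scalar_field R s with
  | RealScalars => fun a _ => a
  | ComplexScalars => fun a b => complex.Complex a b
  end.

(* The norm of a [numFieldType] takes values in the field itself. *)
Definition modulus (R : realType) (s : scalars) (z : scalar_field R s) : R :=
  real_part `|z|.

Section muntz.
Variables (R : realType) (s : scalars).
Local Notation K := (scalar_field R s).
Local Notation mu := (@lebesgue_measure R).

Definition integrable_on (D : set R) (f : R -> K) : Prop :=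
  mu.-integrable D (fun t => (real_part (f t))%:E) /\
  mu.-integrable D (fun t => (imag_part (f t))%:E).

Definition scalar_integral (D : set R) (f : R -> K) : K :=
  of_parts s (\int[mu]_(t in D) real_part (f t))
             (\int[mu]_(t in D) imag_part (f t)).

Definition L1_norm (f : R -> K) : \bar R :=
  (\int[mu]_(t in `[0%R, 1%R]) (modulus (f t))%:E)%E.

Definition sup_norm (f : R -> K) : \bar R :=
  ereal_sup [set (modulus (f x))%:E | x in `[0, 1]].

Definition continuous_01 : set (R -> K) :=
  [set f : R -> K | {within `[(0 : R), 1], continuous f}].

Definition muntz_condition (Lambda : nat -> R) : Prop :=
  (\sum_(0 <= n <oo | Lambda n != 0%R) ((Lambda n)^-1)%:E < +oo)%E.

Definition monomial (lambda : R) : R -> K := fun x => of_parts s (x `^ lambda) 0.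

Definition muntz_span (Lambda : nat -> R) : set (R -> K) :=
  [set p : R -> K | exists n, finite_span (fun k : 'I_n => monomial (Lambda k)) p].

Definition L1_closure (A : set (R -> K)) : set (R -> K) :=
  [set f : R -> K | integrable_on `[0, 1] f /\
     forall eps : R, 0 < eps ->
       exists2 p, A p & (L1_norm (f - p)%R < eps%:E)%E].

(* The classes (modulo null sets) of the closure of the span are represented by
   their unique representative that is continuous on [0, 1[, extended by 0, so
   that equality is equality of functions, [L1_norm] is a norm, and [f 0] is
   the value at 0.  Under the Muntz condition every class has one, and it is
   analytic on ]0, 1[. *)
Definition muntz_L1 (Lambda : nat -> R) : set (R -> K) :=
  [set f : R -> K | [/\ L1_closure (muntz_span Lambda) f,
               {within `[(0 : R), 1[, continuous f} &
               forall x, ~~ (0 <= x < 1) -> f x = 0]].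

Definition volterra_op (f : R -> K) : R -> K := fun x => scalar_integral `[0, x] f.

Definition cesaro_op (f : R -> K) : R -> K :=
  fun x => if x == 0 then f 0 else of_parts s x^-1 0 * volterra_op f x.

End muntz.

(* Main.v *)
Require Import Defs.
From HB Require Import structures.
From mathcomp Require Import all_boot all_order all_algebra.
From mathcomp Require Import all_classical all_reals all_analysis.
From mathcomp Require Import complex measurable_realfun.
From mathcomp Require Import zify ring lra.
Import Order.TTheory GRing.Theory Num.Theory.
Import numFieldNormedType.Exports.
Set Implicit Arguments.
Unset Strict Implicit.
Unset Printing Implicit Defensive.
Local Open Scope classical_set_scope.
Local Open Scope ring_scope.

(** The theorem rests on one upper and one lower estimate.

Upper estimate.  Both operators turn the L1 norm of [f] into a bound for the total
variation of the image.  For the Volterra operator the value at the first point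
plus the variation is at most the norm.  On the other side, every real space of
dimension [n] of continuous functions contains, up to an arbitrarily small error, a
function of sup norm 1 that takes the values 1 and -1 alternately at [n] points
([oscillating_combination]); its first value plus its variation is at least
[1 + 2 (n - 1) = 2 n - 1].  Applied to the image of a subspace of dimension [n], this
yields a vector of norm 1 whose image has sup norm at most [C / (2 n - 1)], with
[C = 1] for the Volterra operator.  With complex scalars the subspace has real
dimension [2 n], and the real and imaginary parts are listed one after the other,
which costs only a constant ([small_image_parts]).  This gives the finite strict
singularity and the upper bounds.

The alternating function comes from a statement on subspaces of a finite dimensional
space with the sup norm ([zigzag_vector]).  The unit ball of a subspace of dimension
[k] in general position is a simple polytope; its vertices carry [k] signs, and the
number of pairs of opposite vertices whose signs alternate is odd.  The proof is by
induction on the dimension, in the manner of Ky Fan: in the half of the polytope above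
a hyperplane, the edges with alternating signs form paths whose ends are the
alternating vertices of the half polytope and of the hyperplane section
([odd_zigzag_step]).

For the Cesaro operator the bound on the variation is where the Muntz condition
enters ([cesaro_variation]).  A family of [n] powers with exponents at least [l] is
reproduced by a combination, with exponentially small coefficients, of its dilations
by factors at most [exp (c n / l)] ([reproducing_block]).  Composing such combinations
over dyadic blocks of exponents keeps the dilation factors bounded, by Cauchy
condensation and the summability of the inverses of the exponents, and produces one combination of dilations with
mass at most 1/2 for all positive exponents ([muntz_reproducing]).  Hence the
variation of a Muntz polynomial near 0 is at most half of its total variation, and
its total variation is controlled away from 0, where the mean of [f] is harmless
([muntz_variation]).

Lower estimate ([bernstein_number_ge]).  For a very lacunary choice of [n] exponents,
there are points at which the powers are almost 1 up to a given index and almost 0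
after it.  The image of a combination of normalized powers then nearly takes the
partial sums [s_j] of the coefficients as values, and the sum of the moduli of the
coefficients, which bounds the L1 norm, is at most [(2 n - 1) * max_j |s_j|].  This is
insensitive to the scalar field, and the modulus of the Cesaro image is at least that
of the Volterra image on ]0, 1[. *)

(** * Alternating sign patterns *)

Fixpoint alternating (b : bool) (s : seq bool) : bool :=
  if s is x :: s' then (x == b) && alternating (~~ b) s' else true.

Section patterns.
Variable I : finType.
Implicit Types (X : {ffun I -> option bool}) (r : seq I).

Definition clear X (j : I) : {ffun I -> option bool} :=
  [ffun i => if i == j then None else X i].

Definition put X (j : I) (e : bool) : {ffun I -> option bool} :=
  [ffun i => if i == j then Some e else X i].

Lemma eq_pmap_in (f g : I -> option bool) r : {in r, f =1 g} -> pmap f r = pmap g r.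
Proof.
elim: r => //= i r IH fg; rewrite fg ?mem_head// IH// => j jr.
by apply: fg; rewrite in_cons jr orbT.
Qed.

Lemma pmap_clear X j r : j \notin r -> pmap (clear X j) r = pmap X r.
Proof.
move=> jr; apply: eq_pmap_in => i ir; rewrite ffunE.
by case: eqP ir jr => // -> ->.
Qed.

(** A sequence that alternates becomes alternating with first sign [b] by deleting
either its last or its first term, according to its own first sign; a sequence
with exactly one pair of equal neighbours does so by deleting either member of
the pair; any other sequence cannot be repaired by one deletion.  Only parities
matter below, and these obey a recursion along [r] that avoids the case
analysis. *)
Lemma odd_alternating_deletions b r X : uniq r ->
  odd (count (fun j => (X j != None) && alternating b (pmap (clear X j) r)) r) =
  alternating b (pmap X r) (+) alternating (~~ b) (pmap X r).
Proof.
elim: r b => [|i r IH] b //= /andP[ir ur].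
rewrite ffunE eqxx/= (pmap_clear _ ir).
have cl j : j \in r -> clear X j i = X i.
  by rewrite ffunE; case: eqP ir => // -> /negP.
case Xi : (X i) => [x|] /=.
  rewrite oddD.
  have -> : count (fun j => (X j != None) &&
      alternating b (oapp (cons^~ (pmap (clear X j) r)) (pmap (clear X j) r)
        (clear X j i))) r =
    if x == b then count (fun j => (X j != None) &&
      alternating (~~ b) (pmap (clear X j) r)) r else 0%N.
    case: ifP => xb.
      by apply: eq_in_count => j /cl ->; rewrite Xi /= xb.
    rewrite -(count_pred0 r); apply: eq_in_count => j /cl ->.
    by rewrite Xi/= xb andbF.
  case: (eqVneq x b) => [xb|]; last first.
    by move=> {Xi}; case: x b {IH cl} => -[]//= _; rewrite ?addbF oddb.
  rewrite IH// negbK oddb xb.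
  by move=> {Xi IH xb cl}; case: b => /=; case: alternating; case: alternating.
rewrite -IH//; congr (odd _); rewrite add0n; apply: eq_in_count => j jr.
by rewrite cl// Xi.
Qed.

Lemma size_pmap_card X : size (pmap X (enum I)) = #|[pred i | X i != None]|.
Proof.
rewrite size_pmap cardE enumT /enum_mem size_filter.
by apply: eq_count => i /=; rewrite !inE; case: (X i).
Qed.
End patterns.

(** * End points of a segment cut out by finitely many intervals *)

Section line_parity.
Variables (R : realFieldType) (I : finType).

Lemma card_pred1_if (P : {pred I}) a (b : bool) :
  (forall j, (j \in P) = (j == a) && b) -> #|P| = b.
Proof.
case: b => PE; last by rewrite eq_card0 // => j; rewrite PE andbF.
by rewrite (@eq_card _ _ (pred1 a)) ?card1 // => j; rewrite PE andbT.
Qed.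

(** The common part of the intervals is empty or is [[lo a, hi b]] with [a] and [b]
unique, so a half line starting at 0 meets its boundary in 0 or 2 points, once
the point 0 itself is counted when it lies inside. *)
Lemma interval_endpoints_parity (J : {pred I}) (lo hi : I -> R) (j0 : I) :
  j0 \in J ->
  {in J, forall j, lo j < hi j} ->
  {in J &, injective lo} -> {in J &, injective hi} ->
  {in J &, forall i j, lo i != hi j} ->
  {in J, forall j, lo j != 0 /\ hi j != 0} ->
  let inside t := [forall (i | i \in J), lo i <= t <= hi i] in
  odd (#|[pred j in J | (0 < lo j) && inside (lo j)]| +
       #|[pred j in J | (0 < hi j) && inside (hi j)]|) = inside 0.
Proof.
move=> Jj0 lohi loI hiI lonhi n0 inside.
case: (arg_maxP lo Jj0) => a Ja maxa0.
have maxa i : i \in J -> lo i <= lo a by exact: maxa0.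
case: (arg_minP hi Jj0) => b Jb minb0.
have minb i : i \in J -> hi b <= hi i by exact: minb0.
have insideE t : inside t = (lo a <= t <= hi b).
  apply/forall_inP/andP => [H|[at_ tb] i Ji].
    by split; [case/andP: (H a Ja)|case/andP: (H b Jb)].
  by rewrite (le_trans (maxa i Ji) at_) (le_trans tb (minb i Ji)).
rewrite (@card_pred1_if _ a ((0 < lo a) && (lo a < hi b))); last first.
  move=> j; rewrite inE insideE; apply/andP/idP => [[Jj /and3P[j0' aj jb]]|].
    have /eqP ja : j == a by rewrite -(inj_in_eq loI)// eq_le maxa.
    by rewrite -ja eqxx j0' lt_neqAle jb lonhi.
  by case/and3P => /eqP -> -> ab; rewrite lexx (ltW ab).
rewrite (@card_pred1_if _ b ((0 < hi b) && (lo a < hi b))); last first.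
  move=> j; rewrite inE insideE; apply/andP/idP => [[Jj /and3P[j0' aj jb]]|].
    have /eqP jb' : j == b by rewrite -(inj_in_eq hiI)// eq_le minb// andbT.
    by rewrite -jb' eqxx j0' lt_neqAle aj lonhi.
  by case/and3P => /eqP -> -> ab; rewrite lexx (ltW ab).
rewrite insideE oddD !oddb.
have [la0 _] := n0 a Ja; have [_ hb0] := n0 b Jb.
rewrite [0 < hi b]lt_neqAle [lo a <= 0]le_eqVlt (negPf la0) eq_sym hb0 /=.
case: (ltgtP 0 (lo a)) la0 => //= [la0|la0] _.
  case: (ltP (lo a) (hi b)) => //= ab; last by rewrite andbF.
  by rewrite ltW// (lt_trans la0).
by case: (leP 0 (hi b)) => //= h0b; rewrite (lt_le_trans la0).
Qed.

Definition sign_val (b : bool) : R := if b then 1 else -1.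

Lemma sign_valN b : sign_val (~~ b) = - sign_val b.
Proof. by case: b; rewrite /= ?opprK. Qed.

Lemma normr_sign_val b : `|sign_val b| = 1.
Proof. by case: b; rewrite /= ?normrN normr1. Qed.

Lemma card_pair_bool (P : {pred I * bool}) :
  #|P| = (#|[pred j | P (j, true)]| + #|[pred j | P (j, false)]|)%N.
Proof.
have -> : #|P| = (\sum_i \sum_b if (i, b) \in P then 1 else 0)%N.
  by rewrite pair_bigA -sum1_card big_mkcond; apply: eq_bigr => -[].
rewrite -!sum1_card [in RHS]big_mkcond [X in (_ + X)%N]big_mkcond -big_split /=.
by apply: eq_bigr => i _; rewrite big_bool.
Qed.

(** The line [al + t * be] meets the cube in a segment.  Its half [0 < t] leaves the
cube an odd number of times exactly when it starts inside; [root q] is the time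
at which coordinate [q.1] takes the value given by the sign [q.2]. *)
Lemma line_parity (J : {pred I}) (al be : I -> R) (j0 : I) :
  j0 \in J ->
  {in J, forall j, be j != 0} -> {in J, forall j, `|al j| != 1} ->
  (forall t, {in J &, forall i j, `|al i + t * be i| = 1 ->
    `|al j + t * be j| = 1 -> i = j}) ->
  let inside t := [forall (i | i \in J), `|al i + t * be i| <= 1] in
  let root q := (sign_val q.2 - al q.1) / be q.1 in
  odd #|[pred q : I * bool | [&& q.1 \in J, 0 < root q & inside (root q)]]| =
  inside 0.
Proof.
move=> Jj0 be0 al1 uniq1 inside root.
pose hi j := root (j, 0 < be j); pose lo j := root (j, ~~ (0 < be j)).
have rootE q : q.1 \in J -> al q.1 + root q * be q.1 = sign_val q.2.
  by move=> /be0 b0; rewrite /root divfK// addrC subrK.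
have root1 q : q.1 \in J -> `|al q.1 + root q * be q.1| = 1.
  by move=> qJ; rewrite rootE// normr_sign_val.
have rootI q q' : q.1 \in J -> q'.1 \in J -> root q = root q' -> q = q'.
  move=> qJ q'J qq'; have E : q.1 = q'.1.
    by apply: (uniq1 (root q)) => //; rewrite ?root1// qq' root1.
  have : sign_val q.2 = sign_val q'.2 by rewrite -!rootE// qq' E.
  case: q q' E {qJ q'J qq'} => [i b] [i' b'] /= ->.
  by case: b b' => -[] //= ?; exfalso; lra.
have betw j t : j \in J -> (`|al j + t * be j| <= 1) = (lo j <= t <= hi j).
  move=> Jj; rewrite ler_norml /lo /hi /root /=.
  have [b0|b0|b0] := ltgtP 0 (be j); last by have := be0 j Jj; rewrite -b0 eqxx.
    by rewrite ler_pdivrMr// ler_pdivlMr//= lerBlDl lerBrDl.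
  by rewrite ler_ndivrMr// ler_ndivlMr//= lerBlDl lerBrDl andbC.
have insideE t : inside t = [forall (i | i \in J), lo i <= t <= hi i].
  by apply: eq_forallb_in => i iJ; rewrite betw.
have loE j : j \in J -> `|al j + lo j * be j| = 1.
  exact: (root1 (j, ~~ (0 < be j))).
have hiE j : j \in J -> `|al j + hi j * be j| = 1.
  exact: (root1 (j, 0 < be j)).
rewrite insideE -(@interval_endpoints_parity J lo hi j0 Jj0).
- have cardS (P : {pred I}) : #|P| = (\sum_j (j \in P))%N.
    by rewrite -sum1_card big_mkcond; apply: eq_bigr => j _; case: (j \in P).
  rewrite card_pair_bool !cardS -!big_split /=; congr (odd _).
  apply: eq_bigr => j _; rewrite !inE /= !insideE /lo /hi.
  by case: (j \in J) => //=; case: (0 < be j) => //=; rewrite addnC.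
- move=> j Jj; rewrite /lo /hi /root /=.
  have [b0|b0|b0] := ltgtP 0 (be j); last by have := be0 j Jj; rewrite -b0 eqxx.
    by rewrite ltr_pM2r ?invr_gt0//=; lra.
  by rewrite ltr_nM2r ?invr_lt0//=; lra.
- by move=> i j iJ jJ E; case: (rootI (i, ~~ (0 < be i)) (j, ~~ (0 < be j)) iJ jJ E).
- by move=> i j iJ jJ E; case: (rootI (i, 0 < be i) (j, 0 < be j) iJ jJ E).
- move=> i j iJ jJ; apply/eqP => E.
  case: (rootI (i, ~~ (0 < be i)) (j, 0 < be j) iJ jJ E) => <-.
  by case: (0 < be i).
- move=> j jJ; split; apply: contra (al1 j jJ) => /eqP E.
    by rewrite -(loE j jJ) E mul0r addr0.
  by rewrite -(hiE j jJ) E mul0r addr0.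
Qed.
End line_parity.

(** * Vertices and edges of a generic section of a cube *)

Section vertices.
Variables (R : realFieldType) (N : nat).
Implicit Types (X Y : {ffun 'I_N -> option bool}).

Definition tight (x : R) : option bool :=
  if x == 1 then Some true else if x == -1 then Some false else None.

Lemma tightP x b : reflect (x = sign_val R b) (tight x == Some b).
Proof.
rewrite /tight; apply: (iffP eqP) => [|->].
  by case: eqP => [-> [<-]//|_]; case: eqP => [-> [<-]|].
by case: b => /=; rewrite eqxx// eqNr oner_eq0.
Qed.

Lemma tight_None x : (tight x != None) = (`|x| == 1).
Proof.
rewrite /tight eqr_norml ler01 andbT.
by case: (x == 1); case: (x == -1).
Qed.

(** General position of the row space of [A] with respect to the coordinate hyperplanes
and to the facets of the cube: no coincidence beyond what the dimension forces.
The section of the cube is then a simple polytope. *)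
Definition generic k (A : 'M[R]_(k, N)) : Prop :=
  (forall c : 'rV_k, c != 0 -> (#|[pred i | ((c *m A) 0 i == 0)%R]| < k)%N) /\
  (forall c : 'rV_k, (#|[pred i | (`|(c *m A) 0 i| == 1)%R]| <= k)%N).

(** The sign pattern records where the vector touches the boundary of the cube; for
generic [A] a pattern with [k] signs comes from one [c] only, so patterns can be
counted instead of vectors. *)
Definition vertex k (A : 'M[R]_(k, N)) X (c : 'rV_k) : Prop :=
  (forall i, `|(c *m A) 0 i| <= 1) /\ (forall i, tight ((c *m A) 0 i) = X i).

Definition supp X : {pred 'I_N} := [pred i | X i != None].

Definition signs X : seq bool := pmap X (enum 'I_N).

Lemma interpolate k (A : 'M[R]_(k, N)) (S : {pred 'I_N}) (x : 'I_N -> R) :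
  generic A -> #|S| = k -> exists c : 'rV_k, {in S, forall i, (c *m A) 0 i = x i}.
Proof.
move=> [A0 _] Sk.
pose AS : 'M[R]_(k, #|S|) := \matrix_(i, j) A i (enum_val j).
have ASE (c : 'rV_k) j : (c *m AS) 0 j = (c *m A) 0 (enum_val j).
  by rewrite !mxE; apply: eq_bigr => i _; rewrite !mxE.
have /row_fullP[M MAS] : row_full AS.
  have: row_free AS.
    apply: inj_row_free => c cAS; apply/eqP; apply: contraTT isT => c0.
    have := A0 c c0; rewrite ltnNge -[leqLHS]Sk subset_leq_card//.
    apply/fintype.subsetP => i iS; rewrite inE -(enum_rankK_in iS iS) -ASE cAS.
    by rewrite mxE.
  by rewrite /row_free /row_full => /eqP ->; rewrite Sk.
exists ((\row_j x (enum_val j)) *m M) => i iS.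
by rewrite -(enum_rankK_in iS iS) -ASE -mulmxA MAS mulmx1 mxE.
Qed.

Lemma generic_inj k (A : 'M[R]_(k, N)) (S : {pred 'I_N}) (c c' : 'rV_k) :
  generic A -> #|S| = k -> {in S, forall i, (c *m A) 0 i = (c' *m A) 0 i} ->
  c = c'.
Proof.
move=> [A0 _] Sk cc'; apply/eqP; rewrite -subr_eq0; apply: contraTT isT => c0.
have := A0 _ c0; rewrite ltnNge -[leqLHS]Sk subset_leq_card//.
by apply/fintype.subsetP => i iS; rewrite inE mulmxBl [X in X == _]mxE [X in _ + X]mxE cc'// subrr.
Qed.

Lemma card_lt_extra (S P : {pred 'I_N}) j :
  {subset S <= P} -> j \in P -> j \notin S -> (#|S| < #|P|)%N.
Proof.
move=> SP jP jS; have := cardU1 j S; rewrite jS add1n => <-.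
apply: subset_leq_card; apply/fintype.subsetP => i.
by rewrite !inE => /orP[/eqP ->//|/SP].
Qed.

Section step.
Variables (k : nat) (A : 'M[R]_(k, N)) (y : 'rV[R]_N).
Let B : 'M[R]_(1 + k, N) := col_mx y A.
Hypotheses (gA : generic A) (gB : generic B) (kN : (k < N)%N).

(** The new row [y] makes the row space of [A] a hyperplane of that of [B], and the
coefficient of [y] is a height above it. *)
Definition upper_vertex Y : bool :=
  `[< exists t c, 0 < t /\ vertex B Y (row_mx t%:M c) >].

Lemma rowBE (t : R) (c : 'rV_k) i :
  (row_mx t%:M c *m B) 0 i = (c *m A) 0 i + t * y 0 i.
Proof. by rewrite mul_row_col mul_scalar_mx addrC !mxE. Qed.

(** [k] prescribed signs leave a line in the row space of [B], which crosses the
hyperplane spanned by [A] at one point [p].  Going up from there, the cube is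
left at the vertices counted on the left, and [p] is in the cube when the
pattern is already a vertex for [A]. *)
Lemma edge_parity X : #|supp X| = k ->
  odd #|[pred q : 'I_N * bool | (X q.1 == None) && upper_vertex (put X q.1 q.2)]|
  = `[< exists c, vertex A X c >].
Proof.
move=> Xk.
have [p pX] := interpolate (fun i => if X i is Some b then sign_val R b else 0) gA Xk.
have [q qy] := interpolate (fun i => y 0 i) gA Xk.
pose J : {pred 'I_N} := [pred j | X j == None].
pose al i := (p *m A) 0 i; pose be i := y 0 i - (q *m A) 0 i.
have lineE t i : (row_mx t%:M (p - t *: q) *m B) 0 i = al i + t * be i.
  by rewrite rowBE /al /be mulmxBl -scalemxAl !mxE; ring.
have be_supp i : i \in supp X -> be i = 0 by move=> iX; rewrite /be qy// subrr.
have al_supp i b : X i = Some b -> al i = sign_val R b.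
  by move=> Xi; rewrite /al pX ?Xi// inE Xi.
have suppJ i : (i \in J) = (i \notin supp X) by rewrite !inE negbK.
have al_supp1 i : i \in supp X -> `|al i| = 1.
  rewrite inE; case Xi : (X i) => [b|]// _.
  by rewrite (al_supp _ _ Xi) normr_sign_val.
have be0 : {in J, forall j, be j != 0}.
  move=> j jJ; apply/eqP => bej.
  have nz : row_mx 1%:M (- q) != 0 :> 'rV[R]_(1 + k).
    by rewrite -[X in _ != X]row_mx0; apply/eqP => /eq_row_mx[/matrixP/(_ 0 0)];
      rewrite !mxE/= => /eqP; rewrite oner_eq0.
  have lt := gB.1 _ nz; suff: (#|supp X| < #|[pred i | ((row_mx 1%:M (- q) *m B) 0 i == 0)%R]|)%N.
    by rewrite Xk ltnNge -ltnS => /negP; apply; exact: lt.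
  have zE i : (row_mx 1%:M (- q) *m B) 0 i = be i.
    by rewrite rowBE /be mulNmx [X in X + _]mxE mul1r addrC.
  apply: (@card_lt_extra _ _ j) => [i iX||]; rewrite -?suppJ// inE zE ?bej//.
  by rewrite be_supp.
have al1 : {in J, forall j, `|al j| != 1}.
  move=> j jJ; apply/eqP => alj; have := gA.2 p; rewrite leqNgt -[X in (X < _)%N]Xk => /negP.
  apply; apply: (@card_lt_extra _ _ j) => [i iX||]; rewrite -?suppJ// inE.
    by rewrite -/(al i) al_supp1.
  by rewrite -/(al j) alj.
have uniq1 t : {in J &, forall i j, `|al i + t * be i| = 1 ->
    `|al j + t * be j| = 1 -> i = j}.
  move=> i j iJ jJ ai aj; apply/eqP; apply: contraTT isT => ij.
  have le := gB.2 (row_mx t%:M (p - t *: q)).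
  suff : (#|supp X|.+1 < #|[pred i | (`|(row_mx t%:M (p - t *: q) *m B) 0 i| == 1)%R]|)%N.
    by rewrite Xk => lt; move: le; rewrite leqNgt => /negP[]; exact: lt.
  have lt1 : (#|supp X| < #|[predU1 i & supp X]|)%N.
    by rewrite cardU1 -suppJ iJ.
  apply: (leq_ltn_trans lt1); apply: (@card_lt_extra _ _ j) => [l||]; rewrite !inE ?lineE ?aj//; last first.
    by move: jJ; rewrite inE => /eqP ->; rewrite eq_sym (negPf ij).
  case/predU1P => [->|lX]; first by rewrite ai.
  have lX' : l \in supp X by rewrite inE.
  by rewrite be_supp// mulr0 addr0 al_supp1.
have [j0 j0J] : exists j0, j0 \in J.
  apply/existsP; rewrite -[X in is_true X]negbK negb_exists; apply/negP => /forallP H.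
  suff E : #|supp X| = N by move: kN; rewrite -Xk E ltnn.
  rewrite -[RHS]card_ord; apply: eq_card => i.
  by have := H i; rewrite suppJ negbK => ->.
pose root (q : 'I_N * bool) := (sign_val R q.2 - al q.1) / be q.1.
pose inside t := [forall (i | i \in J), `|al i + t * be i| <= 1].
have H : odd #|[pred q | [&& q.1 \in J, 0 < root q & inside (root q)]]| = inside 0
  := line_parity j0J be0 al1 uniq1.
transitivity (inside 0); last first.
  apply/forall_inP/asboolP => [in0|[c [c1 cX]] i iJ]; last first.
    have -> : al i = (c *m A) 0 i.
      rewrite /al (@generic_inj _ A (supp X) p c gA Xk)// => l lX; rewrite -/(al l).
      move: lX (cX l); rewrite inE; case Xl : (X l) => [b|]// _ /eqP/tightP ->.
      exact: al_supp.
    by rewrite mul0r addr0.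
  exists p; split=> i; rewrite -/(al i).
    case: (boolP (i \in J)) => [/in0|]; first by rewrite mul0r addr0.
    by rewrite suppJ negbK => iX; rewrite al_supp1.
  case Xi : (X i) => [b|]; first by rewrite (al_supp _ _ Xi); apply/eqP/tightP.
  by apply/eqP; rewrite -[_ == _]negbK tight_None al1// inE Xi.
rewrite -H; congr (odd _); apply: eq_card => -[j e]; rewrite !inE /=.
case Xj : (X j) => [//|] /=.
have jJ : j \in J by rewrite inE Xj.
apply/asboolP/andP => [[t [c [t0 [c1 cX]]]]|[r0 /forall_inP rin]].
  have cE : c = p - t *: q.
    apply: (generic_inj gA Xk) => i iX.
    have := cX i; rewrite ffunE; case: eqP => [ij|_].
      by move: iX; rewrite ij inE Xj.
    move: iX; rewrite inE; case Xi : (X i) => [b|]// _ /eqP/tightP.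
    have := lineE t i; rewrite !rowBE be_supp ?inE ?Xi// (al_supp _ _ Xi).
    by rewrite mulr0 addr0 => <- /addIr.
  have rt : root (j, e) = t.
    rewrite /root /=; apply: (canLR (mulfK (be0 j jJ))).
    have := cX j; rewrite ffunE eqxx cE => /eqP/tightP.
    by rewrite lineE => <-; rewrite addrC addKr.
  rewrite rt t0; split=> //; apply/forall_inP => i iJ.
  by rewrite -lineE -cE.
exists (root (j, e)), (p - root (j, e) *: q); split=> //.
have rj : al j + root (j, e) * be j = sign_val R e.
  by rewrite /root /= divfK ?be0// addrC subrK.
split=> i; rewrite lineE; first case: (boolP (i \in J)) => [/rin//|].
  by rewrite suppJ negbK => iX; rewrite be_supp// mulr0 addr0 al_supp1.
rewrite ffunE; case: eqP => [->|/eqP ij]; first by rewrite rj; apply/eqP/tightP.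
case Xi : (X i) => [b|].
  rewrite be_supp ?inE ?Xi// mulr0 addr0 (al_supp _ _ Xi).
  exact/eqP/tightP.
apply/eqP; rewrite -[_ == _]negbK tight_None; apply: contra ij => /eqP ai.
apply/eqP/(uniq1 (root (j, e))); rewrite ?inE ?Xi ?Xj//.
by rewrite rj normr_sign_val.
Qed.

End step.
End vertices.

(** * Parity of the number of alternating vertices *)

Section parity.
Variables (R : realFieldType) (N : nat).
Local Notation pat := {ffun 'I_N -> option bool}.
Implicit Types (X Y : pat).

(** The first sign is fixed because vertices come in opposite pairs; the number of
pairs is what has a well defined parity. *)
Definition zigzag k (A : 'M[R]_(k, N)) X : bool :=
  [&& #|supp X| == k, alternating true (signs X) & `[< exists c, vertex A X c >]].

Lemma odd_sum (I : finType) (P : {pred I}) (F : I -> nat) :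
  odd (\sum_(i | P i) F i) = \big[addb/false]_(i | P i) odd (F i).
Proof. exact: (big_morph odd oddD (erefl _)). Qed.

Lemma card_sum (I : finType) (P : {pred I}) : #|P| = (\sum_i (P i : nat))%N.
Proof. by rewrite -sum1_card big_mkcond; apply: eq_bigr => i _; rewrite unfold_in; case: (P i). Qed.

Lemma clearK X j e : X j = None -> clear (put X j e) j = X.
Proof.
by move=> Xj; apply/ffunP => i; rewrite !ffunE; case: eqP => [->|].
Qed.

Lemma putK Y j e : Y j = Some e -> put (clear Y j) j e = Y.
Proof.
by move=> Yj; apply/ffunP => i; rewrite !ffunE; case: eqP => [->|].
Qed.

Lemma card_supp_clear Y j : Y j != None -> #|supp Y| = #|supp (clear Y j)|.+1.
Proof.
move=> Yj; rewrite (cardD1 j) inE Yj add1n; congr _.+1.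
by apply: eq_card => i; rewrite !inE ffunE; case: eqP => //= ->; rewrite andbF.
Qed.

Definition opp_pattern X : {ffun 'I_N -> option bool} := [ffun i => omap negb (X i)].

Lemma opp_patternK : involutive opp_pattern.
Proof. by move=> X; apply/ffunP => i; rewrite !ffunE; case: (X i) => //= b; rewrite negbK. Qed.

Lemma card_supp_opp X : #|supp (opp_pattern X)| = #|supp X|.
Proof. by apply: eq_card => i; rewrite !inE ffunE; case: (X i). Qed.

Lemma alternating_opp b X :
  alternating b (signs (opp_pattern X)) = alternating (~~ b) (signs X).
Proof.
rewrite /signs; elim: (enum _) b => //= i r IH b.
by rewrite ffunE; case: (X i) => //= x; rewrite IH; case: x b => -[].
Qed.

Lemma tightN (x : R) : tight (- x) = omap negb (tight x).
Proof.
rewrite /tight eqr_oppLR [- x == - 1]eqr_opp.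
by case: (eqVneq x 1) => [->|_]; rewrite ?[1 == - 1]eq_sym ?eqNr ?oner_eq0//; case: eqP.
Qed.

Lemma vertexN k (A : 'M[R]_(k, N)) X c :
  vertex A X c -> vertex A (opp_pattern X) (- c).
Proof.
have cE i : (- c *m A) 0 i = - (c *m A) 0 i by rewrite mulNmx mxE.
by case=> c1 cX; split=> i; rewrite cE ?normrN// tightN cX ffunE.
Qed.

Section step.
Variables (k : nat) (A : 'M[R]_(k, N)) (y : 'rV[R]_N).
Let B : 'M[R]_(1 + k, N) := col_mx y A.
Hypotheses (gA : generic A) (gB : generic B) (kN : (k < N)%N).

Let up := upper_vertex A y.

Lemma vertex_supp Y c : vertex B Y c -> #|supp Y| = k.+1 -> exists t c',
  c = row_mx t%:M c' /\ t != 0.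
Proof.
move=> [c1 cY] Yk; exists (lsubmx c 0 0), (rsubmx c).
have cE : c = row_mx (lsubmx c 0 0)%:M (rsubmx c) by rewrite -mx11_scalar hsubmxK.
split=> //; apply/eqP => t0.
have := gA.2 (rsubmx c); rewrite leqNgt => /negP; apply.
rewrite [X in (X < _)%N](_ : k = (#|supp Y|.-1)%N) ?Yk//.
have : {subset supp Y <= [pred i | (`|(rsubmx c *m A) 0 i| == 1)%R]}.
  move=> i; rewrite !inE; have := cY i; rewrite [c in c *m _]cE rowBE t0 mul0r addr0 => <-.
  by rewrite tight_None.
by move/fintype.subsetP/subset_leq_card; rewrite Yk.
Qed.

(** A vertex below the hyperplane is the opposite of a vertex above it, and in
general position none lies on it. *)
Lemma zigzag_split Y :
  (zigzag B Y : nat) =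
  (([&& #|supp Y| == k.+1, alternating true (signs Y) & up Y] : nat) +
   [&& #|supp Y| == k.+1, alternating true (signs Y) & up (opp_pattern Y)])%N.
Proof.
rewrite /zigzag -[(#|supp Y| == 1 + k)%N]/(#|supp Y| == k.+1).
case: eqP => //= Yk; case: alternating => //=.
have excl : up Y -> up (opp_pattern Y) -> False.
  move=> /asboolP[t [c [t0 v]]] /asboolP[t' [c' [t'0 /vertexN]]].
  rewrite opp_patternK => v'.
  have E : row_mx t%:M c = - row_mx t'%:M c' :> 'rV_(1 + k).
    apply: (generic_inj gB Yk) => i; rewrite inE.
    have [_ vi] := v; have [_ v'i] := v'.
    case Yi : (Y i) => [b|]// _.
    have /eqP/tightP -> : tight ((row_mx t%:M c *m B) 0 i) = Some b by rewrite vi.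
    by have /eqP/tightP -> : tight ((- row_mx t'%:M c' *m B) 0 i) = Some b by rewrite v'i.
  move: E; rewrite opp_row_mx => /eq_row_mx[/matrixP/(_ 0 0)].
  by rewrite !mxE/= => E _; move: t0 t'0; lra.
case: (boolP (up Y)) => [upY|nupY]; case: (boolP (up (opp_pattern Y))) => [upY'|nupY'] /=.
- by case: (excl upY upY').
- by case/asboolP: upY => t [c [_ v]]; rewrite (asboolT (ex_intro _ _ v)).
- case/asboolP: upY' => t [c [_ /vertexN]]; rewrite opp_patternK => v.
  by rewrite (asboolT (ex_intro _ _ v)).
- case: asboolP => // -[c v].
  have [t [c' [cE t0]]] := vertex_supp v Yk.
  move: v; rewrite cE => v; case: (ltgtP t 0) t0 => // t0 _.
    case/negP: nupY'; apply/asboolP; exists (- t), (- c'); rewrite oppr_gt0.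
    by split=> //; have := vertexN v; rewrite opp_row_mx -raddfN.
  by case/negP: nupY; apply/asboolP; exists t, c'.
Qed.

(** Path following in the upper half of the cube section.  The edges are the lines
with [k] alternating signs, the first one positive.  Counting pairs of an edge
and one of its upper end points in two ways, the end points that do not
alternate occur an even number of times, so modulo 2 the alternating vertices
above the hyperplane are as many as those in it. *)
Lemma odd_zigzag_step : odd #|zigzag A| -> odd #|zigzag B|.
Proof.
pose P j e X := [&& #|supp X| == k, alternating true (signs X), X j == None & up (put X j e)].
(* X is the pattern on an edge, and (j, e) the sign gained at its end point. *)
pose S := (\sum_(X : pat) \sum_(j : 'I_N) \sum_(e : bool) P j e X)%N.
have oddS1 : odd S = odd #|zigzag A|.
  rewrite card_sum !odd_sum; apply: eq_bigr => X _; rewrite /P /zigzag.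
  case: eqP => [Xk|_]; last by rewrite big1// => j _; rewrite big1.
  case: alternating; last by rewrite big1// => j _; rewrite big1.
  rewrite /= oddb -(edge_parity gA gB kN Xk) card_sum pair_bigA /=.
  by congr (odd _); apply: eq_bigr => -[].
have oddS2 : odd S = odd #|zigzag B|.
  have -> : S = (\sum_(Y : pat) \sum_(j : 'I_N) [&& Y j != None, #|supp Y| == k.+1,
      alternating true (signs (clear Y j)) & up Y])%N.
    rewrite /S exchange_big [RHS]exchange_big; apply: eq_bigr => j _.
    rewrite exchange_big /=.
    transitivity (\sum_(e : bool) \sum_(Y : pat) [&& Y j == Some e, #|supp Y| == k.+1,
      alternating true (signs (clear Y j)) & up Y])%N.
      apply: eq_bigr => e _; rewrite [LHS](bigID (fun X => X j == None)) /=.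
      rewrite [X in (_ + X)%N]big1 ?addn0; last first.
        by move=> X /negPf Xj; rewrite /P Xj !andbF.
      rewrite [RHS](bigID (fun Y => Y j == Some e)) /=.
      rewrite [X in (_ + X)%N]big1 ?addn0; last by move=> X /negPf ->.
      rewrite (reindex_onto (fun Y => clear Y j) (fun X => put X j e)) /=; last first.
        by move=> X /eqP/clearK ->.
      apply: eq_big => Y.
        rewrite ffunE eqxx eqxx /=; apply/eqP/eqP => [<-|/putK//].
        by rewrite ffunE eqxx.
      move=> /andP[_ /eqP E]; have Yj : Y j = Some e by rewrite -E ffunE eqxx.
      by rewrite /P E Yj eqxx ffunE eqxx /= (@card_supp_clear Y j) ?Yj// eqSS.
    rewrite exchange_big; apply: eq_bigr => Y _; rewrite big_bool /=.
    by case: (Y j) => [[]|] /=; rewrite ?addn0.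
  rewrite card_sum !odd_sum.
  transitivity (\big[addb/false]_(Y : pat) ([&& #|supp Y| == k.+1, alternating true (signs Y) & up Y]
     (+) [&& #|supp Y| == k.+1, alternating false (signs Y) & up Y])).
    apply: eq_bigr => Y _; case: eqP => [Yk|_]; last first.
      by rewrite big1// => j _; rewrite andbF.
    case: (up Y); last by rewrite !andbF big1// => j _; rewrite !andbF.
    have := odd_alternating_deletions true Y (enum_uniq 'I_N).
    rewrite /= !andbT => <-. congr (odd _).
    rewrite -sum1_count big_enum_cond [RHS]big_mkcond /=.
    by apply: eq_bigr => j _; rewrite andbT; case: ifP.
  rewrite big_split /= [X in _ (+) X](reindex_inj (inv_inj opp_patternK)) /=.
  rewrite -big_split /=; apply: eq_bigr => Y _.
  by rewrite zigzag_split oddD !oddb card_supp_opp alternating_opp.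
by rewrite -oddS1 oddS2.
Qed.
End step.
End parity.

(** * General position *)

Section general_position.
Variables (R : realFieldType) (N : nat).

Lemma avoid_seq (L : seq R) (d : R) : 0 < d -> exists s, 0 < s < d /\ s \notin L.
Proof.
elim: L d => [|a L IH] d d0; first by exists (d / 2); split=> //; lra.
have [s [/andP[s0 sd] sL]] := IH (if 0 < a then Num.min d a else d) ltac:(
  by case: ifP => // a0; rewrite lt_min d0).
exists s; rewrite in_cons negb_or sL s0 andbT; case: ifPn sd => [a0|a0] sd.
  by move: sd; rewrite lt_min => /andP[-> /lt_eqF ->].
by rewrite sd; split=> //; apply: contraNneq a0 => <-.
Qed.

Lemma avoid_family (I : eqType) (r : seq I) (Q : I -> R -> Prop) :
  {in r, forall i, exists s0, forall s, s != s0 -> Q i s} ->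
  exists L : seq R, forall s, s \notin L -> {in r, forall i, Q i s}.
Proof.
elim: r => [|i r IH] H; first by exists [::].
have [|L HL] := IH; first by move=> j jr; apply: H; rewrite in_cons jr orbT.
have [s0 Hs0] := H i (mem_head _ _).
exists (s0 :: L) => s; rewrite in_cons negb_or => /andP[ss0 sL] j.
by rewrite in_cons => /orP[/eqP ->|/HL]; [exact: Hs0|exact].
Qed.

(** Moving a point off one more proper subspace along a direction outside it breaks
each of the finitely many conditions for at most one step length. *)
Lemma avoid_subspaces (I : eqType) (r : seq I) (W : I -> 'rV[R]_N -> Prop)
    (y0 : 'rV[R]_N) (d : R) : 0 < d ->
  {in r, forall i a u v, W i u -> W i v -> W i (a *: u + v)} ->
  {in r, forall i, exists w, ~ W i w} ->
  exists y : 'rV_N, (forall j, `|y 0 j - y0 0 j| <= d) /\ {in r, forall i, ~ W i y}.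
Proof.
elim: r d => [|i r IH] d d0 lin proper.
  by exists y0; split=> // j; rewrite subrr normr0 ltW.
have [||y [yd yr]] := IH (d / 2) ltac:(lra).
- by move=> j jr; apply: lin; rewrite in_cons jr orbT.
- by move=> j jr; apply: proper; rewrite in_cons jr orbT.
have [w wi] := proper i (mem_head _ _).
(* Each subspace contains at most one point of the line through y in direction w. *)
have [|L HL] := @avoid_family I (i :: r) (fun i s => ~ W i (y + s *: w)).
  move=> j jr; have linj := lin j jr.
  have [[s0 Ws0]|] := pselect (exists s0, W j (y + s0 *: w)); last first.
    by move=> nW; exists 0 => s _ Ws; apply: nW; exists s.
  exists s0 => s ss0 Ws.
  have s0' : s - s0 != 0 by rewrite subr_eq0.
  have W0 : W j 0 by have := linj (-1) _ _ Ws Ws; rewrite scaleN1r addNr.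
  have Ww : W j w.
    have := linj (- 1) _ _ Ws0 Ws; rewrite scaleN1r opprD addrACA addNr add0r.
    rewrite addrC -scalerBl => /(linj (s - s0)^-1 _ 0)/(_ W0).
    by rewrite addr0 scalerA mulVf// scale1r.
  move: jr; rewrite in_cons => /orP[/eqP ji|jr]; first by apply: wi; rewrite -ji.
  apply: (yr j jr); have := linj (- s) _ _ Ww Ws.
  by rewrite scaleNr addrC addrK.
pose M := 1 + \sum_j `|w 0 j|.
have M0 : 0 < M by rewrite ltr_pwDl// sumr_ge0.
have [s [/andP[s0 sd] sL]] := @avoid_seq L (d / 2 / M) ltac:(rewrite divr_gt0//; lra).
exists (y + s *: w); split; last exact: HL.
move=> j; rewrite !mxE addrAC (le_trans (ler_normD _ _))//.
have -> : d = d / 2 + d / 2 by lra.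
apply: lerD => //; rewrite normrM (gtr0_norm s0).
move: sd; rewrite ltr_pdivlMr// => /ltW; apply: le_trans.
apply: ler_wpM2l; first exact: ltW.
rewrite /M (bigD1 j)//= addrCA lerDl.
by rewrite addr_ge0// sumr_ge0.
Qed.

(** On a set of more coordinates than [M] has rows, the rows of [M] cannot span. *)
Lemma row_space_proper m (M : 'M[R]_(m, N)) (S : {pred 'I_N}) : (m < #|S|)%N ->
  exists w : 'rV_N, ~ exists c : 'rV_m, {in S, forall i, w 0 i = (c *m M) 0 i}.
Proof.
move=> mS; apply: contrapT => /forallNP H.
have {}H (w : 'rV_N) : exists c : 'rV_m, {in S, forall i, w 0 i = (c *m M) 0 i}.
  by apply: contrapT; exact: H.
pose MS : 'M[R]_(m, #|S|) := \matrix_(i, j) M i (enum_val j).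
have full : row_full MS.
  rewrite -sub1mx; apply/row_subP => j.
  pose u := row j (1%:M : 'M[R]_#|S|).
  have [c cE] := H (\row_i if i \in S =P true is ReflectT iS
    then u 0 (enum_rank_in iS i) else 0).
  apply/submxP; exists c; apply/rowP => l.
  have := cE (enum_val l) (enum_valP l); rewrite mxE.
  case: eqP => [iS|]; last by rewrite enum_valP.
  rewrite enum_valK_in => ->.
  by rewrite !mxE; apply: eq_bigr => q _; rewrite mxE.
have := rank_leq_row MS; rewrite leqNgt => /negP; apply.
by move/eqP: full => ->.
Qed.

Lemma subset_of_card (P : {pred 'I_N}) n : (n <= #|P|)%N ->
  exists S : {ffun 'I_N -> bool}, #|[pred i | S i]| = n /\ forall i, S i -> i \in P.
Proof.
move=> nP; exists [ffun i => i \in take n (enum P)]; split=> [|i]; last first.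
  by rewrite ffunE => /mem_take; rewrite mem_enum.
rewrite (@eq_card _ _ [pred i | i \in take n (enum P)]) => [|i]; last first.
  by rewrite !inE ffunE.
have /card_uniqP H := take_uniq n (enum_uniq P).
rewrite -[RHS](_ : size (take n (enum P)) = n) -?H; first exact: eq_card.
by rewrite H size_takel// -cardE.
Qed.

(** Each failure of general position for the larger matrix puts [y], restricted to
some coordinate set, in the span of too few vectors: the rows of [A], together
with a sign vector when the failure is an excess of coordinates 1 or -1. *)
Lemma generic_extend k (A : 'M[R]_(k, N)) (y0 : 'rV[R]_N) (d : R) :
  generic A -> 0 < d ->
  exists y : 'rV_N, (forall j, `|y 0 j - y0 0 j| <= d) /\ generic (col_mx y A).
Proof.
move=> gA d0.
pose set_ := {ffun 'I_N -> bool}.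
pose M (e : set_) : 'M[R]_(1 + k, N) := col_mx (\row_i sign_val R (e i)) A.
pose W (q : set_ * (set_ * bool)) (y : 'rV[R]_N) :=
  if q.2.2 then exists c : 'rV_(1 + k), {in [pred i | q.1 i], forall i,
                  y 0 i = (c *m M q.2.1) 0 i}
  else exists c : 'rV_k, {in [pred i | q.1 i], forall i, y 0 i = (c *m A) 0 i}.
pose r := seq.filter (fun q : set_ * (set_ * bool) =>
            #|[pred i | q.1 i]| == (k.+1 + q.2.2)%N) (enum {: set_ * (set_ * bool)}).
have [||y [yd yr]] := @avoid_subspaces _ r W y0 d d0.
- move=> q _ a u v; rewrite /W; case: q.2.2 => -[c cE] [c' c'E];
    exists (a *: c + c') => i iS; rewrite mulmxDl -scalemxAl.
    by rewrite [LHS]mxE [RHS]mxE [in LHS]mxE [X in _ = X + _]mxE cE// c'E.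
  by rewrite [LHS]mxE [RHS]mxE [in LHS]mxE [X in _ = X + _]mxE cE// c'E.
- move=> [S [e b]]; rewrite mem_filter /= => /andP[/eqP Sk _]; rewrite /W /=.
  by case: b Sk => Sk; apply: row_space_proper; rewrite Sk ?addn0 ?addn1.
have {}yr (S e : set_) (b : bool) : #|[pred i | S i]| = (k.+1 + b)%N -> ~ W (S, (e, b)) y.
  by move=> Sk; apply: yr; rewrite mem_filter /= Sk eqxx mem_enum.
exists y; split=> //; split=> [c c0|c].
  rewrite -[(_ < 1 + k)%N]/(_ < k.+1)%N ltnNge; apply/negP => kZ.
  have [S [Sk SZ]] := subset_of_card kZ.
  have {}SZ i : S i -> (c *m col_mx y A) 0 i = 0 by move/SZ; rewrite inE => /eqP.
  have cE : c = row_mx (lsubmx c 0 0)%:M (rsubmx c) by rewrite -mx11_scalar hsubmxK.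
  move: (lsubmx c 0 0) (rsubmx c) cE => t c' cE.
  rewrite cE in c0 SZ.
  have [t0|t0] := eqVneq t 0.
    have c'0 : c' != 0.
      by apply: contraNneq c0 => ->; rewrite t0 raddf0; apply/eqP; exact: row_mx0.
    have := gA.1 c' c'0; rewrite ltnNge => /negP; apply.
    apply: leq_trans (leqnSn k) _; rewrite -Sk; apply/subset_leq_card/fintype.subsetP => i.
    by rewrite !inE => /SZ; rewrite rowBE t0 mul0r addr0 => ->.
  apply: (yr S S false); rewrite ?addn0// /W /=; exists (- t^-1 *: c') => i.
  rewrite inE => /SZ; rewrite rowBE -scalemxAl [X in _ -> _ = X]mxE => /eqP.
  by rewrite addrC addr_eq0 => /eqP E; rewrite mulNr -mulrN -E mulKf.
rewrite -[(_ <= 1 + k)%N]/(_ <= k.+1)%N leqNgt; apply/negP => kZ.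
have [S [Sk SZ]] := subset_of_card kZ.
have {}SZ i : S i -> `|(c *m col_mx y A) 0 i| = 1 by move/SZ; rewrite inE => /eqP.
have cE : c = row_mx (lsubmx c 0 0)%:M (rsubmx c) by rewrite -mx11_scalar hsubmxK.
move: (lsubmx c 0 0) (rsubmx c) cE => t c' cE.
rewrite cE {c cE kZ} in SZ.
have [t0|t0] := eqVneq t 0.
  have := gA.2 c'; rewrite leqNgt => /negP; apply.
  apply: leq_trans (leqnSn k.+1) _; rewrite -Sk; apply/subset_leq_card/fintype.subsetP => i.
  by rewrite !inE => /SZ; rewrite rowBE t0 mul0r addr0 => ->.
pose e : set_ := [ffun i => (row_mx t%:M c' *m col_mx y A) 0 i == 1].
apply: (yr S e true); rewrite ?addn1// /W /=.
exists (row_mx (t^-1)%:M (- t^-1 *: c')) => i; rewrite inE => /SZ.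
rewrite rowBE /M rowBE -scalemxAl [(_ *: (c' *m A)) 0 i]mxE [(\row_i sign_val R (e i)) 0 i]mxE ffunE rowBE.
set v := (c' *m A) 0 i + t * y 0 i => v1.
have -> : sign_val R (v == 1) = v.
  case: eqP => // /eqP v1'; apply/esym/eqP; move/eqP: v1.
  by rewrite eqr_norml (negPf v1') => /andP[].
by rewrite /v; field.
Qed.

(** Rows are added one at a time, starting from the zero subspace, whose only vertex
is the empty pattern. *)
Lemma generic_zigzag k (A : 'M[R]_(k, N)) (d : R) : (k <= N)%N -> 0 < d ->
  exists A' : 'M[R]_(k, N),
    [/\ forall i j, `|A' i j - A i j| <= d, generic A' & odd #|zigzag A'|].
Proof.
elim: k A => [|k IH] A kN d0.
  have z (c : 'rV_0) i : (c *m A) 0 i = 0 by rewrite mxE big_ord0.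
  exists A; split=> [[]//||].
    split=> c; first by rewrite thinmx0 eqxx.
    by rewrite leqn0; apply/eqP/eq_card0 => i; rewrite inE z normr0 eq_sym oner_eq0.
  rewrite (@card_pred1_if _ (zigzag A) [ffun=> None] true)// => X.
  rewrite unfold_in andbT /zigzag; apply/and3P/eqP => [[/eqP X0 _ _]|->].
    apply/ffunP => i; rewrite ffunE.
    by have := card0_eq X0 i; rewrite inE => /negbFE/eqP.
  rewrite /signs (_ : pmap _ _ = [::]); last by elim: (enum _) => //= i r; rewrite ffunE.
  split=> //; first by apply/eqP/eq_card0 => i; rewrite !inE ffunE.
  apply/asboolP; exists 0; split=> i; rewrite z ?normr0// ffunE /tight.
  by rewrite eq_sym oner_eq0 eq_sym oppr_eq0 oner_eq0.
pose A1 : 'M[R]_(1 + k, N) := A.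
have [A' [A'd gA' oA']] := IH (dsubmx A1) (ltnW kN) d0.
have [y [yd gy]] := generic_extend (usubmx A1) gA' d0.
pose B : 'M[R]_(1 + k, N) := col_mx y A'.
exists B; split=> //; last exact: odd_zigzag_step.
move=> i j; have -> : A = col_mx (usubmx A1) (dsubmx A1) by rewrite vsubmxK.
have <- : unsplit (@fintype.split 1 k i) = i := fintype.splitK _.
rewrite /B; case: (fintype.split _) => l /=.
  rewrite [X in X - _](col_mxEu y A' l j).
  by rewrite [X in _ - X](col_mxEu (usubmx A1) (dsubmx A1) l j) ord1.
rewrite [X in X - _](col_mxEd y A' l j).
by rewrite [X in _ - X](col_mxEd (usubmx A1) (dsubmx A1) l j).
Qed.

End general_position.

(** * An oscillating vector in every subspace *)

Section discrete_variation.
Variable R : realFieldType.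

Fixpoint variation_from (y : R) (s : seq R) : R :=
  if s is x :: s' then `|x - y| + variation_from x s' else 0.

(** Between consecutive points with opposite unit values the sequence moves by at
least 2, however it behaves at the points where no value is prescribed. *)
Lemma variation_alternating (I : Type) (r : seq I) (x : I -> R)
    (X : I -> option bool) (b : bool) (y : R) :
  (forall i e, X i = Some e -> x i = sign_val R e) ->
  alternating b (pmap X r) -> (0 < size (pmap X r))%N ->
  2 * (size (pmap X r)).-1%:R + `|sign_val R b - y| <=
    variation_from y (map x r).
Proof.
move=> xX; elim: r b y => //= i r IH b y.
case Xi : (X i) => [e|] /=; last first.
  move=> alt sz; have := IH b (x i) alt sz.
  have := ler_distD (x i) (sign_val R b) y; lra.
move=> /andP[/eqP eb alt] _; rewrite (xX _ _ Xi) eb.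
have [/size0nil ->|sz] := posnP (size (pmap X r)).
  have : 0 <= variation_from (sign_val R b) (map x r).
    by elim: (map x r) (sign_val R b) => //= *; rewrite addr_ge0.
  by rewrite /=; lra.
have := IH (~~ b) (sign_val R b) alt sz.
rewrite sign_valN -opprD normrN -mulr2n normrMn normr_sign_val.
case: size sz => //= m _; rewrite -[m.+1]addn1 natrD; lra.
Qed.

(** A perturbed form of the fact that each subspace of dimension [k.+1] contains a
vector of sup norm 1 alternating between 1 and -1 at [k.+1] coordinates.  An
arbitrarily small perturbation is harmless for the estimates drawn from it. *)
Lemma zigzag_vector N k (A : 'M[R]_(k.+1, N)) (d : R) : (k < N)%N -> 0 < d ->
  exists A' : 'M[R]_(k.+1, N), exists c : 'rV_k.+1,
    [/\ forall i j, `|A' i j - A i j| <= d,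
        forall i, `|(c *m A') 0 i| <= 1 &
        2 * k%:R + 1 <=
          variation_from 0 [seq (c *m A') 0 i | i <- enum 'I_N]].
Proof.
move=> kN d0; have [A' [A'd _ oA']] := generic_zigzag A kN d0.
have : (0 < #|zigzag A'|)%N by case: #|_| oA'.
move=> /card_gt0P[X]; rewrite unfold_in => /and3P[/eqP Xk alt /asboolP[c [c1 cX]]].
exists A', c; split=> //.
have sz : size (signs X) = k.+1 by rewrite /signs size_pmap_card.
have := @variation_alternating _ (enum 'I_N) (fun i => (c *m A') 0 i) X true 0.
rewrite -/(signs X) sz subr0 normr_sign_val; apply=> // i e Xi.
by apply/tightP; rewrite cX Xi.
Qed.

End discrete_variation.

(** * Reproducing powers by dilations *)

Section dilations.
Variable R : realType.

(** A list of pairs stands for a polynomial whose coefficients need not be collected,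
so that [mass] bounds the sum of their absolute values. *)
Definition formal_eval (L : seq (R * nat)) (z : R) : R :=
  \sum_(x <- L) x.1 * z ^+ x.2.

Definition mass (T : Type) (L : seq (R * T)) : R := \sum_(x <- L) `|x.1|.

Definition scale (T : Type) (a : R) (L : seq (R * T)) := [seq (a * x.1, x.2) | x <- L].

Definition shift (L : seq (R * nat)) := [seq (x.1, x.2.+1) | x <- L].

Lemma mass_cat T (L L' : seq (R * T)) : mass (L ++ L') = mass L + mass L'.
Proof. by rewrite /mass big_cat. Qed.

Lemma mass_scale T a (L : seq (R * T)) : mass (scale a L) = `|a| * mass L.
Proof.
rewrite /mass big_map big_distrr /=; apply: eq_bigr => x _; exact: normrM.
Qed.

Lemma mass_shift L : mass (shift L) = mass L.
Proof. by rewrite /mass big_map. Qed.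

Lemma mass_ge0 T (L : seq (R * T)) : 0 <= mass L.
Proof. exact: sumr_ge0. Qed.

Lemma formal_eval_cat L L' z :
  formal_eval (L ++ L') z = formal_eval L z + formal_eval L' z.
Proof. by rewrite /formal_eval big_cat. Qed.

Lemma formal_eval_scale a L z : formal_eval (scale a L) z = a * formal_eval L z.
Proof.
rewrite /formal_eval big_map big_distrr /=; apply: eq_bigr => x _.
by rewrite mulrA.
Qed.

Lemma formal_eval_shift L z : formal_eval (shift L) z = z * formal_eval L z.
Proof.
rewrite /formal_eval big_map big_distrr /=; apply: eq_bigr => x _.
by rewrite exprS; ring.
Qed.

(** [rem m] is a remainder of the power [m] modulo the product of the [w - z].  Adding
a node [z] uses that [w ^+ m - z ^+ m] is [w - z] times the sum of the
[z ^+ (m - 1 - a) * w ^+ a], where each power of [w] is replaced by its remainder for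
the other nodes; this recursion never divides by a difference of nodes, so the
bound does not depend on how close the nodes are.  For [m] twice the number of
nodes and small [rho] the factor [rho ^+ m] wins over the other one. *)
Lemma small_remainder (rho : R) (zs : seq R) : 0 < rho <= 1 ->
  {in zs, forall z, 0 <= z <= rho} ->
  exists rem : nat -> seq (R * nat), forall m,
    [/\ {in zs, forall z, formal_eval (rem m) z = z ^+ m},
        {in rem m, forall x, (x.2 < size zs)%N} &
        mass (rem m) <= (3 / rho) ^+ size zs * (2 * rho) ^+ m].
Proof.
move=> /andP[rho0 rho1]; elim: zs => [|z zs IH] zsP.
  exists (fun=> [::]) => m; split=> //.
  by rewrite /mass big_nil expr0 mul1r exprn_ge0// mulr_ge0// ltW.
have [|rem remP] := IH; first by move=> x xzs; apply: zsP; rewrite in_cons xzs orbT.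
have /andP[z0 zr] := zsP z (mem_head _ _).
(* S m is that sum, after replacement of the powers. *)
pose S := fix S m := if m is m'.+1 then scale z (S m') ++ rem m' else [::].
have Seval m : {in zs, forall w, (w - z) * formal_eval (S m) w = w ^+ m - z ^+ m}.
  move=> w wzs; elim: m => [|m IHm] /=.
    by rewrite /formal_eval big_nil mulr0 !expr0 subrr.
  rewrite formal_eval_cat formal_eval_scale; have [/(_ w wzs) -> _ _] := remP m.
  rewrite mulrDr mulrCA IHm !exprS; ring.
have Ssize m : {in S m, forall x, (x.2 < size zs)%N}.
  elim: m => [|m IHm] //= x; rewrite mem_cat => /orP[/mapP[y /IHm ys ->]//|].
  by case: (remP m) => _ + _; exact.
set K := (3 / rho) ^+ size zs in remP.
have Smass m : mass (S m) <= K * (2 * rho) ^+ m / rho.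
  have K0 : 0 <= K by rewrite exprn_ge0// divr_ge0// ltW.
  have s0 : 0 <= 2 * rho by lra.
  elim: m => [|m IHm] /=.
    by rewrite /mass big_nil expr0 mulr1; apply: divr_ge0 => //; exact: ltW.
  rewrite mass_cat mass_scale (ger0_norm z0) exprS.
  have [_ _ rm] := remP m.
  have -> : K * (2 * rho * (2 * rho) ^+ m) / rho =
     rho * (K * (2 * rho) ^+ m / rho) + K * (2 * rho) ^+ m by field; lra.
  by apply: lerD => //; apply: ler_pM => //; exact: mass_ge0.
exists (fun m => (z ^+ m, 0%N) :: shift (S m) ++ scale (- z) (S m)) => m; split.
- move=> w; rewrite /formal_eval big_cons -/(formal_eval _ w) formal_eval_cat.
  rewrite formal_eval_shift formal_eval_scale /= expr0 mulr1 -mulrDl.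
  rewrite in_cons => /orP[/eqP ->|wzs]; first by rewrite subrr mul0r addr0.
  by rewrite Seval// addrC subrK.
- move=> x; rewrite in_cons mem_cat => /or3P[/eqP -> //|/mapP[y yS ->]|/mapP[y yS ->]] /=.
    by rewrite ltnS (Ssize m).
  by rewrite ltnS ltnW// (Ssize m).
- rewrite /mass big_cons -/(mass _) mass_cat mass_shift mass_scale normrN.
  rewrite normrX (ger0_norm z0) /= -/K exprS -/K -{1}[mass (S m)]mul1r -mulrDl.
  have K1 : 1 <= K by rewrite exprn_ege1// ler_pdivlMr//; lra.
  have zm : z ^+ m <= (2 * rho) ^+ m by apply: lerXn2r; rewrite ?nnegrE//; lra.
  have h1 : (1 + z) * mass (S m) <= (1 + rho) * (K * (2 * rho) ^+ m / rho).
    by apply: ler_pM; rewrite ?addr_ge0// ?lerD2l// mass_ge0.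
  apply: (le_trans (lerD zm h1)).
  have s0 : 0 <= (2 * rho) ^+ m by rewrite exprn_ge0//; lra.
  have -> : 3 / rho * K * (2 * rho) ^+ m =
     (2 * rho) ^+ m * (3 * K / rho) by field; lra.
  have -> : (2 * rho) ^+ m + (1 + rho) * (K * (2 * rho) ^+ m / rho) =
     (2 * rho) ^+ m * (1 + (1 + rho) * K / rho) by field; lra.
  apply: ler_wpM2l => //; rewrite -subr_ge0.
  have -> : 3 * K / rho - (1 + (1 + rho) * K / rho) =
     ((1 - rho) * K + (K - rho)) / rho by field; lra.
  by apply: divr_ge0; [apply: addr_ge0; [apply: mulr_ge0|]|]; lra.
Qed.

(** Multiplied by [t `^ lam], the equation says that the power function [lam] is a
combination of its dilations by the factors [x.2]; the same list serves all powers
in [S], hence their linear combinations. *)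
Definition dilation_reproducing (eta D : R) (S : set R) : Prop :=
  exists L : seq (R * R), [/\ {in L, forall x, 1 <= x.2 <= D}, mass L <= eta &
    forall lam, S lam -> \sum_(x <- L) x.1 * x.2 `^ lam = 1].

(** In terms of [z = q `^ (- lam)] a dilation by a power of [q] multiplies the power
function by a negative power of [z].  The remainder of the power [2 * size lams] of
[z] has a small mass when all [z] are at most 1/96, which is what the choice of [q]
ensures; only the smallest exponent and the number of exponents enter. *)
Lemma reproducing_block (ell : R) (lams : seq R) : 0 < ell ->
  {in lams, forall lam, ell <= lam} ->
  dilation_reproducing (8^-1 ^+ size lams)
    (96 `^ (2 * (size lams)%:R / ell)) [set` lams].
Proof.
move=> ell0 lamsP.
pose q : R := 96 `^ ell^-1.
have q1 : 1 <= q by rewrite -[leLHS](powRr0 96) ler_powR ?invr_ge0 ?ltW//; lra.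
pose rho : R := 96^-1.
pose zs := [seq q `^ (- lam) | lam <- lams].
have [||rem remP] := @small_remainder rho zs; first by rewrite /rho; lra.
  move=> _ /mapP[lam /lamsP el ->]; rewrite powR_ge0 /=.
  have -> : rho = 96 `^ (- 1) by rewrite powRN powRr1.
  rewrite /q -powRrM ler_powR ?ler1n//.
  by rewrite mulrN lerN2 mulrC ler_pdivlMr// mul1r.
set n := size lams; have sz : size zs = n by rewrite size_map.
have [ev ex ma] := remP (2 * n)%N; rewrite sz in ex ma.
exists [seq (x.1, q ^+ (2 * n - x.2)) | x <- rem (2 * n)%N]; split.
- move=> _ /mapP[x /ex xn ->] /=; rewrite exprn_ege1//=.
  have -> : 96 `^ (2 * n%:R / ell) = q ^+ (2 * n) :> R.
    rewrite -powR_mulrn ?powR_ge0// /q -powRrM natrM; congr (_ `^ _); ring.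
  by rewrite ler_weXn2l// leq_subr.
- rewrite /mass big_map; apply: (le_trans ma); rewrite exprM -exprMn.
  by rewrite (_ : 3 / rho * (2 * rho) ^+ 2 = 8^-1)// /rho; field.
- move=> lam /= lamL; rewrite big_map /=.
  have q0 : 0 < q by lra.
  have := ev (q `^ (- lam)) (map_f _ lamL); rewrite /formal_eval => E.
  have z0 : (q `^ (- lam)) ^+ (2 * n) != 0 by rewrite expf_neq0// gt_eqF// powR_gt0.
  apply: (mulIf z0); rewrite mul1r -[RHS]E big_distrl /=.
  apply: eq_big_seq => x /ex xn; rewrite -mulrA; congr (_ * _).
  have xn' : (x.2 <= 2 * n)%N by rewrite (leq_trans (ltnW xn))// leq_pmull.
  rewrite -(subnK xn') addnK exprD mulrA.
  rewrite -!powR_mulrn ?powR_ge0//.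
  rewrite -!powRrM -powRD; last by rewrite pnatr_eq0 implybT.
  by rewrite (_ : _ + _ = 0) ?powRr0 ?mul1r//; ring.
Qed.

(** If [k1] and [k2] are the two combinations, [1 - (1 - k1) (1 - k2)] reproduces both
families of powers. *)
Lemma reproducing_mul e1 e2 D1 D2 (S1 S2 : set R) : 1 <= D1 -> 1 <= D2 ->
  dilation_reproducing e1 D1 S1 -> dilation_reproducing e2 D2 S2 ->
  dilation_reproducing ((1 + e1) * (1 + e2) - 1) (D1 * D2) (S1 `|` S2).
Proof.
move=> D11 D21 [L1 [r1 m1 v1]] [L2 [r2 m2 v2]].
pose L12 := [seq (- (x.1 * y.1), x.2 * y.2) | x <- L1, y <- L2].
have D0 : 0 <= D1 /\ 0 <= D2 by lra.
exists (L1 ++ L2 ++ L12); split.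
- move=> x; rewrite !mem_cat => /or3P[/r1/andP[-> h]|/r2/andP[-> h]|] /=.
  + by rewrite (le_trans h)// ler_peMr//; case: D0.
  + by rewrite (le_trans h)// ler_peMl//; case: D0.
  + move=> /allpairsP[[y z] /= [/r1/andP[y1 yD] /r2/andP[z1 zD] ->]] /=.
    rewrite mulr_ege1//= ler_pM//; lra.
- rewrite !mass_cat [mass L12]/mass big_allpairs_dep /=.
  have -> : \sum_(x <- L1) \sum_(y <- L2) `|- (x.1 * y.1)| = mass L1 * mass L2.
    rewrite /mass big_distrl /=; apply: eq_bigr => x _.
    by rewrite big_distrr /=; apply: eq_bigr => y _; rewrite normrN normrM.
  have := mass_ge0 L1; have := mass_ge0 L2 => h2 h1.
  have : mass L1 * mass L2 <= e1 * e2 by apply: ler_pM.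
  lra.
- move=> lam lamS; rewrite !big_cat /= big_allpairs_dep /=.
  set v := fun x : R * R => x.1 * x.2 `^ lam.
  have -> : \sum_(x <- L1) \sum_(y <- L2) - (x.1 * y.1) * (x.2 * y.2) `^ lam =
     - ((\sum_(x <- L1) v x) * (\sum_(y <- L2) v y)).
    rewrite big_distrl /= -sumrN big_seq_cond [RHS]big_seq_cond.
    apply: eq_bigr => x /andP[/r1/andP[x1 _] _].
    rewrite big_distrr /= -sumrN big_seq_cond [RHS]big_seq_cond.
    apply: eq_bigr => y /andP[/r2/andP[y1 _] _].
    by rewrite powRM ?(le_trans ler01)// /v; ring.
  by case: lamS => [/v1|/v2] -> ; ring.
Qed.

End dilations.

(** * Reproducing all powers of a Muntz sequence *)

Section muntz_dilations.
Variables (R : realType) (mu : nat -> R) (S : R).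
Hypotheses (mu_gt0 : forall k, 0 < mu k)
  (mu_nondecr : forall j k, (j <= k)%N -> mu j <= mu k)
  (mu_sum : forall n, \sum_(k < n) (mu k)^-1 <= S).

Lemma dilation_reproducing_le (e e' D D' : R) (A A' : set R) :
  e <= e' -> D <= D' -> A' `<=` A ->
  dilation_reproducing e D A -> dilation_reproducing e' D' A'.
Proof.
move=> ee DD AA [L [r m v]]; exists L; split=> [x /r/andP[-> h]||lam /AA/v//].
  exact: le_trans h DD.
exact: le_trans m ee.
Qed.

(** The block of index [j] consists of the [2 ^ j] exponents starting with number
[2 ^ j - 1].  Its mass 8 to the power [- 2 ^ j] is so small that the product of all
blocks keeps a total mass below 1/2, and the logarithm of its dilation factor is
proportional to [2 ^ j / mu (2 ^ j).-1]. *)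
Lemma reproducing_dyadic J : dilation_reproducing (2^-1 - 8^-1 ^+ J / 2)
  (96 `^ (2 * \sum_(j < J) (2 ^ j)%:R / mu (2 ^ j).-1))
  [set mu k | k in [set k | (k.+1 < 2 ^ J)%N]].
Proof.
elim: J => [|J IH].
  exists [::]; split=> //; first by rewrite /mass big_nil expr0; lra.
  by move=> lam [k /= + _]; rewrite expn0.
pose lams := [seq mu k | k <- iota (2 ^ J).-1 (2 ^ J)].
have sz : size lams = (2 ^ J)%N by rewrite size_map size_iota.
have pow0 : (0 < 2 ^ J)%N by rewrite expn_gt0.
have := @reproducing_block R (mu (2 ^ J).-1) lams (mu_gt0 _) _.
rewrite sz => /(_ _)/(reproducing_mul _ _ IH) H.
apply: dilation_reproducing_le (H _ _ _).
- set a := 8^-1 ^+ J; have a0 : 0 <= a by rewrite exprn_ge0.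
  have ale : a <= 1 by rewrite exprn_ile1//; lra.
  have : 8^-1 ^+ (2 ^ J) <= 8^-1 * a :> R.
    by rewrite /a -exprS; apply: ler_wiXn2l; [lra|lra|rewrite ltn_expl].
  set b := 8^-1 ^+ (2 ^ J) => ba; rewrite exprS -/a.
  have : (1 + (2^-1 - a / 2)) * (1 + b) <= (1 + (2^-1 - a / 2)) * (1 + 8^-1 * a).
    by apply: ler_wpM2l; lra.
  have : 0 <= a * a by rewrite mulr_ge0.
  nra.
- rewrite big_ord_recr /= mulrDr powRD; last by rewrite pnatr_eq0 implybT.
  by rewrite mulrA.
- move=> _ [k /= kJ <-].
  have [kJ'|kJ'] := ltnP k.+1 (2 ^ J); first by left; exists k.
  right; apply: map_f; rewrite mem_iota; move: kJ kJ' pow0; rewrite expnS; lia.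
- rewrite -[leLHS](powRr0 96) ler_powR ?ler1n// mulr_ge0// sumr_ge0// => j _.
  by rewrite divr_ge0// ltW.
- rewrite -[leLHS](powRr0 96) ler_powR ?ler1n// divr_ge0 ?mulr_ge0//.
  by rewrite ltW.
- by move=> _ /mapP[k + ->]; rewrite mem_iota => /andP[/mu_nondecr].
Qed.

(** Cauchy condensation: the sum of the logarithms of the dilation factors of the
blocks is controlled by the sum of the inverses of the exponents. *)
Lemma condensation J :
  \sum_(j < J.+1) (2 ^ j)%:R / mu (2 ^ j).-1 <=
  (mu 0)^-1 + 2 * \sum_(k < 2 ^ J) (mu k)^-1.
Proof.
elim: J => [|J IH].
  rewrite !big_ord_recr !big_ord0 /= !add0r expn0 mul1r lerDl.
  by rewrite mulr_ge0// invr_ge0 ltW.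
rewrite big_ord_recr /= -[in leRHS](big_mkord xpredT (fun k => (mu k)^-1)).
rewrite (big_cat_nat (n := 2 ^ J))//=; last by rewrite leq_exp2l.
rewrite big_mkord mulrDr addrA lerD//.
have -> : (2 ^ J.+1)%:R / mu (2 ^ J.+1).-1 =
    2 * \sum_(2 ^ J <= k < 2 ^ J.+1) (mu (2 ^ J.+1).-1)^-1.
  rewrite big_const_nat iter_addr_0 -mulr_natl expnS mul2n -addnn addnK natrD; ring.
rewrite ler_wpM2l//; apply: ler_sum_nat => k /andP[_ kJ].
by rewrite lef_pV2 ?posrE// mu_nondecr//; lia.
Qed.

Lemma muntz_reproducing : exists2 D, 1 <= D & forall n,
  dilation_reproducing 2^-1 D [set mu k | k in [set k | (k < n)%N]].
Proof.
exists (96 `^ (6 * S)).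
  rewrite -[leLHS](powRr0 96) ler_powR ?ler1n// mulr_ge0//.
  by have := mu_sum 0; rewrite big_ord0.
move=> n; apply: dilation_reproducing_le (reproducing_dyadic n.+1).
- by rewrite lerBlDr lerDl divr_ge0// exprn_ge0.
- rewrite ler_powR ?ler1n//; have := condensation n; have := mu_sum (2 ^ n).
  by have := mu_sum 1; rewrite big_ord1; lra.
- move=> _ [k /= kn <-]; exists k; last by [].
  rewrite /=; apply: leq_ltn_trans kn _; apply: ltn_trans (ltnSn n) _.
  exact: ltn_expl.
Qed.
End muntz_dilations.

(** * Variation along increasing finite sequences *)

Section variation.
Variable R : realType.
Implicit Types (f g : R -> R) (s : seq R).

Definition variation f s : R :=
  if s is x :: s' then variation_from (f x) (map f s') else 0.

(** Repeated points are allowed; they do not change a variation. *)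
Definition sorted_in (a b : R) s : Prop := sorted <=%R s /\ {in s, forall x, a <= x <= b}.

Lemma variation_cons f x y s :
  variation f (x :: y :: s) = `|f y - f x| + variation f (y :: s).
Proof. by []. Qed.

Lemma variation_cat f s x s' :
  variation f (s ++ x :: s') = variation f (rcons s x) + variation f (x :: s').
Proof.
case: s => [|y s]; first by rewrite /= add0r.
elim: s y => [|z s IH] y; first by rewrite /= addr0.
by rewrite /= -!addrA; congr (_ + _); exact: (IH z).
Qed.

Lemma variation_sub_cons f s x : variation f s <= variation f (x :: s).
Proof. by case: s => [|y s] //; rewrite variation_cons lerDr. Qed.

(** Increments dominated by those of a monotone [M] telescope. *)
Lemma variation_le_monotone f M a b s : sorted_in a b s ->
  (forall x y, a <= x -> x <= y -> y <= b -> `|f y - f x| <= M y - M x) ->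
  (forall x y, a <= x -> x <= y -> y <= b -> M x <= M y) ->
  a <= b -> variation f s <= M b - M a.
Proof.
move=> [ss sab] fM Mm ab; case: s ss sab => [_ _|x s ss sab].
  by rewrite subr_ge0 Mm.
suff : variation f (x :: s) <= M b - M x.
  have /andP[ax xb] := sab x (mem_head _ _).
  by have := Mm _ _ (lexx a) ax xb; lra.
elim: s x ss sab => [|y s IH] x ss sab.
  by have /andP[ax xb] := sab x (mem_head _ _); rewrite subr_ge0 Mm.
have /andP[ax xb] := sab x (mem_head _ _).
have /andP[ay yb] : a <= y <= b by apply: sab; rewrite !inE eqxx orbT.
rewrite variation_cons; case/andP: ss => xy ss.
have := fM x y ax xy yb.
have H : {in y :: s, forall z, a <= z <= b}.
  by move=> z zs; apply: sab; rewrite inE zs orbT.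
have := IH y ss H; lra.
Qed.

Lemma variation_lin_comb (I : Type) (r : seq I) (c : I -> R) (h : I -> R -> R) f s :
  {in s, forall x, f x = \sum_(i <- r) c i * h i x} ->
  variation f s <= \sum_(i <- r) `|c i| * variation (h i) s.
Proof.
case: s => [|x s] fE.
  by rewrite sumr_ge0// => i _; rewrite mulr_ge0.
elim: s x fE => [|y s IH] x fE.
  by rewrite sumr_ge0// => i _; rewrite mulr_ge0.
rewrite variation_cons; under eq_bigr do rewrite variation_cons mulrDr.
rewrite big_split /=; apply: lerD; last first.
  by apply: IH => z zs; apply: fE; rewrite inE zs orbT.
rewrite !fE ?inE ?eqxx ?orbT// -sumrB; apply: le_trans (ler_norm_sum _ _ _) _.
by apply: ler_sum => i _; rewrite -mulrBr normrM.
Qed.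

Lemma variation_from_close (I : eqType) (f g : I -> R) (y z eta : R) (r : seq I) :
  `|y - z| <= eta -> {in r, forall i, `|f i - g i| <= eta} ->
  variation_from y (map f r) <= variation_from z (map g r) + 2 * (size r)%:R * eta.
Proof.
elim: r y z => [|i r IH] y z yz fg /=; first by rewrite mulr0 mul0r addr0.
have fgi := fg i (mem_head _ _).
have fgr : {in r, forall i, `|f i - g i| <= eta}.
  by move=> j jr; apply: fg; rewrite inE jr orbT.
have := IH _ _ fgi fgr; rewrite -natr1.
have := ler_distD (g i) (f i) y; have := ler_distD z (g i) y.
by rewrite [`|z - y|]distrC; lra.
Qed.

Lemma variation_map f (t : R) s :
  variation (fun x => f (t * x)) s = variation f [seq t * x | x <- s].
Proof. by case: s => //= x s; rewrite -map_comp. Qed.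

Lemma sorted_in_dilation (a b t : R) s : 0 <= t -> sorted_in a b s ->
  sorted_in (t * a) (t * b) [seq t * x | x <- s].
Proof.
move=> t0 [ss sab]; split.
  by apply: homo_sorted ss => x y xy; apply: ler_wpM2l.
by move=> _ /mapP[x /sab/andP[ax xb] ->]; rewrite !ler_wpM2l.
Qed.

Lemma sorted_in_le a b a' b' s : a' <= a -> b <= b' ->
  sorted_in a b s -> sorted_in a' b' s.
Proof.
move=> aa bb [ss sab]; split=> // x /sab/andP[ax xb].
by rewrite (le_trans aa ax) (le_trans xb bb).
Qed.

Lemma sorted_in_split (a b d : R) s : a <= d <= b -> sorted_in a b s ->
  exists s1 s2, [/\ s = s1 ++ s2, sorted_in a d (rcons s1 d) & sorted_in d b (d :: s2)].
Proof.
move=> /andP[ad db] [ss sab].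
exists [seq x <- s | x <= d], [seq x <- s | ~~ (x <= d)]; split.
- elim: s ss {sab} => //= x s IH xs.
  have ss := path_sorted xs; case: (leP x d) => xd /=; first by rewrite -IH.
  have H : all (fun y => ~~ (y <= d)) s.
    apply/allP => y ys; rewrite -ltNge (lt_le_trans xd)//.
    by move: xs; rewrite (path_sortedE le_trans) => /andP[/allP/(_ _ ys)].
  have -> : [seq y <- s | y <= d] = [::].
    by apply/eqP; rewrite -(negbK (_ == _)) -has_filter -all_predC.
  by rewrite (all_filterP H).
- split=> [|x].
    rewrite (sorted_pairwise le_trans) pairwise_rcons -(sorted_pairwise le_trans).
    by rewrite filter_all sorted_filter//; exact: le_trans.
  rewrite mem_rcons inE mem_filter => /orP[/eqP ->|/andP[-> /sab/andP[->]]//].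
  by rewrite ad lexx.
- split=> [|x].
    rewrite /= (path_sortedE le_trans) sorted_filter// ?andbT; last exact: le_trans.
    by apply/allP => y; rewrite mem_filter -ltNge => /andP[/ltW].
  rewrite inE mem_filter -ltNge => /orP[/eqP ->|/andP[dx /sab/andP[_ ->]]].
    by rewrite lexx.
  by rewrite ltW.
Qed.
End variation.

(** * Variation of Muntz polynomials near the origin *)

Section muntz_variation.
Variable R : realType.
Implicit Types (f g : R -> R) (s : seq R).

Lemma variation_insert f s1 s2 x :
  variation f (s1 ++ s2) <= variation f (s1 ++ x :: s2).
Proof.
case: s1 => [|y s1] /=; first exact: variation_sub_cons.
elim: s1 y => [|z s1 IH] y /=; last by rewrite lerD2l; exact: IH.
case: s2 => [|z s2] /=; first by rewrite addr0.
by rewrite addrA lerD2r addrC ler_distD.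
Qed.

Lemma variation_shift f g (a : R) s : {in s, forall x, f x = a + g x} ->
  variation f s = variation g s.
Proof.
case: s => // x s; elim: s x => // y s IH x fg.
have fgs : {in y :: s, forall x, f x = a + g x}.
  by move=> z zs; apply: fg; rewrite inE zs orbT.
rewrite !variation_cons IH// !fg ?inE ?eqxx ?orbT//; congr (`|_| + _); ring.
Qed.

(** Near the origin a Muntz polynomial [p] is a combination, of mass at most 1/2, of
its dilations, so its variation on [[e, d]] is at most half of its variation on
[[e, 1]].  The rest of the latter comes from [[d, 1]], whence the factor 2, the
total being finite because powers are monotone. *)
Lemma muntz_variation (mu : nat -> R) (S : R) :
  (forall k, 0 < mu k) -> (forall j k, (j <= k)%N -> mu j <= mu k) ->
  (forall n, \sum_(k < n) (mu k)^-1 <= S) ->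
  exists2 d, 0 < d <= 1 & forall n (a : nat -> R) V,
    let p x := \sum_(k < n) a k * x `^ mu k in
    (forall s, sorted_in d 1 s -> variation p s <= V) ->
    forall e s, 0 < e -> sorted_in e 1 s -> variation p s <= 2 * V.
Proof.
move=> mu0 mu_le muS; have [D D1 rep] := muntz_reproducing mu0 mu_le muS.
have D0 : 0 < D by lra.
exists D^-1; first by rewrite invr_gt0 D0 invf_le1.
move=> n a V p pV e s e0 se.
have V0 : 0 <= V by apply: (pV [::]); split.
case: s se => [_|x0 s0 se]; first by rewrite mulr_ge0.
have e1 : e <= 1.
  by have /andP[h1 h2] := se.2 x0 (mem_head _ _); exact: le_trans h1 h2.
move: (x0 :: s0) se => {x0 s0}s se.
have [de|de] := leP D^-1 e.
  by have := pV s (sorted_in_le de (lexx 1) se); lra.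
(* The supremum of A is the variation of p on [e, 1]. *)
pose A := [set variation p s | s in [set s | sorted_in e 1 s]].
have mono lam x y : 0 < lam -> e <= x -> x <= y -> x `^ lam <= y `^ lam.
  by move=> l0 ex xy; rewrite ge0_ler_powR ?nnegrE ?(ltW l0)//; lra.
have A_ub : ubound A (\sum_(k < n) `|a k|).
  move=> _ [t te <-]; apply: le_trans.
    by apply: (@variation_lin_comb R _ (index_enum 'I_n) (fun k => a k)
       (fun k x => x `^ mu k)) => x _.
  apply: ler_sum => k _; rewrite ler_piMr//.
  apply: (le_trans (@variation_le_monotone R _ (fun x => x `^ mu k) _ _ t te _ _ e1)).
  - by move=> x y ex xy y1; rewrite ger0_norm// subr_ge0 mono.
  - by move=> x y ex xy _; exact: mono.
  - by rewrite powR1 gerBl powR_ge0.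
have A_sup : has_sup A.
  split; last by exists (\sum_(k < n) `|a k|).
  by exists 0, [::]; split.
have vA t : sorted_in e 1 t -> variation p t <= sup A.
  by move=> te; apply: (ub_le_sup A_sup.2); exists t.
have [L [Lr Lm Lv]] := rep n.
suff supA : sup A <= 2^-1 * sup A + V by have := vA s se; lra.
apply: ge_sup; first exact: A_sup.1.
move=> _ [t te <-].
have [|t1 [t2 [-> t1d t2d]]] := sorted_in_split (d := D^-1) _ te.
  by rewrite (ltW de) invf_le1.
apply: (le_trans (variation_insert _ _ _ D^-1)); rewrite variation_cat.
apply: lerD; last exact: pV.
apply: le_trans.
  apply: (@variation_lin_comb R _ L (fun c => c.1) (fun c x => p (c.2 * x))).
  move=> x /(t1d.2)/andP[ex xd].
  have x0 : 0 <= x by lra.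
  transitivity (\sum_(c <- L) \sum_(k < n) c.1 * (a k * (c.2 * x) `^ mu k)); last first.
    by apply: eq_bigr => c _; rewrite -big_distrr.
  rewrite exchange_big /=; apply: eq_bigr => k _.
  transitivity (a k * x `^ mu k * \sum_(c <- L) c.1 * c.2 `^ mu k).
    by rewrite Lv ?mulr1//; exists k => /=.
  rewrite big_distrr /= big_seq_cond [RHS]big_seq_cond; apply: eq_bigr.
  move=> c /andP[/Lr/andP[c1 _] _]; rewrite powRM//; [ring|lra].
apply: (@le_trans _ _ (\sum_(c <- L) `|c.1| * sup A)); last first.
  rewrite -big_distrl /=; apply: ler_wpM2r => //.
  by apply: ub_le_sup; [exact: A_sup.2|exists [::]; split].
rewrite big_seq_cond [leRHS]big_seq_cond; apply: ler_sum.
move=> c /andP[/Lr/andP[c1 cD] _]; apply: ler_wpM2l => //.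
rewrite variation_map; apply: vA.
have c0 : 0 <= c.2 by lra.
apply: sorted_in_le (sorted_in_dilation c0 t1d).
  by rewrite ler_peMl// ltW.
by rewrite ler_pdivrMr// mul1r.
Qed.

End muntz_variation.

(** * Primitives of integrable functions *)

Section primitive.
Variable R : realType.
Notation mu := (@lebesgue_measure R).
Implicit Types (g h : R -> R).

Definition integrable01 g := mu.-integrable `[0, 1] (EFin \o g).

Definition primitive g : R -> R := fun x => \int[mu]_(t in `[0, x]) g t.

Lemma integrable01_sub g (a b : R) : 0 <= a -> b <= 1 -> integrable01 g ->
  mu.-integrable `[a, b] (EFin \o g).
Proof.
move=> a0 b1; apply: integrableS => // x /=; rewrite !in_itv /= => /andP[ax xb].
by rewrite (le_trans a0 ax) (le_trans xb b1).
Qed.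

Lemma integrable01_norm g : integrable01 g -> integrable01 (fun x => `|g x|).
Proof. exact: integrable_norm. Qed.

Lemma integrable01B g h : integrable01 g -> integrable01 h ->
  integrable01 (fun x => g x - h x).
Proof. by move=> ig ih; exact: (integrableB _ ig ih). Qed.

Lemma primitiveB g h x : integrable01 g -> integrable01 h -> x <= 1 ->
  primitive (fun x => g x - h x) x = primitive g x - primitive h x.
Proof. by move=> ig ih x1; rewrite /primitive RintegralB//; exact: integrable01_sub. Qed.

Lemma primitive0 g : primitive g 0 = 0.
Proof. by rewrite /primitive set_itv1 Rintegral_set1. Qed.

Lemma primitive_diff g x y : integrable01 g -> 0 <= x -> x <= y -> y <= 1 ->
  `|primitive g y - primitive g x| <=
  primitive (fun t => `|g t|) y - primitive (fun t => `|g t|) x.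
Proof.
move=> ig x0 xy y1.
rewrite /primitive Rintegral_itvB ?bnd_simp//; last exact: integrable01_sub.
rewrite Rintegral_itvB ?bnd_simp//; last exact/integrable01_sub/integrable01_norm.
apply: le_normr_Rintegral => //.
apply: integrableS (integrable01_sub (lexx 0) y1 ig) => // z /=.
by rewrite !in_itv /= => /andP[/ltW xz ->]; rewrite (le_trans x0).
Qed.

Lemma primitive_norm_nondecr g x y : integrable01 g -> 0 <= x -> x <= y -> y <= 1 ->
  primitive (fun t => `|g t|) x <= primitive (fun t => `|g t|) y.
Proof.
by move=> *; rewrite -subr_ge0; apply: le_trans (primitive_diff _ _ _ _).
Qed.

Lemma primitive_norm_ge0 g x : 0 <= primitive (fun t => `|g t|) x.
Proof. exact: Rintegral_ge0. Qed.

Lemma normr_primitive g x : integrable01 g -> 0 <= x -> x <= 1 ->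
  `|primitive g x| <= primitive (fun t => `|g t|) x.
Proof.
by move=> ig x0 x1; have := primitive_diff ig (lexx 0) x0 x1; rewrite !primitive0 !subr0.
Qed.

End primitive.

Section power_primitive.
Variable R : realType.
Notation mu := (@lebesgue_measure R).

Lemma continuous_powR (lam x : R) : 0 < x -> {for x, continuous (fun t : R => t `^ lam)}.
Proof.
move=> x0; apply: differentiable_continuous; apply/derivable1_diffP.
by apply: derivable_powR; rewrite in_itv/= x0.
Qed.

Lemma powR_cvg_at0 (lam : R) : 0 <= lam -> t `^ lam @[t --> 0^'+] --> (0 : R) `^ lam.
Proof.
rewrite le_eqVlt => /predU1P[<-|l0].
  by rewrite powRr0; under eq_fun do rewrite powRr0; exact: cvg_cst.
by rewrite powR0 ?gt_eqF//; exact: powR_cvg0.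
Qed.

Lemma continuous_within_powR (lam y : R) : 0 <= lam -> 0 < y ->
  {within `[0, y], continuous (fun t : R => t `^ lam)}.
Proof.
move=> l0 y0; apply/(continuous_within_itvP _ y0); split.
- by move=> x; rewrite in_itv/= => /andP[x0 _]; exact: continuous_powR.
- exact: powR_cvg_at0.
- apply: cvg_at_left_filter; exact: continuous_powR.
Qed.

Lemma primitive_powR (lam y : R) : 0 <= lam -> 0 <= y ->
  primitive (fun t => t `^ lam) y = y `^ (lam + 1) / (lam + 1).
Proof.
move=> l0; rewrite le_eqVlt => /predU1P[<-|y0].
  by rewrite primitive0 powR0 ?mul0r// gt_eqF//; lra.
have l1 : lam + 1 != 0 by rewrite gt_eqF//; lra.
rewrite /primitive /Rintegral.
rewrite (@continuous_FTC2 _ _ (fun t => t `^ (lam + 1) / (lam + 1)) 0 y)//.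
- by rewrite /= powR0// mul0r subr0.
- exact: continuous_within_powR.
- split.
  + move=> x; rewrite in_itv/= => /andP[x0 _].
    by apply: derivableM => //; apply: derivable_powR; rewrite in_itv/= x0.
  + apply: cvgM; last exact: cvg_cst.
    by apply: powR_cvg_at0; lra.
  + apply: cvgM; last exact: cvg_cst.
    by apply: cvg_at_left_filter; exact: continuous_powR.
- move=> x; rewrite in_itv/= => /andP[x0 _].
  rewrite derive1E deriveM//; last by apply: derivable_powR; rewrite in_itv/= x0.
  rewrite derive_cst scaler0 add0r -derive1E powR_derive1 ?in_itv/= ?x0//.
  by rewrite addrK /GRing.scale/= mulrA mulVf// mul1r.
Qed.

Lemma integrable01_powR (lam : R) : 0 <= lam -> integrable01 (fun t => t `^ lam).
Proof.
move=> l0; apply: continuous_compact_integrable; first exact: segment_compact.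
exact: continuous_within_powR.
Qed.

Lemma integrable01_sum (I : Type) (r : seq I) (a : I -> R) (h : I -> R -> R) :
  (forall i, integrable01 (h i)) -> integrable01 (fun t => \sum_(i <- r) a i * h i t).
Proof.
move=> ih; elim: r => [|i r IH].
  under eq_fun do rewrite big_nil.
  apply: continuous_compact_integrable; first exact: segment_compact.
  by apply: continuous_subspaceT => x; exact: cvg_cst.
under eq_fun do rewrite big_cons.
have := integrableZl _ (a i) (ih i) => /(_ (measurable_itv _)) ii.
exact: (integrableD _ ii IH).
Qed.

Lemma primitive_sum (I : Type) (r : seq I) (a : I -> R) (h : I -> R -> R) x :
  (forall i, integrable01 (h i)) -> x <= 1 ->
  primitive (fun t => \sum_(i <- r) a i * h i t) x =
  \sum_(i <- r) a i * primitive (h i) x.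
Proof.
move=> ih x1; elim: r => [|i r IH].
  rewrite big_nil /primitive; under eq_Rintegral do rewrite big_nil.
  by rewrite Rintegral_cst// mul0r.
rewrite big_cons -IH /primitive; under eq_Rintegral do rewrite big_cons.
rewrite RintegralD//.
- by rewrite RintegralZl//; exact: integrable01_sub.
- have := integrableZl _ (a i) (integrable01_sub (lexx 0) x1 (ih i)).
  by move=> /(_ (measurable_itv _)).
- exact/integrable01_sub/integrable01_sum.
Qed.

End power_primitive.

(** * Variation of the averages of a Muntz function *)

Section cesaro_variation.
Variable R : realType.
Implicit Types (g : R -> R) (s : seq R).

Definition mean g : R -> R := fun x => x^-1 * primitive g x.

(** Away from the origin the increments of the mean are dominated by those of
[d^-1 * N x - N 1 * x^-1], with [N] the primitive of [`|g|]. *)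
Lemma mean_variation_away d g s : 0 < d <= 1 -> integrable01 g ->
  sorted_in d 1 s -> variation (mean g) s <= 2 / d * primitive (fun t => `|g t|) 1.
Proof.
move=> /andP[d0 d1] ig ss.
set N := primitive (fun t => `|g t|).
have N0 x : 0 <= N x by exact: primitive_norm_ge0.
have Nle x y : 0 <= x -> x <= y -> y <= 1 -> N x <= N y by exact: primitive_norm_nondecr.
pose M x := d^-1 * N x - N 1 * x^-1.
have inv_le x y : d <= x -> x <= y -> y^-1 <= x^-1 by move=> dx xy; rewrite lef_pV2 ?posrE//; lra.
have Mle x y : d <= x -> x <= y -> y <= 1 -> M x <= M y.
  move=> dx xy y1; apply: lerB.
    by apply: ler_wpM2l; [rewrite invr_ge0 ltW|apply: Nle => //; lra].
  by apply: ler_wpM2l => //; exact: inv_le.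
have MM : M 1 - M d <= 2 / d * N 1.
  have : 0 <= d^-1 * N d by rewrite mulr_ge0// invr_ge0 ltW.
  by rewrite /M invr1; have := N0 1; lra.
apply: le_trans MM; apply: (variation_le_monotone ss) => // x y dx xy y1.
have x0 : 0 <= x by lra.
have -> : mean g y - mean g x =
   y^-1 * (primitive g y - primitive g x) - primitive g x * (x^-1 - y^-1).
  by rewrite /mean; ring.
have -> : M y - M x = d^-1 * (N y - N x) + N 1 * (x^-1 - y^-1) by rewrite /M; ring.
apply: (le_trans (ler_normB _ _)); apply: lerD; rewrite normrM.
  have y0 : 0 <= y^-1 by rewrite invr_ge0; lra.
  rewrite (ger0_norm y0); apply: ler_pM => //.
    by rewrite lef_pV2 ?posrE//; lra.
  exact: primitive_diff.
rewrite [X in _ * X]ger0_norm ?subr_ge0 ?inv_le//.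
apply: ler_wpM2r; first by rewrite subr_ge0 inv_le.
have x1 : x <= 1 by lra.
by apply: le_trans (normr_primitive ig x0 x1) _; exact: Nle.
Qed.

Definition muntz_approximable (Lambda : nat -> R) g : Prop :=
  forall e, 0 < e -> exists n (a : nat -> R),
    primitive (fun t => `|g t - \sum_(k < n) a k * t `^ Lambda k|) 1 < e.

(** The mean of a Muntz polynomial is a constant plus a Muntz polynomial with positive
exponents, so its variation near 0 is bounded by its variation away from 0, hence
by the integral of its absolute value.  Convergence in the mean implies pointwise
convergence of means on ]0, 1], which carries the estimate to limits. *)
Lemma cesaro_variation (Lambda : nat -> R) (S : R) :
  (forall k, 0 <= Lambda k) -> (forall j k, (j < k)%N -> Lambda j < Lambda k) ->
  (forall n, \sum_(k < n | Lambda k != 0) (Lambda k)^-1 <= S) ->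
  exists2 C, 0 < C & forall g, integrable01 g -> muntz_approximable Lambda g ->
    forall e s, 0 < e -> sorted_in e 1 s ->
    variation (mean g) s <= C * primitive (fun t => `|g t|) 1.
Proof.
move=> L0 Lincr LS.
pose z := Lambda 0 == 0.
have Lpos k : (0 < k)%N -> 0 < Lambda k.
  by move=> k0; exact: le_lt_trans (L0 0) (Lincr _ _ k0).
(* Constants do not contribute to a variation, so the exponent 0 is dropped. *)
pose mu k := if z then Lambda k.+1 else Lambda k.
have mu0 k : 0 < mu k.
  rewrite /mu; case: ifPn => [_|z0]; first exact: Lpos.
  by case: k => [|k]; [rewrite lt_neqAle eq_sym z0 L0|exact: Lpos].
have mu_le j k : (j <= k)%N -> mu j <= mu k.
  rewrite leq_eqVlt => /predU1P[->//|jk]; rewrite /mu.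
  by case: ifP => _; apply/ltW/Lincr.
have muS n : \sum_(k < n) (mu k)^-1 <= S.
  case: (boolP z) => z0.
    apply: le_trans (LS n.+1); rewrite [leRHS]big_mkcond big_ord_recl /= -/z z0 /= add0r.
    by apply: ler_sum => k _; rewrite /mu z0 gt_eqF ?Lpos.
  apply: le_trans (LS n); rewrite [leRHS]big_mkcond /=; apply: ler_sum => k _.
  by have := mu0 k; rewrite /mu (negPf z0) => /gt_eqF ->.
have [d /andP[d0 d1] H] := muntz_variation mu0 mu_le muS.
have d01 : 0 < d <= 1 by rewrite d0.
exists (4 / d); first by rewrite divr_gt0.
move=> g ig ag e s e0 se.
have poly n (a : nat -> R) t : sorted_in e 1 t ->
    variation (mean (fun t => \sum_(k < n) a k * t `^ Lambda k)) t <=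
    4 / d * primitive (fun t => `|\sum_(k < n) a k * t `^ Lambda k|) 1.
  move=> te; set p := fun t => _.
  have ip : integrable01 p.
    by apply: (@integrable01_sum R _ _ (fun k : 'I_n => a k)) => k; exact: integrable01_powR.
  have meanE x : 0 < x -> x <= 1 ->
      mean p x = \sum_(k < n) a k / (Lambda k + 1) * x `^ Lambda k.
    move=> x0 x1; rewrite /mean /p (@primitive_sum R _ _ (fun k : 'I_n => a k))//; last first.
      by move=> k; exact: integrable01_powR.
    rewrite big_distrr /=; apply: eq_bigr => k _.
    rewrite (_ : primitive _ x = x `^ (Lambda k + 1) / (Lambda k + 1)); last first.
      by apply: primitive_powR => //; exact: ltW.
    rewrite powRD ?(gt_eqF x0) ?implybT// powRr1 ?(ltW x0)//.
    have l1 : Lambda k + 1 != 0 by rewrite gt_eqF//; have := L0 k; lra.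
    by field; rewrite l1 gt_eqF.
  have [c0 [m [b E]]] : exists c0 m (b : nat -> R), forall x, 0 < x -> x <= 1 ->
      mean p x = c0 + \sum_(k < m) b k * x `^ mu k.
    rewrite /mu; case: (boolP z) => z0; last first.
      exists 0, n, (fun k => a k / (Lambda k + 1)) => x x0 x1.
      by rewrite meanE// add0r.
    case: n @p ip meanE => [|n] p _ meanE.
      by exists 0, 0%N, (fun=> 0) => x x0 x1; rewrite meanE// !big_ord0 addr0.
    exists (a 0 / (Lambda 0 + 1)), n, (fun k => a k.+1 / (Lambda k.+1 + 1)) => x x0 x1.
    by rewrite meanE// big_ord_recl (eqP z0) powRr0 mulr1.
  have shiftE t' e' : 0 < e' -> sorted_in e' 1 t' ->
      variation (mean p) t' = variation (fun x => \sum_(k < m) b k * x `^ mu k) t'.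
    move=> e'0 [_ te']; apply: (@variation_shift _ _ _ c0) => x /te'/andP[ex x1].
    by apply: E => //; exact: lt_le_trans ex.
  rewrite (shiftE t e)//.
  have -> : 4 / d * primitive (fun t => `|p t|) 1 =
     2 * (2 / d * primitive (fun t => `|p t|) 1) by ring.
  apply: (H m b _ _ e t) => // t' t'd.
  by rewrite -(shiftE t' d)//; exact: mean_variation_away.
have Cg : 0 <= 4 / d by rewrite divr_ge0// ltW.
apply/ler_addgt0Pr => eta eta0.
pose K := 4 / d + 2 * (size s)%:R / e.
have K0 : 0 < K.
  rewrite ltr_pwDl// ?divr_gt0// divr_ge0 ?mulr_ge0// ltW//.
have [n [a nae]] := ag (eta / K) ltac:(by rewrite divr_gt0).
set p := fun t => \sum_(k < n) a k * t `^ Lambda k.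
have ip : integrable01 p.
  by apply: (@integrable01_sum R _ _ (fun k : 'I_n => a k)) => k; exact: integrable01_powR.
set D := primitive _ 1 in nae.
have close x : e <= x -> x <= 1 -> `|mean g x - mean p x| <= D / e.
  move=> ex x1; rewrite /mean -mulrBr -primitiveB// normrM mulrC.
  have igp := integrable01B ig ip.
  have x0 : 0 <= x by lra.
  apply: ler_pM => //.
    apply: (le_trans (normr_primitive igp x0 x1)).
    exact: primitive_norm_nondecr.
  by rewrite ger0_norm ?invr_ge0// lef_pV2 ?posrE//; lra.
have var_close : variation (mean g) s <= variation (mean p) s + 2 * (size s)%:R * (D / e).
  have De : 0 <= D / e by rewrite divr_ge0 ?primitive_norm_ge0// ltW.
  case: s {K K0 nae} se => [|x s] [_ se]; first by rewrite /= mulr0 mul0r addr0.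
  have closes y : y \in x :: s -> `|mean g y - mean p y| <= D / e.
    by move=> /se/andP[]; exact: close.
  apply: le_trans (variation_from_close (closes x (mem_head _ _)) _) _.
    by move=> y ys; apply: closes; rewrite inE ys orbT.
  by rewrite lerD2l ler_wpM2r// ler_wpM2l// ler_nat.
apply: (le_trans var_close).
have np : primitive (fun t => `|p t|) 1 <= primitive (fun t => `|g t|) 1 + D.
  rewrite /primitive -RintegralD//; last 2 first.
  - exact: integrable01_norm.
  - exact/integrable01_norm/integrable01B.
  apply: le_Rintegral => //; first exact: integrable01_norm.
    apply: (integrableD _ (integrable01_norm ig) (integrable01_norm (integrable01B ig ip))).
    exact: measurable_itv.
  by move=> t _ /=; rewrite -{1}(subKr (g t) (p t)); exact: ler_normB.
have := poly n a s se; rewrite -/p.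
have := ler_wpM2l Cg np; move: nae; rewrite ltr_pdivlMr// /K.
have -> : D * (4 / d + 2 * (size s)%:R / e) =
  4 / d * D + 2 * (size s)%:R * (D / e) by ring.
lra.
Qed.

End cesaro_variation.

(** * Real and imaginary parts of scalars *)

Section scalar_parts.
Variables (R : realType) (s : scalars).
Local Notation K := (scalar_field R s).
Implicit Types (z w : K) (b : bool).

(** Statements about real and imaginary parts are made for both at once, and for both
scalar fields at once: the imaginary part of a real scalar is 0. *)
Definition part b : K -> R := if b then @real_part R s else @imag_part R s.

Lemma partD b z w : part b (z + w) = part b z + part b w.
Proof.
rewrite /part; case: s z w => /=; case: b => //= z w; first by rewrite addr0.
  by case: z; case: w.
by case: z; case: w.
Qed.

Lemma partN b z : part b (- z) = - part b z.
Proof.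
rewrite /part; case: s z => /=; case: b => //= z; first by rewrite oppr0.
  by case: z.
by case: z.
Qed.

Lemma partB b z w : part b (z - w) = part b z - part b w.
Proof. by rewrite partD partN. Qed.

Lemma part0 b : part b 0 = 0.
Proof. by rewrite /part; case: s; case: b. Qed.

Lemma part_sum b (I : Type) (r : seq I) (P : pred I) (F : I -> K) :
  part b (\sum_(i <- r | P i) F i) = \sum_(i <- r | P i) part b (F i).
Proof. by apply: (big_morph (part b)) => [z w|]; [exact: partD|exact: part0]. Qed.

Lemma part_real b (a : R) z : part b (of_parts s a 0 * z) = a * part b z.
Proof.
rewrite /part; case: s z => /=; case: b => //= z; first by rewrite mulr0.
  by case: z => x y /=; rewrite mul0r subr0.
by case: z => x y /=; rewrite mul0r addr0.
Qed.

Lemma part_eq z w : (forall b, part b z = part b w) -> z = w.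
Proof.
rewrite /part; case: s z w => /= z w H; first exact: (H true).
by have := H true; have := H false; case: z {H}; case: w => /= a b c d -> ->.
Qed.

Lemma part_of_parts (a a' : R) b : (s = RealScalars -> a' = 0) ->
  part b (of_parts s a a') = if b then a else a'.
Proof. by rewrite /part; case: s; case: b => //= ->. Qed.

Lemma part_false_real z : s = RealScalars -> part false z = 0.
Proof. by rewrite /part; case: s z. Qed.

Lemma real_partM z w :
  real_part (z * w) = real_part z * real_part w - imag_part z * imag_part w.
Proof. by case: s z w => /= z w; [rewrite mul0r subr0|case: z; case: w]. Qed.

Lemma imag_partM z w :
  imag_part (z * w) = real_part z * imag_part w + imag_part z * real_part w.
Proof. by case: s z w => /= z w; [rewrite mul0r mulr0 addr0|case: z; case: w]. Qed.

Lemma normE z : `|z| = of_parts s (modulus z) 0.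
Proof. by case: s z. Qed.

Lemma modulus_sqrt z : modulus z = Num.sqrt (real_part z ^+ 2 + imag_part z ^+ 2).
Proof.
case: s z => /= z; first by rewrite /modulus expr0n addr0 sqrtr_sqr.
change (complex.Re `|z : R[i]| = Num.sqrt (complex.Re z ^+ 2 + complex.Im z ^+ 2)).
by rewrite normc_def.
Qed.

Lemma of_parts_real_le (a a' : R) :
  (of_parts s a 0 <= of_parts s a' 0) = (a <= a').
Proof. by case: s => //=; rewrite lecE /= eqxx. Qed.

Lemma of_parts_real_lt (a a' : R) :
  (of_parts s a 0 < of_parts s a' 0) = (a < a').
Proof. by case: s => //=; rewrite ltcE /= eqxx. Qed.

Lemma of_parts_realD (a a' : R) :
  of_parts s (a + a') 0 = of_parts s a 0 + of_parts s a' 0.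
Proof. by case: s => //=; rewrite /GRing.add /= addr0. Qed.

Lemma of_parts_realM (a a' : R) :
  of_parts s (a * a') 0 = of_parts s a 0 * of_parts s a' 0.
Proof. by apply: part_eq => b; rewrite part_real !part_of_parts//; case: b; rewrite ?mulr0. Qed.

Lemma of_parts_real_inj (a a' : R) : of_parts s a 0 = of_parts s a' 0 -> a = a'.
Proof. by case: s => //= -[]. Qed.

Lemma of_parts0 : of_parts s 0 0 = 0 :> K.
Proof. by case: s. Qed.

Lemma of_parts1 : of_parts s 1 0 = 1 :> K.
Proof. by case: s. Qed.

Lemma modulus_ge0 z : 0 <= modulus z.
Proof. by rewrite modulus_sqrt sqrtr_ge0. Qed.

Lemma modulus0 : modulus (0 : K) = 0.
Proof. by rewrite /modulus normr0; exact: (part0 true). Qed.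

Lemma modulusN z : modulus (- z) = modulus z.
Proof. by rewrite /modulus normrN. Qed.

Lemma modulusD z w : modulus (z + w) <= modulus z + modulus w.
Proof. by rewrite -of_parts_real_le of_parts_realD -!normE ler_normD. Qed.

Lemma modulusB z w : modulus (z - w) <= modulus z + modulus w.
Proof. by rewrite -(modulusN w) modulusD. Qed.

Lemma modulus_sum (I : Type) (r : seq I) (P : pred I) (F : I -> K) :
  modulus (\sum_(i <- r | P i) F i) <= \sum_(i <- r | P i) modulus (F i).
Proof.
elim/big_rec2 : _ => [|i x y _ h]; first by rewrite modulus0.
by apply: le_trans (modulusD _ _) _; rewrite lerD2l.
Qed.

Lemma modulusM z w : modulus (z * w) = modulus z * modulus w.
Proof. by apply: of_parts_real_inj; rewrite of_parts_realM -!normE normrM. Qed.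

Lemma modulus_real (a : R) : modulus (of_parts s a 0) = `|a|.
Proof.
rewrite modulus_sqrt -[real_part _]/(part true _) -[imag_part _]/(part false _).
by rewrite !part_of_parts// expr0n addr0 sqrtr_sqr.
Qed.

Lemma modulus_eq0 z : modulus z = 0 -> z = 0.
Proof. by move=> z0; apply/normr0_eq0; rewrite normE z0 of_parts0. Qed.

Lemma normr_part_le b z : `|part b z| <= modulus z.
Proof.
rewrite modulus_sqrt -sqrtr_sqr ler_sqrt ?addr_ge0 ?sqr_ge0//.
by case: b; rewrite /part ?lerDl ?lerDr sqr_ge0.
Qed.

Lemma modulus_le_parts z : modulus z <= `|part true z| + `|part false z|.
Proof.
rewrite modulus_sqrt -[leRHS]ger0_norm ?addr_ge0// -sqrtr_sqr ler_sqrt ?sqr_ge0//.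
by rewrite sqrrD !real_normK ?num_real// -addrA lerD2l lerDr mulrn_wge0 ?mulr_ge0.
Qed.

Lemma modulus_real_scalars z : s = RealScalars -> modulus z = `|part true z|.
Proof. by rewrite /modulus /part; case: s z. Qed.

(** Positive elements of the scalar field are real, so the balls of its topology are
those of the real valued modulus. *)
Lemma lt_normr_modulus z (e : K) : 0 < e -> (`|z| < e) = (modulus z < part true e).
Proof.
move=> e0; have -> : e = of_parts s (part true e) 0.
  rewrite -[LHS]gtr0_norm// normE; congr of_parts.
  by rewrite /part /modulus gtr0_norm.
by rewrite normE of_parts_real_lt part_of_parts.
Qed.

Lemma part_gt0 (e : K) : 0 < e -> 0 < part true e.
Proof. by move=> e0; have := lt_normr_modulus 0 e0; rewrite normr0 modulus0 e0 => <-. Qed.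

Lemma cvg_parts (T : Type) (F : set_system T) (FF : Filter F) (f : T -> K) (l : K) :
  (forall b, part b (f x) @[x --> F] --> part b l) -> f x @[x --> F] --> l.
Proof.
move=> H; apply/cvgrPdist_lt => e e0.
have e2 : 0 < part true e / 2 by rewrite divr_gt0// part_gt0.
have /cvgrPdist_lt/(_ _ e2) Ht := H true; have /cvgrPdist_lt/(_ _ e2) Hf := H false.
apply: filterS2 Ht Hf => x; rewrite -!partB => ht hf.
by rewrite lt_normr_modulus//; have := modulus_le_parts (l - f x); lra.
Qed.

Lemma cvg_part (T : Type) (F : set_system T) (FF : Filter F) (f : T -> K) (l : K) b :
  f x @[x --> F] --> l -> part b (f x) @[x --> F] --> part b l.
Proof.
move=> H; apply/cvgrPdist_lt => e e0.
have e0' : 0 < of_parts s e 0 :> K by rewrite -of_parts0 of_parts_real_lt.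
have /cvgrPdist_lt/(_ _ e0') := H; apply: filterS => x.
rewrite lt_normr_modulus// part_of_parts// => h.
by rewrite -partB; apply: le_lt_trans h; exact: normr_part_le.
Qed.

Lemma continuous_within_part (A : set R) (f : R -> K) b :
  {within A, continuous f} -> {within A, continuous (part b \o f)}.
Proof. by move=> cf x; apply: cvg_part; exact: cf. Qed.

Lemma continuous_within_parts (A : set R) (f : R -> K) :
  (forall b, {within A, continuous (part b \o f)}) -> {within A, continuous f}.
Proof. by move=> cf x; apply: cvg_parts => b; exact: cf. Qed.

End scalar_parts.

(** * Integrable scalar functions *)

Section L1_functions.
Variables (R : realType) (s : scalars).
Local Notation K := (scalar_field R s).
Local Notation mu := (@lebesgue_measure R).
Implicit Types (f g p : R -> K) (b : bool).

Lemma integrable_part b f : integrable_on `[0, 1] f -> integrable01 (part b \o f).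
Proof. by rewrite /part => -[]; case: b. Qed.

Lemma integrable_onP f : (forall b, integrable01 (part b \o f)) -> integrable_on `[0, 1] f.
Proof. by move=> H; split; [exact: (H true)|exact: (H false)]. Qed.

Lemma measurable_part b f : integrable_on `[0, 1] f -> measurable_fun (`[0, 1] : set (measurableTypeR R)) (part b \o f).
Proof. by move=> /(integrable_part b)/(measurable_int mu)/measurable_EFinP. Qed.

Lemma measurable_modulus f : integrable_on `[0, 1] f ->
  measurable_fun (`[0, 1] : set (measurableTypeR R)) (fun t => modulus (f t)).
Proof.
move=> fi; rewrite (_ : (fun t => _) =
    @Num.sqrt R \o (fun t => part true (f t) ^+ 2 + part false (f t) ^+ 2)); last first.
  by apply: funext => t; exact: modulus_sqrt.
apply: measurableT_comp => //.
  by apply: continuous_measurable_fun => x; exact: sqrt_continuous.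
apply: measurable_funD; apply: measurable_funX.
  exact: (measurable_part true fi).
exact: (measurable_part false fi).
Qed.

Lemma integrable_modulus f : integrable_on `[0, 1] f ->
  integrable01 (fun t => modulus (f t)).
Proof.
move=> fi.
have i1 := integrable01_norm (integrable_part true fi).
have i2 := integrable01_norm (integrable_part false fi).
apply: (le_integrable _ _ _ (integrableD _ i1 i2)) => //.
  apply/measurable_EFinP. exact: (measurable_modulus fi).
move=> t _ /=; rewrite lee_fin ger0_norm ?modulus_ge0//.
by rewrite ger0_norm ?addr_ge0// modulus_le_parts.
Qed.

Definition L1 f : R := primitive (fun t => modulus (f t)) 1.

Lemma L1_normE f : integrable_on `[0, 1] f -> L1_norm f = (L1 f)%:E.
Proof.
move=> fi; rewrite /L1_norm /L1 /primitive /Rintegral fineK//.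
exact: (integrable_fin_num _ (integrable_modulus fi)).
Qed.

Lemma L1_ge0 f : 0 <= L1 f.
Proof. by apply: Rintegral_ge0 => t _; exact: modulus_ge0. Qed.

Lemma primitive_part_le_L1 b f : integrable_on `[0, 1] f ->
  primitive (fun t => `|part b (f t)|) 1 <= L1 f.
Proof.
move=> fi; apply: le_Rintegral => //.
- exact/integrable01_norm/(integrable_part b fi).
- exact: integrable_modulus.
- by move=> t _; exact: normr_part_le.
Qed.

Lemma integrable_onB f g : integrable_on `[0, 1] f -> integrable_on `[0, 1] g ->
  integrable_on `[0, 1] (f - g).
Proof.
move=> fi gi; apply: integrable_onP => b.
have := integrable01B (integrable_part b fi) (integrable_part b gi).
by congr integrable01; apply: funext => t /=; rewrite -partB.
Qed.

Lemma part_volterra b f x : part b (volterra_op f x) = primitive (part b \o f) x.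
Proof.
rewrite /volterra_op /scalar_integral part_of_parts.
  by case: b.
move=> sR; rewrite (_ : (fun t => imag_part (f t)) = cst 0); last first.
  by apply: funext => t; exact: (part_false_real _ sR).
by rewrite Rintegral_cst// mul0r.
Qed.

Lemma part_cesaro b f x : x != 0 -> part b (cesaro_op f x) = mean (part b \o f) x.
Proof. by rewrite /cesaro_op => /negPf ->; rewrite part_real part_volterra. Qed.

Lemma cesaro0 f : cesaro_op f 0 = f 0.
Proof. by rewrite /cesaro_op eqxx. Qed.

Lemma part_span b n (c : 'I_n -> K) (Lambda : nat -> R) t :
  part b ((\sum_(k < n) c k *: @monomial R s (Lambda k)) t) =
  \sum_(k < n) part b (c k) * t `^ Lambda k.
Proof.
rewrite fct_sumE part_sum; apply: eq_bigr => k _.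
rewrite -[_ t]/(c k * of_parts s (t `^ Lambda k) 0).
by rewrite mulrC part_real mulrC.
Qed.

Section muntz_functions.
Variable Lambda : nat -> R.
Hypothesis Lambda_ge0 : forall k, 0 <= Lambda k.

Lemma integrable_span p : muntz_span Lambda p -> integrable_on `[0, 1] p.
Proof.
case=> n [c _ <-]; apply: integrable_onP => b.
rewrite (_ : part b \o _ = fun t => \sum_(k < n) part b (c k) * t `^ Lambda k); last first.
  by apply: funext => t; exact: part_span.
by apply: (@integrable01_sum R _ _ (fun k => part b (c k))) => k; exact: integrable01_powR.
Qed.

Lemma muntz_integrable f : muntz_L1 Lambda f -> integrable_on `[0, 1] f.
Proof. by case=> -[]. Qed.

Lemma muntz_part_approximable b f : muntz_L1 Lambda f ->
  muntz_approximable Lambda (part b \o f).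
Proof.
move=> [[fi fapp] _ _] e e0; have [p ps] := fapp e e0.
have pi := integrable_span ps; case: ps => n [c _ cp].
have fpi := integrable_onB fi pi; rewrite (L1_normE fpi) lte_fin => lt_e.
exists n, (fun k => if (k < n)%N =P true is ReflectT kn then part b (c (Ordinal kn)) else 0).
apply: le_lt_trans lt_e; apply: le_trans (primitive_part_le_L1 b fpi).
rewrite le_eqVlt (_ : primitive _ 1 = primitive (fun t => `|part b ((f - p) t)|) 1) ?eqxx//.
congr (primitive _ 1); apply: funext => t.
rewrite -[(f - p) t]/(f t - p t) partB -cp part_span; congr (`|_ - _|).
apply: eq_bigr => k _; congr (_ * _); case: eqP => [kn|]; last by rewrite ltn_ord.
by congr (part b (c _)); exact: val_inj.
Qed.

End muntz_functions.
End L1_functions.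

(** * Continuity of primitives and averages *)

Section real_averages.
Variable R : realType.
Notation mu := (@lebesgue_measure R).
Implicit Types (f g h : R -> R).

Lemma primitive_continuous g : integrable01 g -> {within `[0, 1], continuous (primitive g)}.
Proof. by move=> ig; exact: parameterized_integral_continuous. Qed.

(** The operators are applied at every real point, while the functions are integrable
on [[0, 1]] and vanish after 1. *)
Lemma primitive_beyond g x : (forall t, ~~ (0 <= t < 1) -> g t = 0) -> 1 <= x ->
  primitive g x = primitive g 1.
Proof.
move=> g0 x1; rewrite /primitive Rintegral_mkcond [RHS]Rintegral_mkcond.
congr (Rintegral _ _ _); apply: funext => t; rewrite !patchE.
case: ifPn => tx; case: ifPn => t1 //; last first.
  case/negP: tx; move: t1; rewrite !inE /= !in_itv /= => /andP[-> t1].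
  exact: le_trans t1 x1.
apply: g0; apply: contra t1 => /andP[t0 /ltW t1].
by rewrite inE /= in_itv /= t0.
Qed.

Lemma primitive_lin (a c : R) f g h x : integrable01 f -> integrable01 g ->
  integrable01 h -> x <= 1 ->
  primitive (fun t => a * f t + c * g t + h t) x =
  a * primitive f x + c * primitive g x + primitive h x.
Proof.
move=> fi gi hi x1.
have sub k : integrable01 k -> mu.-integrable `[0, x] (EFin \o k) by exact: integrable01_sub.
have := integrableZl _ a (sub _ fi) => /(_ (measurable_itv _)) fi'.
have := integrableZl _ c (sub _ gi) => /(_ (measurable_itv _)) gi'.
rewrite /primitive RintegralD//; last exact: sub.
- by rewrite RintegralD// !RintegralZl//; exact: sub.
- exact: (integrableD _ fi' gi').
Qed.

(** The mean over a short interval differs from the limit value by the mean of a small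
function. *)
Lemma mean_cvg0 g : integrable01 g -> g t @[t --> 0^'+] --> g 0 ->
  mean g x @[x --> 0^'+] --> g 0.
Proof.
move=> ig g0; apply/cvgrPdist_le => e e0.
have /cvgrPdist_le/(_ _ e0)[d /= d0 dP] := g0.
near=> x.
have x0 : 0 < x by near: x; exact: nbhs_right_gt.
have x1 : x <= 1 by near: x; apply: nbhs_right_le; exact: ltr01.
have xd : x < d by near: x; apply: nbhs_right_lt.
have icst : mu.-integrable `[0, x] (EFin \o cst (g 0)).
  apply: continuous_compact_integrable; first exact: segment_compact.
  by apply: continuous_subspaceT => y; exact: cvg_cst.
have ix : mu.-integrable `[0, x] (EFin \o g) by exact: integrable01_sub.
have cstE (c : R) : \int[mu]_(t in `[0, x]) c = c * x.
  rewrite Rintegral_cst//; congr (_ * _).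
  have := lebesgue_measure_itv `[0, x]. rewrite /= lte_fin x0 -EFinB subr0 => E.
  by rewrite [X in fine X]E.
have -> : g 0 - mean g x = x^-1 * \int[mu]_(t in `[0, x]) (g 0 - g t).
  rewrite RintegralB// cstE /mean /primitive mulrBr mulrCA mulVf ?mulr1// gt_eqF//.
rewrite normrM gtr0_norm ?invr_gt0// mulrC ler_pdivrMr// -cstE.
have ib : mu.-integrable `[0, x] (EFin \o (fun t => g 0 - g t)).
  exact: (integrableB _ icst ix).
apply: (le_trans (le_normr_Rintegral _ ib)) => //.
apply: le_Rintegral => //.
- exact: (integrable_norm ib).
- apply: continuous_compact_integrable; first exact: segment_compact.
  by apply: continuous_subspaceT => y; exact: cvg_cst.
- move=> t /=; rewrite in_itv /= => /andP[t0 tx].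
  move: t0; rewrite le_eqVlt => /predU1P[<-|t0]; first by rewrite subrr normr0 ltW.
  apply: dP => //=; rewrite sub0r normrN gtr0_norm//; exact: le_lt_trans xd.
Unshelve. all: by end_near. Qed.

Lemma mean_continuous_within g h : integrable01 g -> g t @[t --> 0^'+] --> g 0 ->
  (forall x, 0 < x -> h x = mean g x) -> h 0 = g 0 ->
  {within `[0, 1], continuous h}.
Proof.
move=> ig g0 hE h0.
have /(continuous_within_itvP _ ltr01)[pc _ p1] := primitive_continuous ig.
apply/(continuous_within_itvP _ ltr01); split.
- move=> x x01; have x0 : 0 < x by move: x01; rewrite in_itv/= => /andP[].
  rewrite /continuous_at hE//.
  apply: (@cvg_trans _ (mean g y @[y --> x])).
    apply: near_eq_cvg; near=> y; rewrite hE//; near: y; exact: lt_nbhsr.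
  have xV : y^-1 @[y --> x] --> x^-1 by apply: cvgV; [rewrite gt_eqF|exact: cvg_id].
  exact: (cvgM xV (pc x x01)).
- rewrite h0; apply: cvg_trans (mean_cvg0 ig g0).
  by apply: near_eq_cvg; near=> y; rewrite hE.
- rewrite hE//; apply: (@cvg_trans _ (mean g y @[y --> 1^'-])).
    by apply: near_eq_cvg; near=> y; rewrite hE.
  have V1 : y^-1 @[y --> (1 : R)^'-] --> (1 : R)^-1.
    apply: cvgV; first by rewrite oner_eq0.
    by apply: cvg_at_left_filter; exact: cvg_id.
  exact: (cvgM V1 p1).
Unshelve. all: by end_near. Qed.

End real_averages.

(** * The Volterra and Cesaro operators *)

Section averaging_operators.
Variables (R : realType) (s : scalars).
Local Notation K := (scalar_field R s).
Local Notation mu := (@lebesgue_measure R).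
Implicit Types (f g h : R -> K) (b : bool) (r : seq R).

Lemma sup_norm_le h (M : R) :
  (forall b x, 0 <= x <= 1 -> `|part b (h x)| <= M) -> (sup_norm h <= (2 * M)%:E)%E.
Proof.
move=> hM; apply: ge_ereal_sup => _ [x x01 <-]; rewrite lee_fin.
have {}x01 : 0 <= x <= 1 by move: x01; rewrite /= in_itv.
have := modulus_le_parts (h x); have := hM true x x01; have := hM false x x01; lra.
Qed.

Lemma volterra_continuous f : integrable_on `[0, 1] f -> continuous_01 (volterra_op f).
Proof.
move=> fi; apply: continuous_within_parts => b.
rewrite (_ : part b \o volterra_op f = primitive (part b \o f)); last first.
  by apply: funext => x; exact: part_volterra.
exact/primitive_continuous/integrable_part.
Qed.

Lemma volterra_variation f b r : integrable_on `[0, 1] f -> sorted_in 0 1 r ->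
  variation_from 0 (map (part b \o volterra_op f) r) <= L1 f.
Proof.
move=> fi r01; apply: le_trans (primitive_part_le_L1 b fi).
have ib := integrable_part b fi.
rewrite (_ : part b \o volterra_op f = primitive (part b \o f)); last first.
  by apply: funext => x; exact: part_volterra.
have r01' : sorted_in 0 1 (0 :: r).
  split=> [|x]; last by rewrite inE => /orP[/eqP ->|/(r01.2)//]; rewrite lexx ler01.
  rewrite /= (path_sortedE le_trans) r01.1 andbT.
  by apply/allP => x /(r01.2)/andP[].
have := @variation_le_monotone R (primitive (part b \o f))
  (primitive (fun t => `|part b (f t)|)) 0 1 (0 :: r) r01'.
rewrite /variation !primitive0 subr0; apply=> // x y x0 xy y1.
  exact: primitive_diff.
exact: primitive_norm_nondecr.
Qed.

Lemma linear_parts (a : K) f g b t : part b ((a *: f + g) t) =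
  (if b then real_part a else imag_part a) * part true (f t) +
  (if b then - imag_part a else real_part a) * part false (f t) + part b (g t).
Proof.
rewrite -[(a *: f + g) t]/(a * f t + g t) partD; congr (_ + _).
by case: b; [rewrite mulNr; exact: real_partM|rewrite addrC; exact: imag_partM].
Qed.

Section muntz_operators.
Variables (Lambda : nat -> R) (S : R).
Hypotheses (Lambda_ge0 : forall k, 0 <= Lambda k)
  (Lambda_incr : forall j k, (j < k)%N -> Lambda j < Lambda k)
  (Lambda_sum : forall n, \sum_(k < n | Lambda k != 0) (Lambda k)^-1 <= S).

Lemma muntz_cvg0 f b : muntz_L1 Lambda f ->
  (part b \o f) t @[t --> 0^'+] --> (part b \o f) 0.
Proof.
move=> [_ cf _]; have h0 : (0 : R) < 2^-1 by rewrite invr_gt0.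
have : {within `[(0 : R), 2^-1], continuous (part b \o f)}.
  have := continuous_within_part (b := b) cf; apply: continuous_subspaceW => x /=.
  by rewrite !in_itv /= => /andP[-> x1]; rewrite (le_lt_trans x1)// invf_lt1// ltr1n.
by move=> /(continuous_within_itvP _ h0)[].
Qed.

Lemma cesaro_continuous f : muntz_L1 Lambda f -> continuous_01 (cesaro_op f).
Proof.
move=> Xf; apply: continuous_within_parts => b.
have ib := integrable_part b (muntz_integrable Xf).
apply: (mean_continuous_within ib (muntz_cvg0 (b := b) Xf)) => [x x0|].
  by rewrite /= part_cesaro// gt_eqF.
by rewrite /= cesaro0.
Qed.

Lemma volterra_linear (a : K) f g : muntz_L1 Lambda f -> muntz_L1 Lambda g ->
  volterra_op (a *: f + g) = a *: volterra_op f + volterra_op g.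
Proof.
move=> Xf Xg; apply: funext => x; apply: part_eq => b.
have fi b' := integrable_part b' (muntz_integrable Xf).
have gi b' := integrable_part b' (muntz_integrable Xg).
rewrite linear_parts !part_volterra.
rewrite (_ : part b \o (a *: f + g) = fun t =>
  (if b then real_part a else imag_part a) * part true (f t) +
  (if b then - imag_part a else real_part a) * part false (f t) + part b (g t)); last first.
  by apply: funext => t; exact: linear_parts.
have [x1|x1] := leP x 1; first exact: (primitive_lin _ _ (fi true) (fi false) (gi b) x1).
have f0 b' t : ~~ (0 <= t < 1) -> part b' (f t) = 0.
  by case: Xf => _ _ f0 /f0 ->; exact: part0.
have g0 b' t : ~~ (0 <= t < 1) -> part b' (g t) = 0.
  by case: Xg => _ _ g0 /g0 ->; exact: part0.
have x1' := ltW x1.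
rewrite [LHS]primitive_beyond//; last first.
  by move=> t nt; rewrite !f0// g0// !mulr0 !addr0.
rewrite [primitive (part true \o f) x]primitive_beyond//; last exact: f0.
rewrite [primitive (part false \o f) x]primitive_beyond//; last exact: f0.
rewrite [primitive (part b \o g) x]primitive_beyond//; last exact: g0.
exact: (primitive_lin _ _ (fi true) (fi false) (gi b) (lexx 1)).
Qed.

Lemma cesaro_linear (a : K) f g : muntz_L1 Lambda f -> muntz_L1 Lambda g ->
  cesaro_op (a *: f + g) = a *: cesaro_op f + cesaro_op g.
Proof.
move=> Xf Xg; apply: funext => x.
rewrite -[RHS]/(a * cesaro_op f x + cesaro_op g x) /cesaro_op.
case: eqP => // _; rewrite volterra_linear//.
by rewrite -[X in _ * X]/(a * volterra_op f x + volterra_op g x) mulrDr mulrCA.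
Qed.

(** Besides linearity and continuity of the images, what the upper estimates need from an
operator. *)
Definition variation_bounded (C : R) (T : (R -> K) -> R -> K) : Prop :=
  forall f b r, muntz_L1 Lambda f -> sorted_in 0 1 r ->
    variation_from 0 (map (part b \o T f) r) <= C * L1 f.

(** The constant 1 makes the estimate of the Bernstein numbers sharp for real scalars. *)
Lemma volterra_variation_bounded : variation_bounded 1 (@volterra_op R s).
Proof.
by move=> f b r Xf r01; rewrite mul1r; exact: volterra_variation (muntz_integrable Xf) r01.
Qed.

(** On ]0, 1] this is the estimate for means, the first value being compared with the
one at 1.  Since the image is continuous at 0, points below a small [e'] may be
moved to [e']. *)
Lemma cesaro_variation_bounded : exists2 C, 0 < C &
  variation_bounded C (@cesaro_op R s).
Proof.
have [C C0 CP] := cesaro_variation Lambda_ge0 Lambda_incr Lambda_sum.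
exists (1 + 2 * C); first by lra.
move=> f b r Xf r01.
have fi := muntz_integrable Xf; have ib := integrable_part b fi.
have N1 := primitive_part_le_L1 b fi.
set m := mean (part b \o f).
have away e t : 0 < e -> sorted_in e 1 t -> variation m t <= C * L1 f.
  move=> e0 te; apply: le_trans (CP _ ib (muntz_part_approximable Lambda_ge0 b Xf) e t e0 te) _.
  by apply: ler_wpM2l => //; exact: ltW.
have m1 : `|m 1| <= L1 f.
  rewrite /m /mean invr1 mul1r; apply: le_trans N1.
  exact: (normr_primitive ib ler01 (lexx 1)).
have from0 e t : 0 < e -> sorted_in e 1 t ->
    variation_from 0 (map m t) <= (1 + 2 * C) * L1 f.
  case: t => [_ _|x t e0 te].
    by rewrite mulr_ge0 ?L1_ge0//; lra.
  have /andP[ex x1] := te.2 x (mem_head _ _).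
  have := away e _ e0 te.
  have : variation m [:: x; 1] <= C * L1 f.
    apply: (away e) => //; split; first by rewrite /= x1.
    by move=> y; rewrite !inE => /orP[] /eqP ->; rewrite ?ex ?lexx ?(le_trans ex x1).
  rewrite /= addr0 subr0 => h1 h2.
  have := ler_distD (m 1) (m x) 0; rewrite !subr0 distrC; lra.
apply/ler_addgt0Pr => eta eta0.
pose h := part b \o cesaro_op f.
pose d := eta / (4 * (size r).+1%:R).
have d0 : 0 < d by rewrite divr_gt0// mulr_gt0.
have [e e0 eP] : exists2 e, 0 < e & forall x, 0 < x -> x <= e -> `|h 0 - h x| <= d.
  have /continuous_within_itvP := continuous_within_part (b := b) (cesaro_continuous Xf).
  move=> /(_ ltr01)[_ /cvgrPdist_le/(_ _ d0)[e /= e0 eP] _].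
  exists (e / 2); first by rewrite divr_gt0.
  move=> x x0 xe; apply: eP => //=; rewrite sub0r normrN gtr0_norm//; lra.
have {}eP x : 0 <= x <= e -> `|h 0 - h x| <= d.
  move=> /andP[]; rewrite le_eqVlt => /predU1P[<- _|]; last exact: eP.
  by rewrite subrr normr0 ltW.
pose e' := Num.min e 1.
have e'0 : 0 < e' by rewrite lt_min e0 ltr01.
pose clip x := Num.max e' x.
have clip_sorted : sorted_in e' 1 (map clip r).
  split.
    apply: homo_sorted r01.1 => x y xy.
    by rewrite /clip ge_max le_max lexx /= le_max xy orbT.
  move=> _ /mapP[x /(r01.2)/andP[x0 x1] ->].
  by rewrite /clip le_max lexx /= ge_max x1 andbT /e' ge_min lexx orbT.
have close x : 0 <= x <= 1 -> `|h x - m (clip x)| <= 2 * d.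
  move=> /andP[x0 x1].
  have cx0 : 0 < clip x by rewrite lt_max e'0.
  have -> : m (clip x) = h (clip x) by rewrite /h /= part_cesaro// gt_eqF.
  have [xe|xe] := leP x e'; last first.
    rewrite /clip (max_idPr (ltW xe)) subrr normr0 mulr_ge0//; exact: ltW.
  rewrite /clip (max_idPl xe).
  have e'e : e' <= e by rewrite /e' ge_min lexx.
  have h1 : `|h 0 - h x| <= d by apply: eP; rewrite x0 (le_trans xe).
  have h2 : `|h 0 - h e'| <= d by apply: eP; rewrite (ltW e'0).
  by have := ler_distD (h 0) (h x) (h e'); rewrite [`|h x - h 0|]distrC; lra.
have d20 : `|0 - 0 : R| <= 2 * d by rewrite subrr normr0 mulr_ge0// ltW.
have r01P x (xr : x \in r) := close x (r01.2 x xr).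
have := variation_from_close d20 r01P.
rewrite -/h.
have -> : [seq m (clip x) | x <- r] = map m (map clip r) by rewrite -map_comp.
have := from0 e' _ e'0 clip_sorted.
have : 2 * (size r)%:R * (2 * d) <= eta.
  have -> : 2 * (size r)%:R * (2 * d) = eta * ((size r)%:R / (size r).+1%:R).
    by rewrite /d; field; apply: lt0r_neq0; have : 0 <= (size r)%:R :> R; [by []|lra].
  by rewrite ler_piMr// ?(ltW eta0)// ler_pdivrMr// mul1r ler_nat.
lra.
Qed.

Lemma variation_bounded_sup C T f : 0 <= C -> variation_bounded C T -> muntz_L1 Lambda f ->
  forall b x, 0 <= x <= 1 -> `|part b (T f x)| <= C * L1 f.
Proof.
move=> C0 CT Xf b x x01.
have := CT f b [:: x] Xf; rewrite /= subr0 addr0; apply; split=> // y.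
by rewrite inE => /eqP ->.
Qed.

Lemma averaging_operator_bounded C T : 0 <= C -> variation_bounded C T ->
  (forall f, muntz_L1 Lambda f -> continuous_01 (T f)) ->
  (forall (a : K) f g, muntz_L1 Lambda f -> muntz_L1 Lambda g ->
     T (a *: f + g) = a *: T f + T g) ->
  bounded_linear_operator (@muntz_L1 R s Lambda) (@L1_norm R s)
    (@continuous_01 R s) (@sup_norm R s) T.
Proof.
move=> C0 CT Tc Tl; split=> //; exists (2 * C) => f Xf.
rewrite (L1_normE (muntz_integrable Xf)) -EFinM -mulrA.
by apply: sup_norm_le; exact: variation_bounded_sup.
Qed.

End muntz_operators.
End averaging_operators.

(** * Oscillating combinations of finitely many functions *)

Section oscillating_combination.
Variables (R : realType) (Q : eqType) (d : nat) (phi : 'I_d.+1 -> Q -> R).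
Implicit Types (c : 'rV[R]_d.+1) (L : seq Q).

Definition comb c (q : Q) : R := \sum_i c 0 i * phi i q.

Definition sample_mx L : 'M[R]_(d.+1, size L) := \matrix_(i, j) phi i (tnth (in_tuple L) j).

Lemma sample_mxE c L j : (c *m sample_mx L) 0 j = comb c (tnth (in_tuple L) j).
Proof. by rewrite mxE; apply: eq_bigr => i _; rewrite mxE. Qed.

Lemma combB c q q' : `|comb c q - comb c q'| <=
  \sum_i `|c 0 i| * `|phi i q - phi i q'|.
Proof.
rewrite /comb -sumrB; apply: le_trans (ler_norm_sum _ _ _) _.
by apply: ler_sum => i _; rewrite -mulrBr normrM.
Qed.

(** A sample of maximal rank separates: a combination vanishing on it vanishes at any
further point, as adding that point does not increase the rank. *)
Lemma separating_sample (D : set Q) :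
  (forall c, (forall q, D q -> comb c q = 0) -> c = 0) ->
  exists2 L, {in L, forall q, D q} & row_free (sample_mx L).
Proof.
move=> indep.
pose P m := `[< exists2 L, {in L, forall q, D q} & \rank (sample_mx L) = m >].
have P0 : exists m, P m.
  by exists (\rank (sample_mx [::])); apply/asboolP; exists [::].
have Pd m : P m -> (m <= d.+1)%N by move=> /asboolP[L _ <-]; exact: rank_leq_row.
have [m /asboolP[L LD Lm] maxm] := ex_maxnP P0 Pd.
exists L => //; apply: inj_row_free => c cL; apply: indep => q Dq.
have : P (\rank (sample_mx (q :: L))).
  by apply/asboolP; exists (q :: L) => // q'; rewrite inE => /orP[/eqP ->|/LD].
move/maxm; rewrite -Lm -mxrank_tr -[X in (_ <= X)%N]mxrank_tr => rk.
have sub : ((sample_mx L)^T <= (sample_mx (q :: L))^T)%MS.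
  apply/row_subP => j; have -> : row j (sample_mx L)^T =
      row (lift ord0 j) (sample_mx (q :: L))^T.
    by apply/rowP => i; rewrite !mxE !(tnth_nth q).
  exact: row_sub.
have /eqmxP eqLq : ((sample_mx L)^T == (sample_mx (q :: L))^T)%MS.
  by rewrite -(geq_leqif (mxrank_leqif_eq sub)).
have /submxP[x qx] : (row ord0 (sample_mx (q :: L))^T <= (sample_mx L)^T)%MS.
  by rewrite eqLq row_sub.
have -> : comb c q = (c *m (row ord0 (sample_mx (q :: L))^T)^T) 0 0.
  by rewrite mxE; apply: eq_bigr => i _; rewrite !mxE (tnth_nth q).
by rewrite qx trmx_mul trmxK mulmxA cL mul0mx mxE.
Qed.

(** A right inverse of the sample matrix expresses the coefficients by the values at
the sample points. *)
Lemma row_free_norm_bound (L : seq Q) : row_free (sample_mx L) ->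
  exists2 beta, 0 < beta & forall c eta, 0 <= eta ->
    {in L, forall q, `|comb c q| <= eta} -> \sum_i `|c 0 i| <= beta * eta.
Proof.
move=> /row_freeP[B LB].
exists (1 + \sum_i \sum_j `|B j i|).
  by rewrite ltr_pwDl// sumr_ge0// => i _; rewrite sumr_ge0.
move=> c eta eta0 cL; rewrite mulrDl mul1r -[leLHS]add0r lerD// mulr_suml.
apply: ler_sum => i _; rewrite mulr_suml.
have -> : c 0 i = \sum_j (c *m sample_mx L) 0 j * B j i.
  by rewrite -[in LHS](mulmx1 c) -LB mulmxA mxE.
apply: le_trans (ler_norm_sum _ _ _) _; apply: ler_sum => j _.
by rewrite normrM mulrC ler_wpM2l// sample_mxE cL// mem_tnth.
Qed.

(** The oscillating vector is found on a list of points that contains a separating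
sample and is a fine net.  The sample bounds the coefficients independently of the
list; therefore passing from the perturbed matrix to the true values, and from the
list to all points, costs arbitrarily little.  Linear dependence is the first
alternative. *)
Lemma oscillating_combination (D : set Q) (admissible : set (seq Q)) (eps : R) :
  0 < eps ->
  (forall (ts : seq Q) (e : R), 0 < e -> {in ts, forall q, D q} -> exists L,
    [/\ admissible L, {in L, forall q, D q}, {subset ts <= L} &
      forall q, D q -> exists2 q', q' \in L & forall i, `|phi i q - phi i q'| <= e]) ->
  (exists2 c, c != 0 & forall q, D q -> comb c q = 0) \/
  exists c L, [/\ admissible L, {in L, forall q, D q},
    forall q, D q -> `|comb c q| <= 1 + eps &
    2 * d%:R + 1 - eps <= variation_from 0 (map (comb c) L)].
Proof.
move=> eps0 dense.
have [[c [c0 cD]]|nc] := pselect (exists c, c != 0 /\ forall q, D q -> comb c q = 0).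
  by left; exists c.
right; have [|ts tsD tsfree] := @separating_sample D.
  move=> c cD; apply/eqP; apply: contrapT => /negP c0; apply: nc.
  by exists c.
have [beta beta0 betaP] := row_free_norm_bound tsfree.
have [|L [adL LD tsL net]] := dense ts (eps / (4 * beta)) _ tsD.
  by rewrite divr_gt0// mulr_gt0.
have N0 : 0 <= (size L)%:R :> R by [].
pose N1 := 1 + (size L)%:R : R.
have N10 : 0 < N1 by rewrite /N1; lra.
(* The first bound keeps the coefficients below 2 * beta, the second one pays for the
   size L increments of the variation. *)
pose delta := Num.min (2 * beta)^-1 (eps / (4 * beta * N1)).
have delta0 : 0 < delta by rewrite lt_min !(invr_gt0, divr_gt0, mulr_gt0).
have dN : (d < size L)%N.
  have /eqP <- : row_free (sample_mx L); last exact: rank_leq_col.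
  apply: inj_row_free => c cL; apply/rowP => i; rewrite mxE.
  have : \sum_i `|c 0 i| <= beta * 0.
    apply: betaP => // q /tsL/(nthP q)[j jL <-].
    have := sample_mxE c (Ordinal jL : 'I_(size L)); rewrite cL mxE (tnth_nth q) /= => <-.
    by rewrite normr0.
  rewrite mulr0 (bigD1 i)//= => h; apply/eqP; rewrite -normr_le0.
  by apply: le_trans h; rewrite lerDl sumr_ge0.
have [A [c [AL c1 cvar]]] := zigzag_vector (sample_mx L) dN delta0.
set kappa := \sum_i `|c 0 i|.
have kappa0 : 0 <= kappa by rewrite sumr_ge0.
have close j : `|comb c (tnth (in_tuple L) j) - (c *m A) 0 j| <= kappa * delta.
  rewrite -sample_mxE distrC [X in `|X - _|]mxE [X in `|_ - X|]mxE -sumrB mulr_suml.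
  apply: le_trans (ler_norm_sum _ _ _) _; apply: ler_sum => i _.
  by rewrite -mulrBr normrM ler_wpM2l.
have cL q : q \in L -> `|comb c q| <= 1 + kappa * delta.
  move=> /(nthP q)[j jL <-]; have := close (Ordinal jL); rewrite (tnth_nth q) /= => h.
  have := ler_distD ((c *m A) 0 (Ordinal jL)) (comb c (nth q L j)) 0.
  by rewrite !subr0; have := c1 (Ordinal jL); lra.
have kd0 : 0 <= kappa * delta by rewrite mulr_ge0// ltW.
have kappa_le : kappa <= 2 * beta.
  have h : kappa <= beta * (1 + kappa * delta).
    by apply: betaP => [|q /tsL/cL//]; lra.
  have : beta * delta <= 2^-1.
    have -> : 2^-1 = beta * (2 * beta)^-1 :> R by field; rewrite lt0r_neq0.
    by apply: ler_wpM2l; [exact: ltW|rewrite ge_min lexx].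
  by move=> /(ler_wpM2l kappa0); lra.
have kd_le : kappa * delta <= eps / (2 * N1).
  have -> : eps / (2 * N1) = 2 * beta * (eps / (4 * beta * N1)).
    by field; rewrite !lt0r_neq0.
  by apply: ler_pM => //; [exact: ltW|rewrite ge_min lexx orbT].
have kdN : kappa * delta * (2 * N1) <= eps by rewrite -ler_pdivlMr// mulr_gt0.
have kdN' : 0 <= kappa * delta * (size L)%:R by rewrite mulr_ge0.
move: kdN; rewrite /N1 => kdN.
exists c, L; split=> // [q Dq|].
  have [q' q'L qq'] := net q Dq.
  have : `|comb c q - comb c q'| <= kappa * (eps / (4 * beta)).
    apply: le_trans (combB _ _ _) _; rewrite mulr_suml; apply: ler_sum => i _.
    exact: ler_wpM2l.
  have : kappa * (eps / (4 * beta)) <= 2 * beta * (eps / (4 * beta)).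
    by apply: ler_wpM2r => //; rewrite divr_ge0 ?ltW// mulr_gt0.
  have -> : 2 * beta * (eps / (4 * beta)) = eps / 2 by field; rewrite lt0r_neq0.
  have := ler_distD (comb c q') (comb c q) 0; rewrite !subr0.
  have := cL q' q'L; lra.
have := @variation_from_close R _ (fun j => (c *m A) 0 j)
  (fun j => comb c (tnth (in_tuple L) j)) 0 0 (kappa * delta) (enum 'I_(size L)).
rewrite subrr normr0 => /(_ kd0) H.
have {H} := H (fun j _ => eq_ind _ (fun x => x <= _) (close j) _ (distrC _ _)).
rewrite size_enum_ord.
have -> : map (comb c) L = [seq comb c (tnth (in_tuple L) j) | j <- enum 'I_(size L)].
  transitivity (map (comb c) (map (tnth (in_tuple L)) (enum 'I_(size L)))).
    by rewrite map_tnth_enum.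
  by rewrite -map_comp.
lra.
Qed.

End oscillating_combination.

(** * Uniform continuity and concatenated variation *)

Section nets.
Variable R : realType.

(** Compactness of [[0, 1]], used through neighbourhood covers indexed by the modulus. *)
Lemma uniform_modulus (I : finType) (h : I -> R -> R) (e : R) : 0 < e ->
  (forall i, {within `[(0 : R), 1], continuous (h i)}) ->
  exists2 d, 0 < d & forall x y, 0 <= x <= 1 -> 0 <= y <= 1 -> `|x - y| < d ->
    forall i, `|h i x - h i y| <= e.
Proof.
move=> e0 hc.
have e2 : 0 < e / 2 by rewrite divr_gt0.
have /compact_near_coveringP/near_covering_withinP cov := @segment_compact R 0 1.
pose P (d x : R) := forall y, 0 <= y <= 1 -> `|x - y| < d ->
  forall i, `|h i x - h i y| <= e.
have := cov R (0 : R)^'+ P _; move=> /(_ _)[|d /= d0 dP].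
  move=> x x01; have x01' : 0 <= x <= 1 by move: x01; rewrite /= in_itv.
  have : \forall y \near within `[(0 : R), 1] (nbhs x), forall i, `|h i x - h i y| <= e / 2.
    apply: filter_forall => i.
    have := hc i x; rewrite /continuous_at => /cvgrPdist_le/(_ _ e2).
    by rewrite /= nbhs_subspace_in.
  move=> /nbhs_ballP[d /= d0 dP].
  have d2 : 0 < d / 2 by rewrite divr_gt0.
  exists (ball x (d / 2), [set t | t < d / 2]) => /=.
    by split; [exact: nbhsx_ballx|exact: nbhs_right_lt].
  move=> [z t] [/= xz td] z01 y y01 zy i.
  have hz : `|h i x - h i z| <= e / 2.
    by apply: dP => //; apply: le_ball xz; lra.
  have hy : `|h i x - h i y| <= e / 2.
    apply: dP; last by rewrite /= in_itv.
    rewrite /ball /=; move: xz; rewrite /ball /= => xz.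
    by have := ler_distD z x y; lra.
  by have := ler_distD (h i x) (h i z) (h i y); rewrite [`|h i z - h i x|]distrC; lra.
have d2 : 0 < d / 2 by rewrite divr_gt0.
exists (d / 2) => // x y x01 y01 xy; apply: (dP (d / 2)) => //=.
by rewrite sub0r normrN gtr0_norm//; lra.
Qed.

Lemma finite_net (I : finType) (h : I -> R -> R) (e : R) : 0 < e ->
  (forall i, {within `[(0 : R), 1], continuous (h i)}) ->
  exists2 r : seq R, {in r, forall x, 0 <= x <= 1} &
    forall x, 0 <= x <= 1 -> exists2 y, y \in r & forall i, `|h i x - h i y| <= e.
Proof.
move=> e0 /(uniform_modulus e0)[d d0 dP].
pose N := (Num.truncn d^-1).+1.
have N0 : 0 < N%:R :> R by rewrite ltr0n.
have Nd : N%:R^-1 < d.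
  by rewrite invf_plt ?posrE//; exact: truncnS_gt.
exists [seq k%:R / N%:R | k <- iota 0 N.+1] => [_ /mapP[k + ->]|x x01].
  rewrite mem_iota add0n ltnS /= => kN.
  by rewrite divr_ge0//= ler_pdivrMr// mul1r ler_nat.
have /andP[x0 x1] := x01.
pose k := Num.truncn (x * N%:R).
have xN0 : 0 <= x * N%:R by rewrite mulr_ge0.
have /andP[k1 k2] := truncn_itv xN0.
have kN : (k <= N)%N.
  by rewrite -(ler_nat R); apply: le_trans k1 _; rewrite ler_piMl// ltW.
exists (k%:R / N%:R); first by apply/mapP; exists k => //; rewrite mem_iota add0n ltnS.
apply: dP => //.
  by rewrite divr_ge0//= ler_pdivrMr// mul1r ler_nat.
apply: le_lt_trans Nd; rewrite ger0_norm; last first.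
  by rewrite subr_ge0 ler_pdivrMr.
rewrite lerBlDr -[X in _ <= X + _]mul1r -mulrDl ler_pdivlMr// addrC.
by rewrite natr1 ltW.
Qed.
End nets.

Section concatenated_variation.
Variable R : realFieldType.
Implicit Types (y M : R) (u v : seq R).

Lemma variation_from_cat y u v :
  variation_from y (u ++ v) = variation_from y u + variation_from (last y u) v.
Proof. by elim: u y => [|x u IH] y /=; rewrite ?add0r// IH addrA. Qed.

Lemma last_le_variation y u : `|last y u - y| <= variation_from y u.
Proof.
elim: u y => [|x u IH] y /=; first by rewrite subrr normr0.
by have := IH x; have := ler_distD x (last x u) y; lra.
Qed.

Lemma variation_from_base y u : variation_from y u <= `|y| + variation_from 0 u.
Proof.
case: u => [|x u] /=; first by rewrite addr0.
by have := ler_normB x y; rewrite subr0; lra.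
Qed.

(** The real and the imaginary part of a function are listed one after the other; the
jump between two lists costs at most the variation of the first one. *)
Lemma variation_allpairs (B : eqType) (A : Type) (b : B) (bs : seq B) (r : seq A)
    (F : B * A -> R) (M : R) : 0 <= M ->
  {in b :: bs, forall b', variation_from 0 [seq F (b', x) | x <- r] <= M} ->
  variation_from 0 (map F [seq (b', x) | b' <- b :: bs, x <- r]) <=
    (2 * (size bs)%:R + 1) * M.
Proof.
move=> M0; elim: bs b => [|b' bs IH] b bM.
  rewrite /= cats0 -map_comp mulr0 add0r mul1r.
  by have := bM b (mem_head _ _); rewrite [map _ r](eq_map (g := F \o pair b)).
rewrite allpairs_cons map_cat variation_from_cat.
have h := bM b (mem_head _ _).
have -> : map F [seq (b, x) | x <- r] = [seq F (b, x) | x <- r] by rewrite -map_comp.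
have := IH b' (fun b'' b''s => bM b'' (mem_behead (s := b :: b' :: bs) b''s)).
set v := map F _; set u := map _ r => h'.
have := last_le_variation 0 u; rewrite subr0.
have := variation_from_base (last 0 u) v; rewrite -[size (b' :: bs)]/(size bs).+1 -natr1.
rewrite -/u in h; lra.
Qed.

End concatenated_variation.

(** * Small images in finite-dimensional subspaces *)

Section L1_separated.
Variables (R : realType) (s : scalars) (Lambda : nat -> R).
Local Notation K := (scalar_field R s).

(** All primitives vanish, so the function vanishes at its points of continuity, by
differentiation inside ]0, 1[ and as a limit of means at 0. *)
Lemma muntz_L1_eq0 (f : R -> K) : muntz_L1 Lambda f -> L1 f = 0 -> f = 0.
Proof.
move=> Xf f0; have fi := muntz_integrable Xf.
have prim0 b x : 0 <= x <= 1 -> primitive (part b \o f) x = 0.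
  move=> /andP[x0 x1]; have ib := integrable_part b fi.
  apply/eqP; rewrite -normr_le0 -f0; apply: le_trans (primitive_part_le_L1 b fi).
  apply: le_trans (normr_primitive ib x0 x1) _.
  exact: primitive_norm_nondecr.
have [_ cf fout] := Xf.
apply: funext => x; apply: part_eq => b; rewrite [RHS]part0.
have ib := integrable_part b fi.
have [x01|/fout ->] := boolP (0 <= x < 1); last exact: part0.
have /andP[+ x1] := x01; rewrite le_eqVlt => /predU1P[<-|x0].
  have H : mean (part b \o f) t @[t --> 0^'+] --> (0 : R).
    apply: (@cvg_trans _ ((fun=> (0 : R)) t @[t --> (0 : R)^'+])); last exact: cvg_cst.
    apply: near_eq_cvg; near=> t; rewrite /mean prim0 ?mulr0//.
    by apply/andP; split => //; near: t; apply: nbhs_right_le; exact: ltr01.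
  have := mean_cvg0 ib (muntz_cvg0 Xf (b := b)).
  by move/(cvg_unique _ H)/esym; apply.
have xoo : x \in `]0, 1[ by rewrite in_itv/= x0.
have cx : {for x, continuous (part b \o f)}.
  have : {within `](0 : R), 1[, continuous (part b \o f)}.
    have := continuous_within_part (b := b) cf; apply: continuous_subspaceW => z /=.
    by rewrite !in_itv /= => /andP[/ltW -> ->].
  rewrite continuous_open_subspace; first by apply; rewrite inE.
  exact: interval_open.
have [dF Fx] := continuous_FTC1_closed x1 ib x0 cx.
rewrite -[LHS]Fx derive1E.
rewrite (_ : 'D_1 _ x = 'D_1 (cst (0 : R)) x); first by rewrite derive_cst.
apply: near_eq_derive.
near=> t; rewrite /cst -[LHS]/(primitive (part b \o f) t) prim0//.
by apply/andP; split; apply: ltW; near: t; [exact: lt_nbhsr|exact: lt_nbhsl].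
Unshelve. all: by end_near. Qed.
End L1_separated.

Section small_images.
Variables (R : realType) (s : scalars) (Lambda : nat -> R).
Local Notation K := (scalar_field R s).
Variables (T : (R -> K) -> R -> K) (C : R).
Hypotheses (C0 : 0 < C) (TC : variation_bounded Lambda C T)
  (T_continuous : forall f, muntz_L1 Lambda f -> continuous_01 (T f))
  (T_linear : forall (a : K) f g, muntz_L1 Lambda f -> muntz_L1 Lambda g ->
     T (a *: f + g) = a *: T f + T g).
Variable E : set (R -> K).
Hypotheses (E_linear : linear_subspace E) (EX : E `<=` muntz_L1 Lambda).

Lemma subspace_lin (a : K) f g : E f -> E g -> E (a *: f + g).
Proof. by move=> Ef Eg; have := E_linear.2 a f g; rewrite !inE; apply. Qed.

Lemma subspace0 : E 0.
Proof. by have := E_linear.1; rewrite inE. Qed.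

Lemma subspace_sum (I : Type) (r : seq I) (a : I -> K) (g : I -> R -> K) :
  (forall i, E (g i)) -> E (\sum_(i <- r) a i *: g i).
Proof.
move=> Eg; elim: r => [|i r IH]; first by rewrite big_nil; exact: subspace0.
by rewrite big_cons; exact: subspace_lin.
Qed.

Lemma operator0 : T 0 = 0.
Proof.
have X0 := EX subspace0.
by have := T_linear (-1) X0 X0; rewrite scaler0 addr0 scaleN1r addNr.
Qed.

Lemma operator_sum (I : Type) (r : seq I) (a : I -> K) (g : I -> R -> K) :
  (forall i, E (g i)) -> T (\sum_(i <- r) a i *: g i) = \sum_(i <- r) a i *: T (g i).
Proof.
move=> Eg; elim: r => [|i r IH]; first by rewrite !big_nil operator0.
by rewrite !big_cons T_linear ?IH//; apply: EX => //; exact: subspace_sum.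
Qed.

Lemma L1_scale (a : R) f : integrable_on `[0, 1] f -> 0 <= a ->
  L1 (of_parts s a 0 *: f) = a * L1 f.
Proof.
move=> fi a0; rewrite /L1 /primitive -RintegralZl//; last exact: integrable_modulus.
apply: eq_Rintegral => t _; rewrite -[X in modulus X]/(of_parts s a 0 * f t).
by rewrite modulusM modulus_real ger0_norm.
Qed.

Section real_basis.
Variables (d : nat) (g : 'I_d.+1 -> R -> K) (b0 : bool) (bs : seq bool).
Hypotheses (Eg : forall i, E (g i))
  (g_free : forall c : 'I_d.+1 -> R, \sum_i of_parts s (c i) 0 *: g i = 0 ->
     forall i, c i = 0)
  (all_parts : forall (z : K) b, b \notin b0 :: bs -> part b z = 0).

Let real_comb (c : 'I_d.+1 -> R) : R -> K := \sum_i of_parts s (c i) 0 *: g i.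

Let real_comb_in c : E (real_comb c).
Proof. exact: subspace_sum. Qed.

Let part_real_comb c b x : part b (T (real_comb c) x) = \sum_i c i * part b (T (g i) x).
Proof.
rewrite operator_sum// fct_sumE part_sum; apply: eq_bigr => i _.
exact: part_real.
Qed.

Let ratio := (2 * (size bs)%:R + 1) * C / (2 * d%:R + 1).

(** An oscillating combination [h] of the parts of the images satisfies
[2 d + 1 - e <= variation <= (2 (size bs) + 1) * C * L1 norm], where [d.+1] is the real
dimension, while its sup norm is at most [1 + e]; dividing by the norm gives the
ratio.  The list [b0 :: bs] names the parts that can be different from 0. *)
Lemma small_image_parts (eps : R) : 0 < eps -> exists c,
  L1 (real_comb c) = 1 /\ forall b x, 0 <= x <= 1 ->
    `|part b (T (real_comb c) x)| <= ratio + eps.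
Proof.
move=> eps0.
have ratio0 : 0 <= ratio by rewrite divr_ge0 ?mulr_ge0 ?addr_ge0 ?mulr_ge0// ltW.
have normalize c (M : R) : 0 < L1 (real_comb c) ->
    (forall b x, b \in b0 :: bs -> 0 <= x <= 1 -> `|part b (T (real_comb c) x)| <= M) ->
    M <= (ratio + eps) * L1 (real_comb c) ->
    exists c', L1 (real_comb c') = 1 /\ forall b x, 0 <= x <= 1 ->
      `|part b (T (real_comb c') x)| <= ratio + eps.
  move=> l0 cM Ml; set l := L1 _ in l0 Ml.
  have l0' : 0 <= l^-1 by rewrite invr_ge0 ltW.
  exists (fun i => l^-1 * c i).
  have -> : real_comb (fun i => l^-1 * c i) = of_parts s l^-1 0 *: real_comb c.
    rewrite /real_comb scaler_sumr; apply: eq_bigr => i _.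
    by rewrite of_parts_realM scalerA.
  have Xc := EX (real_comb_in c).
  split.
    by rewrite L1_scale//; [exact: mulVf (lt0r_neq0 l0)|exact: muntz_integrable Xc].
  move=> b x x01.
  have [bin|bout] := boolP (b \in b0 :: bs); last first.
    by rewrite all_parts// normr0 addr_ge0// ltW.
  have -> : T (of_parts s l^-1 0 *: real_comb c) = of_parts s l^-1 0 *: T (real_comb c).
    have := T_linear (of_parts s l^-1 0) Xc (EX subspace0).
    by rewrite operator0 !addr0.
  rewrite -[X in part b X]/(of_parts s l^-1 0 * T (real_comb c) x) part_real normrM.
  rewrite (ger0_norm l0') mulrC ler_pdivrMr//.
  exact: le_trans (cM b x bin x01) Ml.
pose phi (i : 'I_d.+1) (q : bool * R) : R := part q.1 (T (g i) q.2).
pose D : set (bool * R) := [set q | q.1 \in b0 :: bs /\ 0 <= q.2 <= 1].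
pose adm : set (seq (bool * R)) :=
  [set [seq (b, x) | b <- b0 :: bs, x <- r] | r in [set r | sorted_in 0 1 r]].
pose B := (2 * (size bs)%:R + 1) * C.
have B0 : 0 < B by rewrite mulr_gt0.
(* This tolerance makes (1 + e) * B / (2 d + 1 - e) at most ratio + eps. *)
pose e := eps / (2 * B + eps).
have e0 : 0 < e by rewrite divr_gt0//; lra.
have combE c q : comb phi c q = part q.1 (T (real_comb (fun i => c 0 i)) q.2).
  by rewrite part_real_comb.
have dense (ts : seq (bool * R)) (e1 : R) : 0 < e1 -> {in ts, forall q, D q} -> exists L,
    [/\ adm L, {in L, forall q, D q}, {subset ts <= L} &
      forall q, D q -> exists2 q', q' \in L & forall i, `|phi i q - phi i q'| <= e1].
  move=> e10 tsD.
  have [|r0 r01 net] := @finite_net R ('I_d.+1 * bool)%type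
    (fun ib x => part ib.2 (T (g ib.1) x)) e1 e10.
    move=> [i b] /=; apply: (continuous_within_part (b := b)).
    exact: T_continuous (EX (Eg i)).
  pose r := sort <=%R (r0 ++ map snd ts).
  have rE x : (x \in r) = (x \in r0) || (x \in map snd ts) by rewrite mem_sort mem_cat.
  have r_in : sorted_in 0 1 r.
    split; first by apply: sort_sorted; exact: le_total.
    by move=> x; rewrite rE => /orP[/r01//|/mapP[q /tsD[_ q01] ->]].
  exists [seq (b, x) | b <- b0 :: bs, x <- r]; split; first by exists r.
  - by move=> q /allpairsP[[b x] /= [bin xr ->]]; split=> //; exact: r_in.2.
  - move=> [b x] qts; have [bin x01] := tsD _ qts.
    apply: allpairs_f => //; rewrite rE; apply/orP; right; exact: (map_f snd qts).
  - move=> [b x] [bin x01]; have [y yr0 yP] := net x x01.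
    exists (b, y); first by apply: allpairs_f => //; rewrite rE yr0.
    by move=> i; exact: (yP (i, b)).
have [[c c0 cD]|[c [L [[r r01 <-] LD cD cvar]]]] :=
    @oscillating_combination R _ d phi D adm e e0 dense.
  apply: (normalize (fun i => c 0 i) 0).
  - rewrite lt_neqAle L1_ge0 andbT; apply: contra c0 => /eqP/esym l0.
    have f0 := muntz_L1_eq0 (EX (real_comb_in _)) l0.
    by apply/eqP/rowP => i; rewrite mxE; exact: (g_free f0).
  - move=> b x bin x01; have := cD (b, x) (conj bin x01).
    by rewrite combE => /= ->; rewrite normr0.
  - by rewrite mulr_ge0 ?L1_ge0// addr_ge0// ltW.
set f := real_comb (fun i => c 0 i).
have Xf : muntz_L1 Lambda f := EX (real_comb_in _).
have d0 : 0 <= d%:R :> R by [].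
have varL : variation_from 0 (map (comb phi c) [seq (b, x) | b <- b0 :: bs, x <- r]) <=
    (2 * (size bs)%:R + 1) * (C * L1 f).
  apply: variation_allpairs => [|b' b'in]; first by rewrite mulr_ge0 ?L1_ge0// ltW.
  rewrite (eq_map (g := part b' \o T f)); first exact: TC.
  by move=> x /=; rewrite combE.
have eE : e * (2 * B + eps) = eps by rewrite /e divfK// gt_eqF//; lra.
have m0 : 0 < 2 * d%:R + 1 :> R by lra.
have ratioE : ratio * (2 * d%:R + 1) = B by rewrite /ratio -/B divfK// gt_eqF.
have ratioB : ratio <= B by rewrite -ratioE ler_peMr//; lra.
have key : (1 + e) * B <= (ratio + eps) * (2 * d%:R + 1 - e).
  have h1 : 0 <= eps * d%:R by rewrite mulr_ge0// ltW.
  have h2 : e * ratio <= e * B by rewrite ler_wpM2l// ltW.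
  have -> : (ratio + eps) * (2 * d%:R + 1 - e) =
      ratio * (2 * d%:R + 1) + 2 * (eps * d%:R) + eps - e * ratio - e * eps by ring.
  by rewrite ratioE; move: eE; rewrite mulrDr mulrCA; lra.
have lm : 2 * d%:R + 1 - e <= B * L1 f.
  by apply: (le_trans cvar); apply: (le_trans varL); rewrite /B mulrA.
apply: (normalize (fun i => c 0 i) (1 + e)).
- rewrite -/f lt_neqAle L1_ge0 andbT; apply/eqP => l0.
  have e1 : e < 1 by rewrite /e ltr_pdivrMr; lra.
  by move: lm; rewrite -l0 mulr0; lra.
- by move=> b x bin x01; have := cD (b, x) (conj bin x01); rewrite combE.
- rewrite -/f.
  rewrite -(ler_pM2r B0); apply: (le_trans key).
  by rewrite -mulrA [L1 f * B]mulrC ler_wpM2l// addr_ge0// ltW.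
Qed.

End real_basis.
End small_images.

(** * Upper bounds for Bernstein numbers *)

Section bernstein_upper.
Variables (R : realType) (s : scalars) (Lambda : nat -> R).
Local Notation K := (scalar_field R s).
Variables (T : (R -> K) -> R -> K) (C : R).
Hypotheses (C0 : 0 < C) (TC : variation_bounded Lambda C T)
  (T_continuous : forall f, muntz_L1 Lambda f -> continuous_01 (T f))
  (T_linear : forall (a : K) f g, muntz_L1 Lambda f -> muntz_L1 Lambda g ->
     T (a *: f + g) = a *: T f + T g).

Definition small_image_property (B : R) (n : nat) : Prop :=
  forall (E : set (R -> K)) (e : 'I_n -> R -> K), linear_subspace E ->
    E `<=` muntz_L1 Lambda -> linearly_independent e -> (forall i, E (e i)) ->
    forall eps : R, 0 < eps -> exists f,
      [/\ E f, L1_norm f = 1%E & (sup_norm (T f) <= (B + eps)%:E)%E].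

(** One part only and real dimension [n.+1] give [C / (2 * n + 1)]. *)
Lemma small_image_real n : s = RealScalars ->
  small_image_property (C / (2 * n%:R + 1)) n.+1.
Proof.
move=> sR E e El EX e_free Ee eps eps0.
have [||c [c1 cT]] := @small_image_parts R s Lambda T C C0 TC
    T_continuous T_linear E El EX n e true [::] Ee _ _ eps eps0.
- move=> c /e_free c0 i; apply: (@of_parts_real_inj R s); rewrite of_parts0; exact: c0.
- by move=> z [|]; rewrite ?inE// => _; exact: part_false_real.
have Ef := @subspace_sum R s E El _ (index_enum 'I_n.+1) (fun i => of_parts s (c i) 0) e Ee.
exists (\sum_i of_parts s (c i) 0 *: e i); split=> //.
  by rewrite (L1_normE (muntz_integrable (EX _ Ef))) c1.
apply: ge_ereal_sup => _ [x x01 <-]; rewrite lee_fin modulus_real_scalars//.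
have {}x01 : 0 <= x <= 1 by move: x01; rewrite /= in_itv.
by have := cT true x x01; rewrite /= mulr0 add0r mul1r.
Qed.

(** As a real space the subspace has twice as many dimensions, with basis the [e j] and
the [i * e j]. *)
Lemma small_image_complex n : s = ComplexScalars ->
  small_image_property (2 * C / n.+1%:R) n.+1.
Proof.
move=> sC E e El EX e_free Ee eps eps0.
pose g (i : 'I_(n.+1 + n.+1)) : R -> K := match fintype.split i with
  | inl j => e j | inr j => of_parts s 0 1 *: e j end.
have gl j : g (lshift n.+1 j) = e j.
  by rewrite /g (unsplitK (inl j : 'I_n.+1 + 'I_n.+1)%type).
have gr j : g (rshift n.+1 j) = of_parts s 0 1 *: e j.
  by rewrite /g (unsplitK (inr j : 'I_n.+1 + 'I_n.+1)%type).
have Eg i : E (g i).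
  rewrite /g; case: fintype.split => j //.
  by rewrite -[_ *: _]addr0; apply: subspace_lin => //; exact: subspace0.
have parts (a b : R) b' : part b' (of_parts s a b) = if b' then a else b.
  by rewrite part_of_parts// sC.
have eps2 : 0 < eps / 2 by rewrite divr_gt0.
have [||c [c1 cT]] := @small_image_parts R s Lambda T C C0 TC
    T_continuous T_linear E El EX (n + n.+1) g true [:: false] Eg _ _ _ eps2.
- rewrite -[(n + n.+1).+1]/(n.+1 + n.+1)%N => c.
  rewrite big_split_ord /= => H.
  have coef j : of_parts s (c (lshift n.+1 j)) 0 +
      of_parts s (c (rshift n.+1 j)) 0 * of_parts s 0 1 = 0 :> K.
    apply: (e_free (fun j => of_parts s (c (lshift n.+1 j)) 0 +
      of_parts s (c (rshift n.+1 j)) 0 * of_parts s 0 1)).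
    rewrite -[RHS]H -big_split; apply: eq_bigr => l _.
    by rewrite gl gr scalerA; exact: scalerDl.
  have cl j : c (lshift n.+1 j) = 0.
    have := congr1 (part true) (coef j).
    by rewrite partD part_real !parts mulr0 addr0 part0.
  have cr j : c (rshift n.+1 j) = 0.
    have := congr1 (part false) (coef j).
    by rewrite partD part_real !parts mulr1 add0r part0.
  move=> i; rewrite -(fintype.splitK i).
  by case: fintype.split => j; [exact: cl|exact: cr].
- by move=> z [|].
have Ef := @subspace_sum R s E El _ (index_enum 'I_(n + n.+1).+1)
  (fun i => of_parts s (c i) 0) g Eg.
exists (\sum_i of_parts s (c i) 0 *: g i); split=> //.
  by rewrite (L1_normE (muntz_integrable (EX _ Ef))) c1.
have -> : 2 * C / n.+1%:R + eps = 2 * (C / n.+1%:R + eps / 2).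
  by rewrite mulrDr mulrA [2 * (eps / 2)]mulrC divfK ?pnatr_eq0.
apply: sup_norm_le => b x x01; apply: le_trans (cT b x x01) _; rewrite lerD2r.
have n0 : 0 <= n%:R :> R by [].
rewrite -natr1 natrD -natr1 /= mulrDr mulr1.
rewrite ler_pdivrMr; last by lra.
rewrite mulrAC ler_pdivlMr; last by lra.
by have := mulr_ge0 (ltW C0) n0; lra.
Qed.

Lemma small_image n : small_image_property (2 * C / n.+1%:R) n.+1.
Proof.
case: (boolP (asbool (s = RealScalars))) => [/asboolP sR|/asboolP sC]; last first.
  by apply: small_image_complex; case: s sC.
move=> E e El EX e_free Ee eps eps0.
have [f [Ef f1 fT]] := small_image_real sR El EX e_free Ee eps0.
exists f; split=> //; apply: le_trans fT _; rewrite lee_fin lerD2r.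
have n0 : 0 <= n%:R :> R by [].
rewrite ler_pdivrMr; last by lra.
rewrite mulrAC ler_pdivlMr ?ltr0n// -[n.+1%:R]natr1.
by have := mulr_ge0 (ltW C0) n0; move: (ltW C0); lra.
Qed.

Lemma finitely_strictly_singular_small_image :
  finitely_strictly_singular (@muntz_L1 R s Lambda) (@L1_norm R s) (@sup_norm R s) T.
Proof.
move=> eps eps0; pose N := (Num.truncn (4 * C / eps)).+1.
exists N => // E El EX [e e_free Ee].
have eps2 : 0 < eps / 2 by rewrite divr_gt0.
have [f [Ef f1 fT]] := small_image El EX e_free Ee eps2.
exists f; split=> //; apply: le_trans fT _; rewrite lee_fin.
have : 2 * C / N.+1%:R <= eps / 2.
  rewrite ler_pdivrMr ?ltr0n//.
  have : 4 * C / eps < N.+1%:R.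
    by apply: lt_trans (truncnS_gt _) _; rewrite ltr_nat.
  by rewrite ltr_pdivrMr//; lra.
by move=> h; rewrite [leRHS]splitr lerD2r.
Qed.

Lemma finite_span_linear n (e : 'I_n -> R -> K) : linear_subspace (finite_span e).
Proof.
split; first by rewrite inE; exists (fun=> 0) => //; rewrite big1// => i _; rewrite scale0r.
move=> a u v; rewrite !inE => -[c _ <-] [c' _ <-].
exists (fun i => a * c i + c' i) => //.
rewrite scaler_sumr -big_split; apply: eq_bigr => i _ /=.
by rewrite scalerDl scalerA.
Qed.

Lemma finite_span_mem n (e : 'I_n -> R -> K) i : finite_span e (e i).
Proof.
exists (fun j => (j == i)%:R) => //; rewrite (bigD1 i)//= eqxx scale1r big1 ?addr0//.
by move=> j /negPf ->; rewrite scale0r.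
Qed.

Lemma bernstein_number_le (B : R) n : small_image_property B n ->
  (bernstein_number (@muntz_L1 R s Lambda) (@L1_norm R s) (@sup_norm R s) T n
    <= B%:E)%E.
Proof.
move=> H; apply: ge_ereal_sup => _ [E [EX [e e_free EE]] <-].
apply/lee_addgt0Pr => eps eps0.
have El : linear_subspace E by rewrite EE; exact: finite_span_linear.
have Ee i : E (e i) by rewrite EE; exact: finite_span_mem.
have [f [Ef f1 fT]] := H E e El EX e_free Ee eps eps0.
apply: le_trans fT; apply: ereal_inf_lbound.
by exists f.
Qed.
End bernstein_upper.

(** * Lower bounds for Bernstein numbers *)

Section restricted_polynomials.
Variables (R : realType) (s : scalars).
Local Notation K := (scalar_field R s).
Local Notation mu := (@lebesgue_measure R).
Variable Lambda : nat -> R.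
Hypothesis Lambda_ge0 : forall k, 0 <= Lambda k.

Definition restrict01 (p : R -> K) : R -> K := fun t => if 0 <= t < 1 then p t else 0.

Lemma integrable01_restrict (g h : R -> R) : integrable01 g ->
  (forall t, 0 <= t < 1 -> h t = g t) -> (forall t, ~~ (0 <= t < 1) -> h t = 0) ->
  integrable01 h.
Proof.
move=> ig hg h0.
have -> : h = g \_ `[0, 1[.
  apply: funext => t; rewrite patchE; case: ifPn => t01.
    by apply: hg; move: t01; rewrite inE /= in_itv.
  by apply: h0; apply: contra t01; rewrite inE /= in_itv.
rewrite /integrable01 -restrict_EFin; apply/integrable_restrict => //.
apply: integrableS ig => //; exact: measurableI.
Qed.

Lemma muntz_restrict01 p : muntz_span Lambda p -> muntz_L1 Lambda (restrict01 p).
Proof.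
move=> ps; have pi := integrable_span Lambda_ge0 ps.
have in01 t : 0 <= t < 1 -> restrict01 p t = p t by rewrite /restrict01 => ->.
have out01 t : ~~ (0 <= t < 1) -> restrict01 p t = 0 by rewrite /restrict01 => /negPf ->.
have ri : integrable_on `[0, 1] (restrict01 p).
  apply: integrable_onP => b; apply: (integrable01_restrict (integrable_part b pi)).
    by move=> t /in01 /= ->.
  by move=> t /out01 /= ->; exact: part0.
split; [split=> //| |exact: out01].
  move=> e e0; exists p => //.
  have di := integrable_onB ri pi.
  rewrite (L1_normE di) lte_fin /L1 /primitive -Rintegral_itv_bndo_bndc; last first.
    apply: integrableS (integrable_modulus di) => // t /=.
    by rewrite !in_itv /= => /andP[-> /ltW].
  rewrite (_ : Rintegral _ _ _ = \int[mu]_(t in `[0, 1[) 0).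
    by rewrite Rintegral_cst// mul0r.
  apply: eq_Rintegral => t; rewrite inE /= in_itv /= => t01.
  by rewrite -[(restrict01 p - p) t]/(restrict01 p t - p t) in01// subrr modulus0.
apply: continuous_within_parts => b.
case: ps => n [c _ cp].
apply: (@subspace_eq_continuous _ _ _ (fun t => \sum_(k < n) part b (c k) * t `^ Lambda k)).
  move=> t; rewrite inE /= in_itv /= => t01.
  by rewrite -[RHS]/(part b (restrict01 p t)) in01// -cp part_span.
suff : {within `[(0 : R), 1], continuous (fun t => \sum_(k < n) part b (c k) * t `^ Lambda k)}.
  by apply: continuous_subspaceW => t /=; rewrite !in_itv /= => /andP[-> /ltW].
elim: n c {cp} => [|n IH] c.
  have -> : (fun t : R => \sum_(k < 0) part b (c k) * t `^ Lambda k) = cst 0.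
    by apply: funext => t; rewrite big_ord0.
  by move=> x; exact: cvg_cst.
have -> : (fun t : R => \sum_(k < n.+1) part b (c k) * t `^ Lambda k) =
    (fun t => \sum_(k < n) part b (c (widen_ord (leqnSn n) k)) * t `^ Lambda k +
      part b (c ord_max) * t `^ Lambda n).
  by apply: funext => t; rewrite big_ord_recr.
move=> x; apply: cvgD; first exact: (IH (fun k => c (widen_ord (leqnSn n) k))).
by apply: cvgM; [exact: cvg_cst|exact: continuous_within_powR].
Qed.

Lemma muntz_span_subsequence (k : nat -> nat) n (a : 'I_n -> K) :
  muntz_span Lambda (\sum_(i < n) a i *: @monomial R s (Lambda (k i))).
Proof.
pose N := (\max_(i < n) k i).+1.
have kN (i : 'I_n) : (k i < N)%N by rewrite ltnS; exact: leq_bigmax.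
exists N, (fun m : 'I_N => \sum_(i < n | Ordinal (kN i) == m) a i) => //.
under eq_bigr do rewrite scaler_suml.
rewrite (exchange_big_dep xpredT)//=; apply: eq_bigr => i _.
by rewrite (big_pred1 (Ordinal (kN i)))// => j; rewrite /= eq_sym.
Qed.

End restricted_polynomials.

Section lacunary.
Variables (R : realType) (Lambda : nat -> R).
Hypotheses (Lambda_ge0 : forall k, 0 <= Lambda k)
  (Lambda_incr : forall j k, (j < k)%N -> Lambda j < Lambda k)
  (Lambda_unbounded : forall M, exists k, M < Lambda k).

(** The point [x j] is chosen close enough to 1 for the exponent number [k j], and the next
exponent large enough for [x j]; by monotonicity, at [x j] all powers up to number [j]
are almost 1 and all later ones almost 0. *)
Lemma lacunary_sequence (del : R) : 0 < del < 1 -> exists k (x : nat -> R), forall j,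
  [/\ (k j < k j.+1)%N, 0 < x j < 1, x j `^ (Lambda (k j) + 1) = 1 - del &
      x j `^ (Lambda (k j.+1) + 1) <= del].
Proof.
move=> /andP[del0 del1].
pose X m := (1 - del) `^ (Lambda m + 1)^-1.
have Lp m : 0 < Lambda m + 1 by have := Lambda_ge0 m; lra.
have X0 m : 0 < X m by rewrite powR_gt0//; lra.
have XE m : X m `^ (Lambda m + 1) = 1 - del.
  by rewrite -powRrM mulVf ?gt_eqF// powRr1//; lra.
have X1 m : X m < 1.
  rewrite ltNge; apply/negP => X1; have : 1 `^ (Lambda m + 1) <= X m `^ (Lambda m + 1).
    by rewrite ge0_ler_powR ?nnegrE// ltW.
  by rewrite powR1 XE; lra.
have next m : exists m', (m < m')%N /\ X m `^ (Lambda m' + 1) <= del.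
  have lnX : ln (X m) < 0 by apply: ln_lt0; rewrite X0 X1.
  have [m' hm'] := Lambda_unbounded (Num.max (Lambda m) (ln del / ln (X m))).
  move: hm'; rewrite gt_max => /andP[h1 h2]; exists m'; split.
    rewrite ltnNge leq_eqVlt; apply/negP => /orP[/eqP E|/Lambda_incr]; last by lra.
    by rewrite E ltxx in h1.
  rewrite /powR gt_eqF// -[leRHS](lnK (x := del)) ?posrE// ler_expR.
  by move: h2; rewrite ltr_ndivrMr// => h; lra.
have [nxt nxtP] := choice next.
pose k := fix k j := if j is j'.+1 then nxt (k j') else 0%N.
exists k, (fun j => X (k j)) => j; have [h1 h2] := nxtP (k j).
by split=> //; rewrite X0 X1.
Qed.

End lacunary.

Section bernstein_lower.
Variables (R : realType) (s : scalars).
Local Notation K := (scalar_field R s).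
Variable Lambda : nat -> R.
Hypotheses (Lambda_ge0 : forall k, 0 <= Lambda k)
  (Lambda_incr : forall j k, (j < k)%N -> Lambda j < Lambda k)
  (Lambda_unbounded : forall M, exists k, M < Lambda k).

Lemma sum_modulus_lt (a : nat -> K) n (S : R) :
  (forall j, (j <= n)%N -> modulus (\sum_(i < j.+1) a i) < S) ->
  \sum_(i < n.+1) modulus (a i) < (2 * n%:R + 1) * S.
Proof.
elim: n => [|n IH] H.
  by have := H 0%N (leqnn _); rewrite !big_ord1 mulr0 add0r mul1r.
have {}IH := IH (fun j jn => H j (leqW jn)).
rewrite big_ord_recr /=; have h1 := H n (leqnSn _); have h2 := H n.+1 (leqnn _).
have : modulus (a n.+1) <= modulus (\sum_(i < n.+2) a i) + modulus (\sum_(i < n.+1) a i).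
  have {1}-> : a n.+1 = \sum_(i < n.+2) a i - \sum_(i < n.+1) a i.
    by rewrite [X in _ = X - _]big_ord_recr /= addrAC subrr add0r.
  exact: modulusB.
by rewrite -[n.+1%:R]natr1; lra.
Qed.

(** The first term is a partial sum and each other term is a difference of two, which
gives [2 n + 1] summands. *)
Lemma large_partial_sum (a : nat -> K) n : exists2 j, (j <= n)%N &
  \sum_(i < n.+1) modulus (a i) <= (2 * n%:R + 1) * modulus (\sum_(i < j.+1) a i).
Proof.
have n0 : 0 <= n%:R :> R by [].
have m0 : 0 < 2 * n%:R + 1 :> R by lra.
apply: contrapT => /forall2NP H.
have := @sum_modulus_lt a n ((\sum_(i < n.+1) modulus (a i)) / (2 * n%:R + 1)).
rewrite mulrCA divff ?gt_eqF// mulr1 ltxx => /(_ _)/negP[]// j jn.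
rewrite ltr_pdivlMr// mulrC ltNge; apply/negP => h.
by case: (H j) => // /(_ jn).
Qed.

Section lacunary_span.
Variables (n : nat) (del : R) (k : nat -> nat) (x : nat -> R).
Hypotheses (del0 : 0 < del)
  (kx : forall j, [/\ (k j < k j.+1)%N, 0 < x j < 1,
    x j `^ (Lambda (k j) + 1) = 1 - del & x j `^ (Lambda (k j.+1) + 1) <= del]).

Let lam i := Lambda (k i).

Definition lacunary_vector (i : 'I_n.+1) : R -> K :=
  restrict01 (of_parts s (lam i + 1) 0 *: @monomial R s (lam i)).

Let lam1 i : 0 < lam i + 1. Proof. by have := Lambda_ge0 (k i); rewrite /lam; lra. Qed.

Let k_incr i j : (i <= j)%N -> (k i <= k j)%N.
Proof.
elim: j => [|j IH]; first by rewrite leqn0 => /eqP ->.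
rewrite leq_eqVlt => /predU1P[->//|/IH h]; apply: leq_trans h _.
by case: (kx j) => /ltnW.
Qed.

Let lam_incr i j : (i <= j)%N -> lam i <= lam j.
Proof.
move=> /k_incr; rewrite leq_eqVlt => /predU1P[E|/Lambda_incr/ltW//].
by rewrite /lam E.
Qed.

Let comb (a : 'I_n.+1 -> K) : R -> K := \sum_i a i *: lacunary_vector i.

Let combE a : comb a = restrict01
  (\sum_i (a i * of_parts s (lam i + 1) 0) *: @monomial R s (lam i)).
Proof.
apply: funext => t; rewrite /comb /restrict01 !fct_sumE.
case: ifPn => t01; last first.
  rewrite big1// => i _; rewrite -[LHS]/(a i * lacunary_vector i t).
  by rewrite /lacunary_vector /restrict01 (negPf t01) mulr0.
apply: eq_bigr => i _; rewrite -[LHS]/(a i * lacunary_vector i t).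
by rewrite /lacunary_vector /restrict01 t01 -scalerA.
Qed.

Lemma lacunary_in_muntz a : muntz_L1 Lambda (comb a).
Proof. by rewrite combE; apply: muntz_restrict01 => //; exact: muntz_span_subsequence. Qed.

Let part_comb a b t : 0 <= t < 1 ->
  part b (comb a t) = \sum_i (part b (a i) * (lam i + 1)) * t `^ lam i.
Proof.
move=> t01; rewrite combE /restrict01 t01 fct_sumE part_sum; apply: eq_bigr => i _.
rewrite -[X in part b X]/(a i * of_parts s (lam i + 1) 0 * of_parts s (t `^ lam i) 0).
by rewrite -mulrA -of_parts_realM mulrC part_real; ring.
Qed.

Let A (a : 'I_n.+1 -> K) := \sum_i modulus (a i).

Lemma lacunary_L1_le a : L1 (comb a) <= A a.
Proof.
pose c i := modulus (a i) * (lam i + 1).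
have ic : integrable01 (fun t => \sum_(i < n.+1) c i * t `^ lam i).
  by apply: (@integrable01_sum R _ _ c) => i; apply: integrable01_powR; exact: Lambda_ge0.
apply: (@le_trans _ _ (primitive (fun t => \sum_(i < n.+1) c i * t `^ lam i) 1)).
  apply: le_Rintegral => //.
    exact/integrable_modulus/muntz_integrable/lacunary_in_muntz.
  move=> t /=; rewrite in_itv /= => /andP[t0 t1].
  have c0 i : 0 <= c i * t `^ lam i.
    by rewrite !mulr_ge0 ?modulus_ge0 ?powR_ge0// ltW.
  rewrite combE /restrict01; case: ifPn => _; last by rewrite modulus0 sumr_ge0.
  rewrite fct_sumE; apply: le_trans (modulus_sum _ _ _) _; apply: ler_sum => i _.
  rewrite -[X in modulus X]/(a i * of_parts s (lam i + 1) 0 * of_parts s (t `^ lam i) 0).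
  by rewrite !modulusM !modulus_real !ger0_norm ?powR_ge0// ltW.
rewrite (@primitive_sum R _ _ c)//; last first.
  by move=> i; apply: integrable01_powR; exact: Lambda_ge0.
apply: ler_sum => i _.
rewrite (_ : primitive _ 1 = 1 `^ (lam i + 1) / (lam i + 1)); last first.
  by apply: primitive_powR => //; exact: Lambda_ge0.
by rewrite powR1 /c mul1r -mulrA divff ?mulr1// gt_eqF.
Qed.

Let volterra_comb a y : 0 < y < 1 ->
  volterra_op (comb a) y = \sum_i a i * of_parts s (y `^ (lam i + 1)) 0.
Proof.
move=> /andP[y0 y1]; apply: part_eq => b; rewrite part_volterra part_sum.
rewrite (_ : primitive _ y =
    primitive (fun t => \sum_(i < n.+1) (part b (a i) * (lam i + 1)) * t `^ lam i) y); last first.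
  apply: eq_Rintegral => t; rewrite inE /= in_itv /= => /andP[t0 ty].
  by apply: part_comb; rewrite t0 (le_lt_trans ty).
rewrite (@primitive_sum R _ _ (fun i => part b (a i) * (lam i + 1))); last exact: ltW.
  2: by move=> i; apply: integrable01_powR; exact: Lambda_ge0.
apply: eq_bigr => i _.
rewrite (_ : primitive _ y = y `^ (lam i + 1) / (lam i + 1)); last first.
  by apply: primitive_powR; [exact: Lambda_ge0|exact: ltW].
rewrite [in RHS]mulrC part_real.
by field; rewrite gt_eqF.
Qed.

(** At [x j] the image of the combination is nearly the partial sum of its coefficients
up to [j]. *)
Lemma lacunary_volterra_ge a : exists2 y, 0 < y < 1 &
  A a * (1 / (2 * n%:R + 1) - del) <= modulus (volterra_op (comb a) y).
Proof.
pose a' i := a (inord i).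
have aE (i : 'I_n.+1) : a i = a' i by rewrite /a' inord_val.
have [j jn hj] := large_partial_sum a' n.
have [_ xj _ _] := kx j; exists (x j) => //; rewrite volterra_comb//.
have /andP[x0 x1] := xj.
set s_j := \sum_(i < j.+1) a' i in hj.
have sE : s_j = \sum_(i < n.+1) a i * of_parts s (i <= j)%N%:R 0.
  rewrite /s_j (big_ord_widen n.+1 a')// big_mkcond /=; apply: eq_bigr => i _.
  by rewrite ltnS aE; case: leqP => _; rewrite ?of_parts1 ?of_parts0 ?mulr1 ?mulr0.
set v := \sum_(i < n.+1) _.
have vs : modulus (v - s_j) <= del * A a.
  rewrite sE /v -sumrB /A mulr_sumr.
  apply: le_trans (modulus_sum _ _ _) _; apply: ler_sum => i _.
  rewrite -mulrBr modulusM mulrC ler_wpM2r ?modulus_ge0//.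
  have -> : of_parts s (x j `^ (lam i + 1)) 0 - of_parts s (i <= j)%N%:R 0 =
      of_parts s (x j `^ (lam i + 1) - (i <= j)%N%:R) 0.
    by apply: part_eq => -[]; rewrite partB !part_of_parts ?subrr.
  rewrite modulus_real ler_norml.
  have pw u w : u <= w -> x j `^ w <= x j `^ u by move=> uw; rewrite ger_powR// x0 ltW.
  have [_ _ e1 e2] := kx j.
  have p0 : 0 <= x j `^ (lam i + 1) by exact: powR_ge0.
  case: leqP => [ij|ji].
    have p1 : x j `^ (lam i + 1) <= 1.
      by have := pw 0 (lam i + 1) (ltW (lam1 i)); rewrite powRr0.
    have : 1 - del <= x j `^ (lam i + 1).
      by rewrite -e1 pw// lerD2r; exact: lam_incr.
    by move=> h; rewrite mulr1n; apply/andP; split; move: del0 h p1; lra.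
  have : x j `^ (lam i + 1) <= del.
    by apply: le_trans e2; rewrite pw// lerD2r; exact: lam_incr.
  by move=> h; rewrite mulr0n subr0; apply/andP; split; move: del0 h p0; lra.
have sj : A a / (2 * n%:R + 1) <= modulus s_j.
  have n0 : 0 <= n%:R :> R by [].
  rewrite ler_pdivrMr; last by lra.
  by rewrite mulrC; apply: le_trans hj; rewrite /A; under eq_bigr do rewrite aE.
have : modulus s_j <= modulus v + modulus (v - s_j).
  by rewrite -{1}(subKr v s_j) modulusB.
by rewrite mulrBr mulrA mulr1; lra.
Qed.

End lacunary_span.

(** For well separated exponents the normalized powers have an L1 norm at most the sum
[A] of the moduli of the coefficients, while the image has sup norm at least nearly
[A / (2 n + 1)].  The same inequality shows that the powers are independent. *)
Lemma bernstein_number_ge n (T : (R -> K) -> R -> K) :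
  (forall f y, muntz_L1 Lambda f -> 0 < y < 1 ->
     modulus (volterra_op f y) <= modulus (T f y)) ->
  ((1 / (2 * n%:R + 1))%:E <=
    bernstein_number (@muntz_L1 R s Lambda) (@L1_norm R s) (@sup_norm R s) T n.+1)%E.
Proof.
move=> TV.
have n0 : 0 <= n%:R :> R by [].
pose c : R := 1 / (2 * n%:R + 1).
have c0 : 0 < c by rewrite divr_gt0//; lra.
have c1 : c <= 1 by rewrite ler_pdivrMr ?mul1r; lra.
apply/lee_addgt0Pr => eps eps0; rewrite -leeBlDr// -EFinB -/c.
pose del := Num.min eps (c / 2).
have del0 : 0 < del by rewrite lt_min eps0 divr_gt0.
have del1 : del < c by rewrite gt_min; apply/orP; right; lra.
have [k [x kx]] : exists k (x : nat -> R), forall j,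
    [/\ (k j < k j.+1)%N, 0 < x j < 1, x j `^ (Lambda (k j) + 1) = 1 - del &
      x j `^ (Lambda (k j.+1) + 1) <= del].
  by apply: lacunary_sequence => //; rewrite del0; lra.
pose e := @lacunary_vector n k.
pose comb (a : 'I_n.+1 -> K) := \sum_i a i *: e i.
have combX a : muntz_L1 Lambda (comb a) by exact: lacunary_in_muntz.
apply: (@le_trans _ _ (ereal_inf [set sup_norm (T v) | v in
   [set v | finite_span e v /\ L1_norm v = 1%E]])); last first.
  apply: ereal_sup_ubound; exists (finite_span e) => //; split.
    by move=> _ [a _ <-]; exact: combX.
  exists e => // a a0 i; apply: modulus_eq0.
  have [y y01] := lacunary_volterra_ge del0 kx a.
  rewrite -/e -/(comb a) (_ : comb a = 0)//.
  have -> : volterra_op (0 : R -> K) y = 0.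
    apply: part_eq => b; rewrite part_volterra part0 /primitive.
    rewrite (_ : part b \o 0 = cst 0); last by apply: funext => t; exact: part0.
    by rewrite Rintegral_cst// mul0r.
  rewrite modulus0 -/c -[leRHS](mul0r (c - del)) ler_pM2r ?subr_gt0// => A0.
  apply/eqP; rewrite eq_le modulus_ge0 andbT; apply: le_trans A0.
  by rewrite (bigD1 i)//= lerDl sumr_ge0// => l _; exact: modulus_ge0.
apply/ereal_infP => _ [v [[a _ <-] v1] <-].
have Xv := combX a.
have l1 : 1 <= \sum_i modulus (a i).
  have := lacunary_L1_le k a; rewrite -/e -/(comb a).
  by move: v1; rewrite -/(comb a) (L1_normE (muntz_integrable Xv)) => -[->].
have [y y01 hy] := lacunary_volterra_ge del0 kx a.
apply: (@le_trans _ _ (modulus (T (comb a) y))%:E); last first.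
  apply: ereal_sup_ubound; exists y => //=.
  by have /andP[h1 h2] := y01; rewrite in_itv/= !ltW.
rewrite lee_fin; apply: le_trans (TV _ _ Xv y01); apply: le_trans hy.
apply: (@le_trans _ _ (c - del)); first by rewrite lerB// ge_min lexx.
by rewrite -/c ler_peMl// subr_ge0 ltW.
Qed.

End bernstein_lower.

(** * The theorem *)

Section muntz_condition.
Variables (R : realType) (Lambda : nat -> R).
Hypotheses (Lambda_ge0 : forall k, 0 <= Lambda k)
  (Lambda_incr : forall j k, (j < k)%N -> Lambda j < Lambda k)
  (Lambda_muntz : muntz_condition Lambda).

Lemma muntz_partial_sums : exists S, forall n,
  \sum_(k < n | Lambda k != 0) (Lambda k)^-1 <= S.
Proof.
have inv0 k : (0 <= ((Lambda k)^-1)%:E)%E by rewrite lee_fin invr_ge0.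
exists (fine (\sum_(0 <= k <oo | Lambda k != 0%R) ((Lambda k)^-1)%:E)%E) => n.
rewrite -lee_fin fineK; last first.
  by rewrite ge0_fin_numE//; apply: nneseries_ge0.
rewrite -sumEFin -(big_mkord (fun k => Lambda k != 0) (fun k => ((Lambda k)^-1)%:E)).
exact: nneseries_lim_ge.
Qed.

Lemma muntz_unbounded M : exists k, M < Lambda k.
Proof.
have [S LS] := muntz_partial_sums.
apply: contrapT => /forallNP H.
have {}H k : Lambda k <= M by rewrite leNgt; apply/negP/H.
have pos k : 0 < Lambda k.+1 by apply: le_lt_trans (Lambda_incr (ltnSn k)).
have M0 : 0 < M by exact: lt_le_trans (pos 0%N) (H 1%N).
pose n := (Num.truncn (S * M)).+1.
have : n%:R / M <= S.
  apply: le_trans (LS n.+1); rewrite big_mkcond big_ord_recl /=.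
  apply: (@le_trans _ _ (\sum_(k < n) M^-1)).
    by rewrite sumr_const card_ord -[M^-1 *+ n]mulr_natl.
  rewrite -[leLHS]add0r; apply: lerD.
    by case: ifP => // _; rewrite invr_ge0.
  by apply: ler_sum => k _; rewrite gt_eqF //= lef_pV2 ?posrE.
rewrite ler_pdivrMr// leNgt => /negP; apply.
exact: truncnS_gt.
Qed.

End muntz_condition.

Theorem theorem5p3 (R : realType) (s : scalars) (Lambda : nat -> R)
  (Lambda_ge0 : forall n, 0 <= Lambda n)
  (Lambda_incr : forall m n, (m < n)%N -> Lambda m < Lambda n)
  (Lambda_muntz : muntz_condition Lambda) :
  let X := @muntz_L1 R s Lambda in
  let V := @volterra_op R s in
  let Gamma := @cesaro_op R s in
  let operator := bounded_linear_operator X (@L1_norm R s)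
                    (@continuous_01 R s) (@sup_norm R s) in
  let fss := finitely_strictly_singular X (@L1_norm R s) (@sup_norm R s) in
  let b T n := bernstein_number X (@L1_norm R s) (@sup_norm R s) T n in
  [/\ operator V /\ operator Gamma,
      fss V /\ fss Gamma,
      forall T, T = V \/ T = Gamma ->
        exists c C : R, [/\ 0 < c, 0 < C &
          forall n : nat, (1 <= n)%N ->
            ((c / n%:R)%:E <= b T n)%E /\ (b T n <= (C / n%:R)%:E)%E],
      forall n : nat, (1 <= n)%N ->
        ((1 / (2 * n%:R - 1))%:E <= b V n)%E /\
        ((1 / (2 * n%:R - 1))%:E <= b Gamma n)%E &
      s = RealScalars -> forall n : nat, (1 <= n)%N ->
        b V n = (1 / (2 * n%:R - 1))%:E].
Proof.
move=> X V Gamma operator fss b.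
have [S LS] := muntz_partial_sums Lambda_ge0 Lambda_muntz.
have Lunb := muntz_unbounded Lambda_ge0 Lambda_incr Lambda_muntz.
have Vvar : variation_bounded Lambda 1 V by exact: volterra_variation_bounded.
have [C C0 Gvar] := @cesaro_variation_bounded R s Lambda S Lambda_ge0 Lambda_incr LS.
have Vcont f : X f -> continuous_01 (V f).
  by move=> Xf; apply: volterra_continuous; exact: muntz_integrable Xf.
have Gcont f : X f -> continuous_01 (Gamma f) by exact: cesaro_continuous.
have Vlin a f g : X f -> X g -> V (a *: f + g) = a *: V f + V g by exact: volterra_linear.
have Glin a f g : X f -> X g -> Gamma (a *: f + g) = a *: Gamma f + Gamma g.
  exact: cesaro_linear.
have nE n : 2 * n.+1%:R - 1 = 2 * n%:R + 1 :> R by rewrite -[n.+1%:R]natr1; ring.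
have Vlow n : ((1 / (2 * n.+1%:R - 1))%:E <= b V n.+1)%E.
  by rewrite nE; apply: bernstein_number_ge.
have Glow n : ((1 / (2 * n.+1%:R - 1))%:E <= b Gamma n.+1)%E.
  rewrite nE; apply: bernstein_number_ge => // f y _ /andP[y0 y1].
  rewrite /Gamma /cesaro_op gt_eqF// modulusM modulus_real gtr0_norm ?invr_gt0//.
  by rewrite ler_peMl ?modulus_ge0// invf_ge1// ltW.
have order T CT : 0 < CT -> variation_bounded Lambda CT T ->
    (forall f, X f -> continuous_01 (T f)) ->
    (forall a f g, X f -> X g -> T (a *: f + g) = a *: T f + T g) ->
    (forall n, ((1 / (2 * n.+1%:R - 1))%:E <= b T n.+1)%E) ->
    exists c C : R, [/\ 0 < c, 0 < C &
          forall n : nat, (1 <= n)%N ->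
            ((c / n%:R)%:E <= b T n)%E /\ (b T n <= (C / n%:R)%:E)%E].
  move=> CT0 Tvar Tcont Tlin Tlow; exists 2^-1, (2 * CT); split.
  - by rewrite invr_gt0.
  - by rewrite mulr_gt0.
  - case=> // n _; split.
      apply: le_trans (Tlow n); rewrite lee_fin nE.
      have n0 : 0 <= n%:R :> R by [].
      rewrite ler_pdivlMr; last by lra.
      rewrite mulrAC ler_pdivrMr ?ltr0n// -[n.+1%:R]natr1; lra.
    exact: bernstein_number_le (small_image CT0 Tvar Tcont Tlin (n := n)).
split.
- by split; [exact: averaging_operator_bounded Vvar Vcont Vlin|
             exact: averaging_operator_bounded (ltW C0) Gvar Gcont Glin].
- by split; [exact: finitely_strictly_singular_small_image Vvar Vcont Vlin|
             exact: finitely_strictly_singular_small_image Gvar Gcont Glin].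
- by move=> T [->|->]; [exact: order Vvar _ _ _|exact: order Gvar _ _ _].
- by case=> // n _.
- move=> sR [//|n] _; apply/eqP; rewrite eq_le Vlow andbT nE.
  exact: bernstein_number_le (small_image_real ltr01 Vvar Vcont Vlin sR (n := n)).
Qed.
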